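(* Consider a random rooted planar map $M$ with $n$ edges, $m+1$ vertices, and $n-m+1$ faces, with two of the vertices designated ''seed'' and ''target'', chosen uniformly among all such decorated maps except that the probability of a given decorated map is proportional to the number of spanning trees the map has. Conditional on $M$, one may generate a loop-erased random walk $L$ from the seed to the target. Given $M$, one may also generate an edge-based DLA growth process, which yields a random tree $D$ containing the seed and the target. Then: (i) The number of edges in $D$ agrees in law with the number of edges in $L$. (ii) The law of the map obtained by unzipping the first $k$ steps of $L$ (to produce a map with a grey polygon with distinguished tip) is the same as the law of the map obtained by unzipping the first $k$ steps of $D$. (iii) The law of the map obtained by unzipping all of the edges of $L$ agrees with the law of the map obtained by unzipping all of the edges of $D$.
   Context: **Loop-erased random walk.** $L$ is the simple path obtained as the chronological loop erasure of a simple random walk on $M$ started at the seed and stopped at the target. **Edge-based DLA.** Start with the cluster consisting of the seed alone. At each step run a simple random walk on $M$ from the target until it first hits the cluster, and add to the cluster the last edge traversed before the cluster is hit (together with its endpoint outside the cluster). Stop when the target belongs to the cluster. The final cluster is the tree $D$; the $k$th step of $D$ is the $k$th edge added. **Unzipping.** To unzip an edge $e$ is to cut the map open along it. Initially the distinguished grey polygon is just the seed vertex. If $e$ joins a vertex $v$ of the boundary of the current grey polygon to a vertex $w$ not on it, then unzipping $e$ replaces $e$ by two parallel copies, splitting $v$ into two copies (except for the first edge, when the seed is not split), so that the grey polygon has two additional boundary edges; the new tip is $w$. Thus unzipping the first edge produces a grey 2-gon, and after $k$ edges are unzipped one has a map with a distinguished grey $2k$-gon with a distinguished boundary vertex, the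 tip, together with the target vertex. For $L$ the edges are unzipped in order along the path starting from the seed; for $D$ they are unzipped in the order in which they were added. *)

(* Defs.v *)
From HB Require Import structures.
From mathcomp Require Import all_boot all_order all_algebra all_fingroup.
From mathcomp Require Import boolp classical_sets reals ereal esum.

Set Implicit Arguments.
Unset Strict Implicit.
Unset Printing Implicit Defensive.

Import Order.TTheory GRing.Theory Num.Theory.

(* A map is given by its darts (oriented edges): [vrot] sends a dart to the
   next one around its origin, [drev] reverses darts.  Vertices are the cycles
   of [vrot], as sets of darts; faces are the cycles of [face_perm] below, which
   sends a dart to the next one along the boundary of the face to its left. *)
Record dmap (D : finType) := DMap {
  vrot : {perm D};
  drev : {perm D};
  rootd : D;
  seed : {set D};
  target : {set D} }.

Section DmapFinite.
Variable D : finType.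

Definition dmap_enc (M : dmap D) :=
  (vrot M, drev M, rootd M, seed M, target M).
Definition dmap_dec (u : {perm D} * {perm D} * D * {set D} * {set D}) :=
  let: (r, o, d, s, t) := u in DMap r o d s t.
Lemma dmap_encK : cancel dmap_enc dmap_dec. Proof. by case. Qed.

HB.instance Definition _ := Finite.copy (dmap D) (can_type dmap_encK).
End DmapFinite.

Section Maps.
Variable D : finType.
Implicit Types (M : dmap D) (d : D) (p : seq D) (v : {set D}).

Definition dtail M d : {set D} := porbit (vrot M) d.
Definition dhead M d : {set D} := dtail M (drev M d).
Definition dedge M d : {set D} := [set d; drev M d].
Definition face_perm M : {perm D} := (drev M * (vrot M)^-1)%g.

Fixpoint walk M v p : bool :=
  if p is d :: p' then (dtail M d == v) && walk M (dhead M d) p' else true.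

Definition endpoint M v p : {set D} := last v (map (dhead M) p).

(* Edge sets are represented by sets of darts stable under [drev]. *)
Definition edge_set M (E : {set D}) : Prop :=
  forall d, d \in E -> drev M d \in E.

Definition connected_by M (E : {set D}) : Prop :=
  forall x y : D, exists p : seq D,
    [/\ walk M (dtail M x) p, {subset p <= E}
      & endpoint M (dtail M x) p = dtail M y].

Definition is_cycle M (c : seq D) : bool :=
  [&& c != [::], path.cycle (fun d e => dhead M d == dtail M e) c,
      uniq (map (dtail M) c) & uniq (map (dedge M) c)].

Definition acyclic M (E : {set D}) : Prop :=
  forall c : seq D, {subset c <= E} -> ~~ is_cycle M c.

Definition spanning_tree M (E : {set D}) : Prop :=
  [/\ edge_set M E, connected_by M E & acyclic M E].

Definition nb_spanning_trees M : nat :=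
  #|[set E : {set D} | `[< spanning_tree M E >]]|.

Definition is_map M : Prop :=
  (forall d, drev M d != d /\ drev M (drev M d) = d) /\ connected_by M [set: D].

(* Euler's relation V + F = E + 2, the number of edges E being #|D| / 2. *)
Definition planar M : Prop :=
  (2 * (#|porbits (vrot M)| + #|porbits (face_perm M)|) = #|D| + 4)%N.

Definition relabel (f : {perm D}) M : dmap D :=
  DMap (vrot M ^ f)%g (drev M ^ f)%g (f (rootd M)) (f @: seed M) (f @: target M).

Definition iso_class M : {set dmap D} := [set relabel f M | f : {perm D}].

(* Chronological loop erasure of a walk started at [v]: the new dart [d] is
   appended to the current simple path [p], unless it returns to a vertex of
   [p], in which case [p] is cut at that vertex. *)
Definition erase_step M v p d : seq D :=
  take (index (dhead M d) (v :: map (dhead M) p)) (rcons p d).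

Definition loop_erasure M v p : seq D := foldl (erase_step M v) [::] p.

(* [p] is a walk from [v] stopped when it first visits the vertex set [A]. *)
Definition first_hit M v (A : {set {set D}}) p : bool :=
  [&& walk M v p, endpoint M v p \in A & all (fun d => dtail M d \notin A) p].

End Maps.

(* Unzipped maps.  The darts of the original map are [inl d]; once the edge of
   [d] is unzipped, the two copies of that edge are {inl d, inr d} and
   {inl d', inr d'}, where d' is the reverse of [d], with [inr d] and [inr d']
   on the boundary of the grey polygon.  The [inr d] which are fixed by [grot]
   and [gopp] are the darts not in use. *)
Record gmap (D : finType) := GMap {
  grot : {perm (D + D)};
  gopp : {perm (D + D)};
  (* darts bounding the grey polygon; empty when it is a single vertex *)
  gpoly : {set D + D};
  gtip : {set D + D};
  gtarget : {set D + D} }.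

Section Unzip.
Variable D : finType.
Local Notation T := (D + D)%type.

Definition inl_fun (s : {perm D}) (x : T) : T :=
  match x with inl d => inl (s d) | inr d => inr d end.
Lemma inl_fun_inj s : injective (inl_fun s).
Proof. by move=> [x|x] [y|y] //= [] /perm_inj->. Qed.
Definition inl_perm (s : {perm D}) : {perm T} := perm (@inl_fun_inj s).

Definition gmap_init (M : dmap D) : gmap D :=
  GMap (inl_perm (vrot M)) (inl_perm (drev M)) finset.set0
       (inl @: seed M) (inl @: target M).

(* Unzip the edge of the dart [d], directed from the grey polygon to the new
   tip.  Around the head of [d], [inr d] is inserted just before [inl d'];
   around the origin of [d], [inr d'] is inserted just before [inl d].  If the
   polygon already has a dart [y] leaving that origin, the grey corner there
   lies between [y] and its successor, and the origin is split into two
   vertices, separated by that corner and the cut edge.  In mathcomp,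
   (s * t) x = t (s x). *)
Definition unzip (M : dmap D) (Y : gmap D) (d : D) : gmap D :=
  let d' := drev M d in
  let split : {perm T} :=
    if [pick y in gpoly Y | y \in porbit (grot Y) (inl d)] is Some y
    then tperm (inr d') y else 1%g in
  let r := (split * grot Y * tperm (inl d) (inr d')
                           * tperm (inl d') (inr d))%g in
  let o := (gopp Y * tperm (inl d) (inl d')
                   * tperm (inl d) (inr d) * tperm (inl d') (inr d'))%g in
  GMap r o (inr d |: (inr d' |: gpoly Y)) (porbit r (inr d))
       (* the target may gain a dart but is never split *)
       (\bigcup_(x in gtarget Y) porbit r x).

Definition unzip_all (M : dmap D) (s : seq D) : gmap D :=
  foldl (unzip M) (gmap_init M) s.

Definition gmap_iso (Y Y' : gmap D) : Prop :=
  exists f : {perm T},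
    [/\ grot Y' = (grot Y ^ f)%g, gopp Y' = (gopp Y ^ f)%g,
        gpoly Y' = f @: gpoly Y, gtip Y' = f @: gtip Y
      & gtarget Y' = f @: gtarget Y].

End Unzip.

Definition decorated (n m : nat) (M : dmap 'I_(2 * n)) : Prop :=
  [/\ is_map M /\ planar M,
      #|porbits (vrot M)| = m.+1, #|porbits (face_perm M)| = (n - m).+1,
      seed M \in porbits (vrot M) /\ target M \in porbits (vrot M)
    & seed M != target M].

Section Laws.
Local Open Scope ring_scope.
Local Open Scope classical_set_scope.
Local Open Scope ereal_scope.
Variable R : realType.

(* Decorated rooted maps are isomorphism classes of labelled ones.  Each class
   gets its number of spanning trees as total weight, shared equally among its
   labelled representatives. *)
Definition map_weight (D : finType) (M : dmap D) : R :=
  ((nb_spanning_trees M)%:R / #|iso_class M|%:R)%R.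

Definition map_law (n m : nat) (M : dmap 'I_(2 * n)) : R :=
  if `[< decorated m M >] then
    (map_weight M / \sum_(M' : dmap 'I_(2 * n) | `[< decorated m M' >])
                      map_weight M')%R
  else 0%R.

Section GivenMap.
Variables (D : finType) (M : dmap D).

(* Simple random walk leaves a vertex through a uniform dart. *)
Definition walk_prob (p : seq D) : R := (\prod_(d <- p) #|dtail M d|%:R^-1)%R.

(* Law of L, as the sequence of darts of the path from the seed. *)
Definition lerw_law (g : seq D) : \bar R :=
  \esum_(p in [set p : seq D | first_hit M (seed M) [set target M]%SET p
                            /\ loop_erasure M (seed M) p = g])
    (walk_prob p)%:E.

(* Probability that simple random walk from the target first hits the cluster
   [C] through the edge of [d], where [d] is directed away from [C]. *)
Definition hit_prob (C : {set {set D}}) (d : D) : \bar R :=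
  \esum_(p in [set p : seq D | first_hit M (target M) C p
                            /\ exists q, p = rcons q (drev M d)])
    (walk_prob p)%:E.

(* Probability that edge-based DLA with current cluster [C] adds successively
   the edges of the darts of [s], directed away from the cluster, then stops. *)
Fixpoint dla_prob (C : {set {set D}}) (s : seq D) : \bar R :=
  match s with
  | [::] => if target M \in C then 1 else 0
  | d :: s' => if target M \in C then 0
               else hit_prob C d * dla_prob (dhead M d |: C)%SET s'
  end.

Definition dla_law (s : seq D) : \bar R := dla_prob [set seed M]%SET s.

End GivenMap.

(* Probability of the event [A], the map M being sampled first, then the
   sequence of darts with conditional law [P M]. *)
Definition joint_prob (n m : nat)
    (P : dmap 'I_(2 * n) -> seq 'I_(2 * n) -> \bar R)
    (A : dmap 'I_(2 * n) -> seq 'I_(2 * n) -> Prop) : \bar R :=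
  \sum_(M : dmap 'I_(2 * n))
     (map_law m M)%:E * \esum_(s in [set s | A M s]) P M s.

Definition pr_lerw (n m : nat) := @joint_prob n m (@lerw_law 'I_(2 * n)).
Definition pr_dla (n m : nat) := @joint_prob n m (@dla_law 'I_(2 * n)).

End Laws.

Arguments pr_lerw R n m A : clear implicits.
Arguments pr_dla R n m A : clear implicits.

(* Main.v *)
(* Let K(C) be the determinant of the Laplacian of M with Dirichlet condition on a
   set C of vertices, G_C the inverse of this Laplacian, t the target, and h(C, w)
   the probability that the walk from t enters C at w.  By the matrix-tree theorem
   K({v}) is the number of spanning trees.  The walk from t enters C through an
   edge from v in C to w with probability G_C(t, w), and
     K(C) G_C(t, w) = K(C + w) h(C + w, w).
   Multiplying these identities along the growth of the cluster, the number of
   spanning trees times the probability that D starts with given edges is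
   K(C) h(C, w), for the final cluster C and tip w, times the product of the
   h(C', w') over the previous clusters and tips.  For L, which chooses its next
   edge with the same probabilities conditioned on starting at the tip, the
   factors h(C', w') are replaced by indicators that the next edge starts at w'.
   Now K(C) h(C, w) depends only on the unzipped map.  The unzipped map with its
   tip determines the map obtained by zipping up the last edge, except for the tip
   of the latter, which may be any vertex of the grey polygon.  Since both the
   h(C', w') and the indicators sum to 1 over these positions, by induction each
   unzipped map gets the same total weight from L and from D. *)
From HB Require Import structures.
Require Import Defs.
From mathcomp Require Import all_boot all_order all_algebra all_fingroup zify ring.
From mathcomp Require Import boolp classical_sets functions cardinality fsbigop reals ereal esum.
From mathcomp Require Import fintype finset.

Set Implicit Arguments.
Unset Strict Implicit.
Unset Printing Implicit Defensive.

Import Order.TTheory GRing.Theory Num.Theory.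

(** * Dirichlet Laplacians *)

(** Everything is counted on labelled maps. A rooted map has no automorphism, so all isomorphism
    classes have equally many labelled representatives, and the weights received from L and from D
    are shown to agree for each single labelled unzipped map, before isomorphism enters. Apart from
    K(C) h(C, w), this common weight is the number of darts: unzipping forgets the root, and a
    preimage under the first step is free only in its root dart. No identity divides by h, which may
    vanish. The laws concern stopped sequences, while the weights describe sequences that may still
    grow. The link is conservation: as long as the target is not reached, the weight of a sequence
    is the sum of the weights of its one-dart extensions. Whether the target has been reached can be
    read off the unzipped map. *)

Section DirichletLaplacian.
Local Open Scope ring_scope.
Variables (R : realFieldType) (V D : finType).
Implicit Types (tl hd : D -> V) (O : {set V}) (u v w : V) (x b : V -> R).

(* Laplacian with Dirichlet condition outside [O], extended by the identity so
   that the size of the matrix does not depend on [O]. *)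
Definition lap tl hd O u v : R :=
  if (u \in O) && (v \in O)
  then \sum_(d | tl d == u) ((u == v)%:R - (hd d == v)%:R) else (u == v)%:R.

Definition lapmx tl hd O : 'M[R]_#|V| :=
  \matrix_(i, j) lap tl hd O (enum_val i) (enum_val j).

Definition lapdet tl hd O : R := \det (lapmx tl hd O).

Definition green tl hd O u v : R :=
  invmx (lapmx tl hd O) (enum_rank u) (enum_rank v).

Lemma sum_enum_val (F : V -> R) : \sum_(i < #|V|) F (enum_val i) = \sum_v F v.
Proof.
rewrite (reindex (@enum_rank V)) /=; last exact/onW_bij/enum_rank_bij.
by apply: eq_bigr => v _; rewrite enum_rankK.
Qed.

Lemma eq_lapmx tl hd tl' hd' O :
    (forall d, (tl d \in O) = (tl' d \in O)) ->
    (forall d, tl d \in O -> tl d = tl' d) ->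
    (forall d, tl d \in O -> (hd d \in O) = (hd' d \in O)) ->
    (forall d, tl d \in O -> hd d \in O -> hd d = hd' d) ->
  lapmx tl hd O = lapmx tl' hd' O.
Proof.
move=> tlO tlE hdO hdE; apply/matrixP => i j; rewrite !mxE /lap.
move: (enum_val i) (enum_val j) => u v.
case: ifP => // /andP[uO vO].
apply: eq_big => [d|d /eqP du].
  apply/eqP/eqP => [du|du]; first by rewrite -tlE ?du.
  by rewrite tlE // tlO du.
congr (_ - (_)%:R); have dO : tl d \in O by rewrite du.
have := hdO d dO; case: (boolP (hd d \in O)) => [hO _|hO /esym h'O]; first by rewrite -hdE.
by congr nat_of_bool; apply/eqP/eqP => h; [move: hO | move: h'O]; rewrite h vO.
Qed.

Section Fixed.
Variables (tl hd : D -> V) (O : {set V}).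
Local Notation L := (lap tl hd O).
Local Notation Lm := (lapmx tl hd O).
Local Notation G := (green tl hd O).

Lemma lap_sum_in x u : u \in O ->
  \sum_v L u v * x v = \sum_(d | tl d == u) (x u - (hd d \in O)%:R * x (hd d)).
Proof.
move=> uO.
have -> : \sum_v L u v * x v =
    \sum_(v in O) \sum_(d | tl d == u) ((u == v)%:R - (hd d == v)%:R) * x v.
  rewrite [RHS]big_mkcond; apply: eq_bigr => v _; rewrite /lap uO /=.
  case: ifP => vO; first by rewrite mulr_suml.
  by case: eqP vO => [<-|]; rewrite ?uO ?mul0r.
rewrite exchange_big; apply: eq_bigr => d _.
under eq_bigr do rewrite mulrBl.
rewrite big_split sumrN /=; congr (_ - _).
  rewrite (bigD1 u) //= eqxx mul1r big1 ?addr0 // => v /andP[_ vu].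
  by rewrite eq_sym (negPf vu) mul0r.
case: (boolP (hd d \in O)) => [hO|hO].
  rewrite (bigD1 (hd d)) //= eqxx mul1r big1 ?addr0 ?mul1r // => v /andP[_ vu].
  by rewrite eq_sym (negPf vu) mul0r.
rewrite mul0r big1 // => v vO.
by case: eqP => [h|]; [rewrite h vO in hO | rewrite mul0r].
Qed.

Lemma lap_sum_out x u : u \notin O -> \sum_v L u v * x v = x u.
Proof.
move=> uO; rewrite (bigD1 u) //= /lap (negPf uO) /= eqxx mul1r big1 ?addr0 // => v vu.
by rewrite eq_sym (negPf vu) mul0r.
Qed.

Hypothesis detN0 : lapdet tl hd O != 0.

Lemma lapmx_unit : Lm \in unitmx. Proof. by rewrite unitmxE unitfE. Qed.

Lemma lap_green u w : \sum_v L u v * G v w = (u == w)%:R.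
Proof.
have /matrixP/(_ (enum_rank u) (enum_rank w)) := mulmxV lapmx_unit.
rewrite !mxE -sum_enum_val (inj_eq enum_rank_inj) => <-.
by apply: eq_bigr => i _; rewrite !mxE !enum_rankK /green enum_valK.
Qed.

Lemma green_lap u w : \sum_v G u v * L v w = (u == w)%:R.
Proof.
have /matrixP/(_ (enum_rank u) (enum_rank w)) := mulVmx lapmx_unit.
rewrite !mxE -sum_enum_val (inj_eq enum_rank_inj) => <-.
by apply: eq_bigr => i _; rewrite !mxE !enum_rankK /green enum_valK.
Qed.

Lemma green_solve_all x b u :
  (forall v, \sum_w L v w * x w = b v) -> x u = \sum_w G u w * b w.
Proof.
move=> xb; under eq_bigr do rewrite -xb mulr_sumr.
rewrite exchange_big /=.
under eq_bigr => v _ do (under eq_bigr do rewrite mulrA); under eq_bigr do rewrite -mulr_suml green_lap.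
rewrite (bigD1 u) //= eqxx mul1r big1 ?addr0 // => v vu.
by rewrite eq_sym (negPf vu) mul0r.
Qed.

Lemma green_in_out u w : u \in O -> w \notin O -> G u w = 0.
Proof.
move=> uO wO; have := green_lap u w.
rewrite (bigD1 w) //= {1}/lap (negPf wO) /= eqxx mulr1 big1; last first.
  by move=> v vw; rewrite /lap (negPf wO) andbF (negPf vw) mulr0.
by rewrite addr0 => ->; case: eqP wO => // <-; rewrite uO.
Qed.

Lemma green_solve x b u : u \in O ->
    (forall v, v \in O ->
      \sum_(d | tl d == v) (x v - (hd d \in O)%:R * x (hd d)) = b v) ->
  x u = \sum_(w in O) G u w * b w.
Proof.
move=> uO xb.
pose b' v := if v \in O then b v else x v.
rewrite (green_solve_all (b := b')); last first.
  move=> v; rewrite /b'; case: ifPn => vO; first by rewrite lap_sum_in // xb.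
  by rewrite lap_sum_out.
rewrite [RHS]big_mkcond; apply: eq_bigr => w _; rewrite /b'.
by case: ifPn => // wO; rewrite green_in_out ?mul0r.
Qed.

Lemma green_col u w : u \in O ->
  \sum_(d | tl d == u) (G u w - (hd d \in O)%:R * G (hd d) w) = (u == w)%:R.
Proof. by move=> uO; rewrite -(lap_sum_in (fun v => G v w)) // lap_green. Qed.

Lemma green_sum1 t : t \in O ->
  \sum_(u in O) G t u * \sum_(d | tl d == u) (hd d \notin O)%:R = 1.
Proof.
move=> tO.
rewrite -(@green_solve (fun=> 1) (fun u => \sum_(d | tl d == u) (hd d \notin O)%:R)) //.
by move=> v vO; apply: eq_bigr => d _; rewrite mulr1; case: (_ \in _); rewrite /= ?subrr ?subr0.
Qed.

(** By Cramer's rule [G w w] is the minor at [w] divided by the determinant. Removing [w] from [O]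
    turns its row and column into those of the identity, and expanding along that row leaves the
    same minor. *)
Lemma lapdet_setD1 w : w \in O ->
  lapdet tl hd O * G w w = lapdet tl hd (O :\ w).
Proof.
move=> wO; rewrite /G /green /invmx lapmx_unit !mxE mulrA divff // mul1r.
rewrite /lapdet (expand_det_row _ (enum_rank w)) (bigD1 (enum_rank w)) //=.
rewrite mxE enum_rankK /lap !inE eqxx /= mul1r big1 ?addr0; last first.
  move=> i iw; rewrite mxE enum_rankK /lap !inE eqxx /=.
  by case: (w =P enum_val i) iw => [->|_ _]; rewrite ?enum_valK ?eqxx ?mul0r.
rewrite /cofactor; congr (_ * \det _); apply/matrixP => i j; rewrite !mxE /lap.
have nw k : enum_val (lift (enum_rank w) k) != w.
  by apply/eqP => /(congr1 enum_rank); rewrite enum_valK => /eqP; rewrite eq_sym (negPf (neq_lift _ _)).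
by rewrite !inE !nw.
Qed.

End Fixed.

(* The mean number of visits to [w], up to a degree, is the probability of hitting
   [w] times the same mean number for a walk from [w]. *)
Lemma green_setD1 tl hd O t w :
    lapdet tl hd O != 0 -> lapdet tl hd (O :\ w) != 0 ->
    t \in O -> w \in O -> t != w ->
  green tl hd O t w = green tl hd O w w * \sum_(u in O :\ w)
      green tl hd (O :\ w) t u * \sum_(d | tl d == u) (hd d == w)%:R.
Proof.
move=> detN0 det'N0 tO wO tw; set G := green tl hd O.
pose x v := if v == w then 0 else G v w.
have <- : x t = G t w by rewrite /x (negPf tw).
have tO' : t \in O :\ w by rewrite !inE tw.
rewrite (green_solve det'N0 (b := fun u => G w w * \sum_(d | tl d == u) (hd d == w)%:R) tO').
  by rewrite mulr_sumr; apply: eq_bigr => u _; rewrite mulrCA.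
move=> v; rewrite !inE => /andP[vw vO]; have := green_col detN0 w vO.
rewrite (negPf vw) => e0; apply/eqP; rewrite -subr_eq0; apply/eqP.
rewrite -[RHS]e0 mulr_sumr -sumrB; apply: eq_bigr => d _; rewrite /x (negPf vw) !inE.
by case: eqP => [->|_]; rewrite ?wO /= ?mulr0 ?mul0r ?mulr1 ?mul1r ?subr0 //.
Qed.

Definition successor hd O (o : option D) : option V :=
  if o is Some d then if hd d \in O then Some (hd d) else None else None.

(* A rooted forest is a choice of an arrow [Some d] out of each vertex of [O],
   and [None] elsewhere, such that following the arrows leads out of [O]. *)
Definition arrows tl O u : pred (option D) :=
  fun o => if u \in O then (if o is Some d then tl d == u else false) else o == None.

Definition well_founded_arrows hd O (f : {ffun V -> option D}) : Prop :=
  exists rk : V -> nat, forall u v, successor hd O (f u) = Some v -> (rk v < rk u)%N.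

Lemma lap_arrows tl hd O u v :
  lap tl hd O u v =
    \sum_(o | arrows tl O u o) ((u == v)%:R - (successor hd O o == Some v)%:R).
Proof.
rewrite /lap /arrows; case: (boolP (u \in O)) => uO /=; last first.
  by rewrite big_pred1_eq /= subr0.
pose F o : R := (u == v)%:R - (successor hd O o == Some v)%:R.
rewrite -[RHS]/(\sum_(o | if o is Some d then tl d == u else false) F o).
rewrite [RHS](bigID (fun o : option D => o == None)) [X in _ = X + _]big1 ?add0r; last by case=> [d|] /=; rewrite ?andbF.
rewrite [RHS](reindex_omap Some id) /=; last by case=> [d|] //; rewrite andbF.
case: ifP => vO.
  apply: eq_big => [d|d _]; first by rewrite andbT eqxx andbT.
  rewrite /F /=; case: ifP => hO; first by rewrite (inj_eq Some_inj).
  by case: (hd d =P v) => [h|//]; rewrite -h hO in vO.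
have uv : (u == v) = false by case: eqP vO => // <-; rewrite uO.
rewrite big1 ?uv // => d _; rewrite /F /= uv.
case: ifP => hO; last by rewrite subr0.
by case: eqP vO => [[<-]|]; rewrite ?hO ?subr0.
Qed.

(** A permutation with nonzero product moves an index only along an arrow, where [rk] decreases
    strictly. Since a permutation preserves the sum of the ranks, only the identity contributes. *)
Lemma det_forest hd O f : well_founded_arrows hd O f ->
  \det (\matrix_(i < #|V|, j < #|V|)
     ((enum_val i == enum_val j)%:R - (successor hd O (f (enum_val i)) == Some (enum_val j))%:R)) = 1 :> R.
Proof.
move=> [rk rkP].
have irr u : successor hd O (f u) == Some u = false.
  by apply/negP => /eqP/rkP; rewrite ltnn.
rewrite /determinant (bigD1 1%g) //= [X in _ + X]big1 ?addr0.
  rewrite odd_perm1 expr0 mul1r big1 // => i _.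
  by rewrite mxE perm1 eqxx irr subr0.
move=> s s1; apply/eqP; rewrite mulf_eq0; apply/orP; right.
apply/prodf_eq0; apply: contraNP s1 => H.
have le i : (rk (enum_val (s i)) <= rk (enum_val i) ?= iff (s i == i))%N.
  have Hi : (\matrix_(i < #|V|, j < #|V|)
     ((enum_val i == enum_val j)%:R - (successor hd O (f (enum_val i)) == Some (enum_val j))%:R)) i (s i) != 0 :> R.
    by apply/eqP => e; apply: H; exists i => //; rewrite e.
  move: Hi; rewrite mxE (inj_eq enum_val_inj) [i == _]eq_sym.
  case: (s i =P i) => [->|ne]; first by move=> _; apply/leqif_refl.
  rewrite /= sub0r oppr_eq0 pnatr_eq0 eqb0 negbK => /eqP/rkP lt.
  by split; [exact: ltnW | rewrite ltn_eqF].
have := leqif_sum (fun i (_ : true) => le i).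
rewrite -(reindex_inj (@perm_inj _ s) (P := xpredT) (F := fun i => rk (enum_val i))) /=.
case=> _; rewrite eqxx => /esym/forallP fix_s.
by apply/eqP/permP => i; rewrite perm1; exact/eqP/fix_s.
Qed.

(** The set of vertices from which the arrows never stop is stable along arrows in both directions,
    so its indicator is a null vector of the matrix. If it were empty, the time at which the arrows
    stop would be a rank. *)
Lemma det_not_forest hd O f : ~ well_founded_arrows hd O f ->
  \det (\matrix_(i < #|V|, j < #|V|)
     ((enum_val i == enum_val j)%:R - (successor hd O (f (enum_val i)) == Some (enum_val j))%:R)) = 0 :> R.
Proof.
move=> nwf; set A := (X in \det X).
pose nxt := obind (fun v => successor hd O (f v)).
pose ends u n := iter n nxt (Some u) == None.
pose bad u := `[< ~ exists n, ends u n >].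
have badS u v : successor hd O (f u) = Some v -> bad v = bad u.
  have E n : successor hd O (f u) = Some v -> ends u n.+1 = ends v n.
    by move=> uv; rewrite /ends iterSr /= uv.
  move=> uv; apply/asboolP/asboolP => nP [n] h; apply: nP.
    by case: n h => [|n] h; [move: h|exists n; rewrite -E].
  by exists n.+1; rewrite E.
have badN u : successor hd O (f u) = None -> bad u = false.
  by move=> uN; apply/asboolP; apply; exists 1%N; rewrite /ends /= uN.
suff [u0 bu0] : exists u, bad u.
  rewrite -det_tr; apply/eqP/det0P.
  exists (\row_j (bad (enum_val j))%:R).
    apply/eqP => /rowP/(_ (enum_rank u0)) /eqP.
    by rewrite !mxE enum_rankK bu0 oner_eq0.
  apply/rowP => i; rewrite !mxE.
  under eq_bigr do rewrite !mxE.
  rewrite (sum_enum_val (fun v => (bad v)%:R * ((enum_val i == v)%:R - (successor hd O (f (enum_val i)) == Some v)%:R))).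
  move: (enum_val i) => u.
  under eq_bigr do rewrite mulrBr.
  rewrite sumrB (bigD1 u) //= eqxx mulr1 big1 ?addr0; last first.
    by move=> v vu; rewrite eq_sym (negPf vu) mulr0.
  case uv: (successor hd O (f u)) => [v|]; last first.
    by rewrite big1 ?subr0 ?(badN _ uv) // => v _; rewrite mulr0.
  rewrite (bigD1 v) //= eqxx mulr1 big1 ?addr0 ?(badS _ _ uv) ?subrr // => w wv.
  by case: (Some v =P Some w) wv => [[->]|_ _]; rewrite ?eqxx ?mulr0 //.
apply: contrapT => /forallNP nbad; apply: nwf.
have ex u : exists n, ends u n.
  by apply: contrapT => h; apply: (nbad u); apply/asboolP.
exists (fun u => ex_minn (ex u)) => u v uv.
case: ex_minnP => n nP nmin; case: ex_minnP => [[|m]] mP mmin; first by move: mP.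
by rewrite ltnS; apply: nmin; move: mP; rewrite /ends iterSr /= uv.
Qed.

(* Each row of the Laplacian is a sum over the arrows out of a vertex; expanding
   the determinant by multilinearity gives 1 for each acyclic choice of arrows
   and 0 for the others. *)
Lemma lapdet_forests tl hd O :
  lapdet tl hd O = #|[set f : {ffun V -> option D} | (f \in family (arrows tl O))
                       && `[< well_founded_arrows hd O f >]]|%:R.
Proof.
pose B (f : {ffun V -> option D}) : 'M[R]_#|V| := \matrix_(i, j)
   ((enum_val i == enum_val j)%:R - (successor hd O (f (enum_val i)) == Some (enum_val j))%:R).
have -> : lapdet tl hd O = \sum_(f in family (arrows tl O)) \det (B f).
  rewrite /lapdet /determinant exchange_big; apply: eq_bigr => s _.
  rewrite -mulr_sumr; congr (_ * _).
  under eq_bigr do rewrite mxE lap_arrows.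
  rewrite (reindex (@enum_rank V)) /=; last exact/onW_bij/enum_rank_bij.
  under eq_bigr do rewrite enum_rankK.
  rewrite bigA_distr_big_dep /=; apply: eq_bigr => f _.
  rewrite [RHS](reindex (@enum_rank V)) /=; last exact/onW_bij/enum_rank_bij.
  by apply: eq_bigr => u _; rewrite mxE enum_rankK.
rewrite -sum1_card natr_sum big_mkcond [RHS]big_mkcond; apply: eq_bigr => f _.
rewrite !inE.
case: ifP => // _ /=.
by case: asboolP => wf; [exact: det_forest | exact: det_not_forest].
Qed.
End DirichletLaplacian.

(** * Unzipping and zipping one edge *)

Section PermOrbits.
Variables (T : finType).
Implicit Types (s : {perm T}) (x y z : T).

Lemma tpermE x y z : tperm x y z = if z == x then y else if z == y then x else z.
Proof.
by case: tpermP => [->|->|/eqP/negPf -> /eqP/negPf ->//]; rewrite eqxx //; case: eqP.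
Qed.

Lemma tperm_invariant (U : Type) (f : T -> U) x y z : f x = f y -> f (tperm x y z) = f z.
Proof. by move=> fxy; case: tpermP => [->|->|]. Qed.

Lemma porbit_invariant (U : Type) (f : T -> U) s x y :
  (forall z, f (s z) = f z) -> porbit s x = porbit s y -> f x = f y.
Proof.
move=> fs /eqP; rewrite eq_porbit_mem => /porbitP[i ->].
by elim: i => [|i IH]; rewrite ?expg0 ?perm1 // expgSr permM fs.
Qed.

Lemma porbit1 s x : porbit s (s x) = porbit s x.
Proof. by rewrite -[s x]/((s ^+ 1)%g x) porbit_perm. Qed.

Lemma porbit_fixed s x y : s x = x -> porbit s y = porbit s x -> y = x.
Proof.
move=> sx /eqP; rewrite eq_porbit_mem => /porbitP[i ->].
by elim: i => [|i IH]; rewrite ?expg0 ?perm1 // expgSr permM IH.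
Qed.

Lemma card_porbits_tpermL s x y : x != y ->
  (#|porbits (tperm x y * s)%g| + (porbit s x != porbit s y).*2 = #|porbits s|.+1)%N.
Proof. by move=> xy; have := porbits_mul_tperm s x y; rewrite /= xy addn1 eq_porbit_mem. Qed.

(** The cycle count tells whether the transposition merges two cycles or splits one. As the
    transposition is an involution, applying the count once more to the product relates the two
    cases. *)
Lemma porbit_tpermL s x y : x != y ->
  (porbit (tperm x y * s)%g x == porbit (tperm x y * s)%g y) = (porbit s x != porbit s y).
Proof.
move=> xy; have := card_porbits_tpermL s xy.
have := card_porbits_tpermL (tperm x y * s)%g xy; rewrite mulgA tperm2 mul1g.
by case: eqP; case: eqP => _ _ /=; lia.
Qed.

Lemma card_porbits_tpermR s x y : x != y ->
  (#|porbits (s * tperm x y)%g| + (porbit s x != porbit s y).*2 = #|porbits s|.+1)%N.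
Proof.
move=> xy; have := card_porbits_tpermL s^-1 xy.
by rewrite -[porbits (s * _)%g]porbitsV invMg tpermV porbitsV !porbitV.
Qed.
End PermOrbits.

Section SumEq.
Variables (A B : eqType).
Lemma inl_eqE (a b : A) : (inl a == inl b :> A + B) = (a == b). Proof. by []. Qed.
Lemma inr_eqE (a b : B) : (inr a == inr b :> A + B) = (a == b). Proof. by []. Qed.
Lemma inlr_eqE (a : A) (b : B) : (inl a == inr b) = false. Proof. by []. Qed.
Lemma inrl_eqE (a : A) (b : B) : (inr b == inl a) = false. Proof. by []. Qed.
Definition sum_eqE := (inl_eqE, inr_eqE, inlr_eqE, inrl_eqE).
End SumEq.

Section UnzipStep.
Variable D : finType.
Local Notation T := (D + D)%type.
Implicit Types (r o : {perm T}) (P : {set T}) (a b d e : D) (x y z : T).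

Definition insert_rot r d d' : {perm T} :=
  (r * tperm (inl d) (inr d') * tperm (inl d') (inr d))%g.
Definition unzip_rot r d d' y0 : {perm T} := (tperm (inr d') y0 * insert_rot r d d')%g.
Definition unzip_opp o d d' : {perm T} :=
  (o * tperm (inl d) (inl d') * tperm (inl d) (inr d) * tperm (inl d') (inr d'))%g.
Definition unzip_poly P d d' : {set T} := inr d |: (inr d' |: P).

(** [y0] is the polygon dart at the origin of [d], just before the grey corner. For the first edge
    the polygon is empty and [y0] is set to [inr d'], so that [tperm (inr d') y0] is trivial and no
    vertex is split: one formula covers both cases. *)
Record unzippable r o P d d' y0 : Prop := Unzippable {
  uz_inl : forall e, inl e \notin P;
  uz_neq : d != d';
  uz_d : inr d \notin P;
  uz_d' : inr d' \notin P;
  uz_rfix : forall e, inr e \notin P -> r (inr e) = inr e;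
  uz_ofix : forall e, inr e \notin P -> o (inr e) = inr e;
  uz_od : o (inl d) = inl d';
  uz_od' : o (inl d') = inl d;
  uz_y0 : (P = set0 /\ y0 = inr d') \/ (y0 \in P /\ porbit r y0 = porbit r (inl d));
  uz_head : porbit r (inl d') <> porbit r (inl d);
  uz_off : forall y, y \in P -> porbit r y <> porbit r (inl d') }.

Section Facts.
Variables (r0 o0 : {perm T}) (P0 : {set T}) (d d' : D) (y0 : T).
Hypothesis U : unzippable r0 o0 P0 d d' y0.
Let r1 := insert_rot r0 d d'.
Let r := unzip_rot r0 d d' y0.
Let o := unzip_opp o0 d d'.

Let dd' : d == d' = false. Proof. exact: negPf (uz_neq U). Qed.
Let d'd : d' == d = false. Proof. by rewrite eq_sym. Qed.
Let ifsE := (permM, tpermE, sum_eqE, eqxx, dd', d'd).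

Lemma uz_y0_d : y0 <> inr d.
Proof.
case: (uz_y0 U) => [[_ ->] [/eqP]|[yP _] y0e]; first by rewrite d'd.
by move: yP; rewrite y0e (negPf (uz_d U)).
Qed.

Lemma insert_d : r1 (inr d) = inl d'.
Proof. by rewrite !ifsE (uz_rfix U (uz_d U)) !ifsE. Qed.

Lemma insert_d' : r1 (inr d') = inl d.
Proof. by rewrite !ifsE (uz_rfix U (uz_d' U)) !ifsE. Qed.

Lemma unzip_d : r (inr d) = inl d'.
Proof. by rewrite permM tpermD ?insert_d // eq_sym ?inr_eqE ?dd' //; apply/eqP/nesym/uz_y0_d. Qed.

Lemma unzip_y0 : r y0 = inl d.
Proof. by rewrite permM tpermR insert_d'. Qed.

Lemma unzip_d' : r (inr d') = r1 y0.
Proof. by rewrite permM tpermL. Qed.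

Lemma unzip_other x : x <> inr d' -> x <> y0 -> r x = r1 x.
Proof. by move=> xd xy; rewrite permM tpermD // eq_sym; apply/eqP. Qed.

Lemma insert_other x : r0 x <> inl d -> r0 x <> inl d' -> x <> inr d -> x <> inr d' -> r1 x = r0 x.
Proof.
move=> x1 x2 x3 x4; have rd := uz_rfix U (uz_d U); have rd' := uz_rfix U (uz_d' U).
have x5 : r0 x <> inr d by move=> h; apply: x3; apply: (@perm_inj _ r0); rewrite rd.
have x6 : r0 x <> inr d' by move=> h; apply: x4; apply: (@perm_inj _ r0); rewrite rd'.
by rewrite !permM !tpermD // eq_sym; apply/eqP.
Qed.

(* Darts which are not in [r0] inherit the vertex of the dart they precede. *)
Definition old_vertex x : {set T} := porbit r0
  (if x == inr d then inl d' else if x == inr d' then inl d else x).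

Lemma old_vertex_other x : x != inr d -> x != inr d' -> old_vertex x = porbit r0 x.
Proof. by rewrite /old_vertex => /negPf -> /negPf ->. Qed.

Lemma old_vertex_inl e : old_vertex (inl e) = porbit r0 (inl e).
Proof. exact: old_vertex_other. Qed.

Lemma old_vertex_r0 x : old_vertex (r0 x) = old_vertex x.
Proof.
have rd := uz_rfix U (uz_d U); have rd' := uz_rfix U (uz_d' U).
have [->|xd] := eqVneq x (inr d); first by rewrite rd.
have [->|xd'] := eqVneq x (inr d'); first by rewrite rd'.
have h1 : r0 x != inr d by rewrite -rd (inj_eq perm_inj).
have h2 : r0 x != inr d' by rewrite -rd' (inj_eq perm_inj).
by rewrite !old_vertex_other ?porbit1.
Qed.

Lemma old_vertex_d : old_vertex (inr d) = porbit r0 (inl d').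
Proof. by rewrite /old_vertex eqxx. Qed.

Lemma old_vertex_d' : old_vertex (inr d') = porbit r0 (inl d).
Proof. by rewrite /old_vertex inr_eqE d'd eqxx. Qed.

Lemma old_vertex_y0 : old_vertex y0 = porbit r0 (inl d).
Proof.
case: (uz_y0 U) => [[_ ->]|[yP <-]]; first exact: old_vertex_d'.
rewrite old_vertex_other //; apply: contraTneq yP => ->; first exact: uz_d U.
exact: uz_d' U.
Qed.

Lemma old_vertex_r1 x : old_vertex (r1 x) = old_vertex x.
Proof.
rewrite !permM !tperm_invariant ?old_vertex_r0 //.
  by rewrite old_vertex_d' old_vertex_inl.
by rewrite old_vertex_d old_vertex_inl.
Qed.

Lemma old_vertex_r x : old_vertex (r x) = old_vertex x.
Proof.
by rewrite permM old_vertex_r1 tperm_invariant // old_vertex_y0 old_vertex_d'.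
Qed.

Lemma old_vertexP x y : porbit r x = porbit r y -> old_vertex x = old_vertex y.
Proof. exact/porbit_invariant/old_vertex_r. Qed.

Lemma r0_insert : r0 = (r1 * tperm (inl d') (inr d) * tperm (inl d) (inr d'))%g.
Proof. by apply/permP => x; rewrite !permM !tpermK. Qed.

Lemma insert_r0 x : porbit r1 (r0 x) = porbit r1 x.
Proof.
have e1 : porbit r1 (inl d') = porbit r1 (inr d) by rewrite -insert_d porbit1.
have e2 : porbit r1 (inl d) = porbit r1 (inr d') by rewrite -insert_d' porbit1.
by rewrite {1}r0_insert 2!permM !(tperm_invariant (f := porbit r1)) // porbit1.
Qed.

Lemma insert_vertex x y : porbit r0 x = porbit r0 y -> porbit r1 x = porbit r1 y.
Proof. exact/porbit_invariant/insert_r0. Qed.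

Lemma insert_y0 : porbit r1 y0 = porbit r1 (inr d').
Proof.
case: (uz_y0 U) => [[_ ->]//|[yP /insert_vertex ->]].
by rewrite -insert_d' porbit1.
Qed.

Lemma unzip_split : y0 <> inr d' -> porbit r y0 <> porbit r (inr d').
Proof.
move=> /eqP ne; apply/eqP; rewrite eq_sym porbit_tpermL 1?eq_sym //.
by rewrite insert_y0 eqxx.
Qed.

(* Conversely, [r0] glues the two vertices created at the origin of [d]. *)
Definition glued_vertex x : {set T} :=
  if porbit r x == porbit r (inr d') then porbit r y0 else porbit r x.

Lemma glued_vertex_r x : glued_vertex (r x) = glued_vertex x.
Proof. by rewrite /glued_vertex porbit1. Qed.

Lemma glued_vertex_r0 x : glued_vertex (r0 x) = glued_vertex x.
Proof.
have gr1 z : glued_vertex (r1 z) = glued_vertex z.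
  have -> : r1 = (tperm (inr d') y0 * r)%g by rewrite /r /unzip_rot mulgA tperm2 mul1g.
  rewrite permM glued_vertex_r tperm_invariant //.
  by rewrite /glued_vertex eqxx; case: eqP.
have e1 : glued_vertex (inl d') = glued_vertex (inr d) by rewrite -insert_d gr1.
have e2 : glued_vertex (inl d) = glued_vertex (inr d') by rewrite -insert_d' gr1.
by rewrite {1}r0_insert 2!permM !(tperm_invariant (f := glued_vertex)) // gr1.
Qed.

Lemma glued_vertexP x y : porbit r0 x = porbit r0 y -> glued_vertex x = glued_vertex y.
Proof. exact/porbit_invariant/glued_vertex_r0. Qed.

Lemma glued_vertex_d : glued_vertex (inl d) = porbit r y0.
Proof. by rewrite -unzip_y0 glued_vertex_r /glued_vertex; case: eqP. Qed.

(** The two directions use opposite invariants: [old_vertex] is constant on the orbits of [r], and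
    [glued_vertex] on those of [r0]. Away from the origin of [d] neither identifies distinct
    vertices. *)
Lemma vertex_unchanged x y : x != inr d -> x != inr d' -> y != inr d -> y != inr d' ->
  porbit r0 x <> porbit r0 (inl d) ->
  (porbit r y == porbit r x) = (porbit r0 y == porbit r0 x).
Proof.
move=> xd xd' yd yd' nx; apply/eqP/eqP => [/old_vertexP|yx].
  by rewrite !old_vertex_other.
have ox : old_vertex x <> porbit r0 (inl d) by rewrite old_vertex_other.
have x1 : porbit r x <> porbit r (inr d').
  by move=> /old_vertexP; rewrite old_vertex_d'.
have x2 : porbit r x <> porbit r y0.
  by move=> /old_vertexP; rewrite old_vertex_y0.
have := glued_vertexP yx; rewrite /glued_vertex.
by case: eqP => _; case: eqP => // _ e; case: x2.
Qed.

Lemma split_vertex x : porbit r0 x = porbit r0 (inl d) ->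
  porbit r x = porbit r (inr d') \/ porbit r x = porbit r y0.
Proof.
move=> /glued_vertexP; rewrite glued_vertex_d /glued_vertex.
by case: eqP => [|_]; [left | right].
Qed.

(** Before the cut [inr d] and [inr d'] are fixed points; each insertion merges one of them into a
    vertex, so two orbits are lost. Splitting the origin gives one back unless the polygon is
    empty. *)
Lemma card_unzip_rot :
  (#|porbits r| + 2 = #|porbits r0| + (P0 != set0))%N.
Proof.
have rd := uz_rfix U (uz_d U); have rd' := uz_rfix U (uz_d' U).
pose r' := (r0 * tperm (inl d) (inr d'))%g.
have h1 : (#|porbits r'| + 1 = #|porbits r0|)%N.
  have := @card_porbits_tpermR _ r0 (inl d) (inr d') isT; rewrite -/r'.
  by case: eqP => [/(porbit_fixed rd')//|_] /=; lia.
have r'd : r' (inr d) = inr d by rewrite permM rd tpermD // eq_sym inr_eqE dd'.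
have h2 : (#|porbits r1| + 1 = #|porbits r'|)%N.
  have := @card_porbits_tpermR _ r' (inl d') (inr d) isT; rewrite -[(r' * _)%g]/r1.
  by case: eqP => [/(porbit_fixed r'd)//|_] /=; lia.
have y0E : (y0 == inr d') = (P0 == set0).
  case: (uz_y0 U) => [[-> ->]|[yP _]]; first by rewrite !eqxx.
  have /negPf -> : P0 != set0 by apply/set0Pn; exists y0.
  by apply: contraTF yP => /eqP ->; exact: uz_d' U.
rewrite -y0E; case: (eqVneq y0 (inr d')) => [e|ne] /=.
  have -> : r = r1 by rewrite /r /unzip_rot e tperm1 mul1g.
  by rewrite -h1 -h2 addn0 -addnA.
have ne' : inr d' != y0 by rewrite eq_sym.
have := card_porbits_tpermL r1 ne'; rewrite insert_y0 eqxx -[(_ * r1)%g]/r /= -h1 -h2.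
by move: #|porbits r| #|porbits r1| => i j; lia.
Qed.

Lemma face_unzip : (o * r^-1 = o0 * r0^-1 * tperm (inr d) (inr d') * tperm (inr d') y0)%g.
Proof.
have rd : (r0^-1)%g (inr d) = inr d by apply: (@perm_inj _ r0); rewrite permKV (uz_rfix U (uz_d U)).
have rd' : (r0^-1)%g (inr d') = inr d' by apply: (@perm_inj _ r0); rewrite permKV (uz_rfix U (uz_d' U)).
have -> : (o0 * r0^-1 * tperm (inr d) (inr d') = o0 * tperm (inr d) (inr d') * r0^-1)%g.
  by rewrite -!mulgA; congr (_ * _)%g; rewrite -{1}rd -{1}rd' -tpermJ conjgE invgK mulKg.
rewrite /r /unzip_rot /insert_rot !invMg !tpermV !mulgA; congr (_ * _ * _)%g.
rewrite /o /unzip_opp -!mulgA; congr (_ * _)%g; apply/permP => x; rewrite !permM !tpermE.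
have [e x_e] : exists e, x = inl e \/ x = inr e by case: x => e; exists e; [left | right].
have sumE := (@inl_eqE D D, @inr_eqE D D, @inlr_eqE D D, @inrl_eqE D D).
have [ed|/negPf ed] := eqVneq e d.
  by case: x_e => ->; rewrite ed; do 9?[rewrite ?sumE ?eqxx ?dd' ?d'd /=].
have [ed'|/negPf ed'] := eqVneq e d'.
  by case: x_e => ->; rewrite ed'; do 9?[rewrite ?sumE ?eqxx ?dd' ?d'd /=].
by case: x_e => ->; do 9?[rewrite ?sumE ?eqxx ?ed ?ed' /=].
Qed.

(** In the old face permutation [inr d] and [inr d'] are fixed. The first transposition of
    [face_unzip] joins them into a 2-gon, and the second joins this 2-gon to the orbit of [y0] if
    the polygon is nonempty. *)
Lemma card_unzip_face :
  (#|porbits (o * r^-1)%g| + 1 + (P0 != set0) = #|porbits (o0 * r0^-1)%g|)%N.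
Proof.
rewrite face_unzip; set f0 := (o0 * r0^-1)%g.
have f0fix e : inr e \notin P0 -> f0 (inr e) = inr e.
  move=> eP; rewrite permM (uz_ofix U eP); apply: (@perm_inj _ r0).
  by rewrite permKV (uz_rfix U eP).
have fd := f0fix _ (uz_d U); have fd' := f0fix _ (uz_d' U).
set f1 := (f0 * _)%g.
have h1 : (#|porbits f1| + 1 = #|porbits f0|)%N.
  have dd : (inr d : T) != inr d' by rewrite inr_eqE dd'.
  have := card_porbits_tpermR f0 dd; rewrite -/f1.
  by case: eqP => [/(porbit_fixed fd') [/eqP]|_] /=; [rewrite dd' | lia].
case: (uz_y0 U) => [[-> ->]|[yP _]].
  by rewrite tperm1 mulg1 eqxx addn0.
have -> : P0 != set0 by apply/set0Pn; exists y0.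
have ne : inr d' != y0 by apply: contraTneq yP => <-; exact: uz_d' U.
have := card_porbits_tpermR f1 ne; case: eqP => [e _|_] /=; last first.
  by rewrite -h1; move: #|porbits _| #|porbits f1| => i j; lia.
pose g x := (x == inr d) || (x == inr d').
have gf z : g (f1 z) = g z.
  rewrite /f1 permM (tperm_invariant (f := g)); last by rewrite /g !eqxx orbT.
  by rewrite /g -{1}fd -{1}fd' !(inj_eq perm_inj).
have := porbit_invariant gf e.
rewrite /g eqxx orbT [y0 == inr d']eq_sym (negPf ne) orbF => /esym/eqP.
by move=> h; case: uz_y0_d.
Qed.

End Facts.
End UnzipStep.

(** * Invariants of maps with a grey polygon *)

Section PolygonMaps.
Variable D : finType.
Local Notation T := (D + D)%type.
Implicit Types (r o : {perm T}) (P : {set T}) (a b d e : D) (x y z : T) (S : {set D}).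

(* The maps with a grey 2k-gon obtained from maps with [nv] vertices and [nf]
   faces; the [inr] darts which are not in use are fixed by both permutations,
   hence counted as vertices and as faces.  For k = 0, closed maps. *)
Record polygon_map (nv nf k : nat) r o P : Prop := PolygonMap {
  pm_inl : forall e, inl e \notin P;
  pm_rfix : forall e, inr e \notin P -> r (inr e) = inr e;
  pm_ofix : forall e, inr e \notin P -> o (inr e) = inr e;
  pm_oP : forall a, inr a \in P -> o (inl a) = inr a /\ o (inr a) = inl a;
  pm_o : forall e, inr e \notin P -> exists e',
    [/\ inr e' \notin P, e' != e, o (inl e) = inl e' & o (inl e') = inl e];
  pm_corner : forall a, inr a \in P -> exists2 b, inr b \in P & r (inr a) = inl b;
  pm_cycle : forall S a, a \in S -> (forall b, b \in S -> inr b \in P) ->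
    (forall b c, b \in S -> r (inr b) = inl c -> c \in S) ->
    forall b, inr b \in P -> b \in S;
  pm_sep : forall y y', y \in P -> y' \in P -> porbit r y = porbit r y' -> y = y';
  pm_conn : forall S a, a \in S -> (forall b, inr b \in P -> b \in S) ->
    (forall b c, b \in S -> porbit r (inl c) = porbit r (inl b) -> c \in S) ->
    (forall b c, b \in S -> inr b \notin P -> o (inl b) = inl c -> c \in S) ->
    forall b, b \in S;
  pm_card : #|P| = k.*2;
  pm_vertices : (#|porbits r| + k + (0 < k) = nv + #|D|)%N;
  pm_faces : (#|porbits (o * r^-1)%g| + k.*2 = nf + (0 < k) + #|D|)%N }.

Lemma unzip_polyE P d d' e :
  (inr e \in unzip_poly P d d') = [|| e == d, e == d' | inr e \in P].
Proof. by rewrite /unzip_poly !in_setU1 !inr_eqE. Qed.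

Section Facts.
Variables (r0 o0 : {perm T}) (P0 : {set T}) (d d' : D) (y0 : T).
Hypothesis U : unzippable r0 o0 P0 d d' y0.
Let r1 := insert_rot r0 d d'.
Let r := unzip_rot r0 d d' y0.
Let o := unzip_opp o0 d d'.
Let P := unzip_poly P0 d d'.

Let dd' : d == d' = false. Proof. exact: negPf (uz_neq U). Qed.
Let d'd : d' == d = false. Proof. by rewrite eq_sym. Qed.

Lemma unzip_opp_d : o (inl d) = inr d /\ o (inr d) = inl d.
Proof.
split; rewrite !permM ?(uz_od U) ?(uz_ofix U (uz_d U)).
  by rewrite tpermR tpermL tpermD // inr_eqE d'd.
by rewrite [tperm (inl d) (inl d') _]tpermD // tpermR tpermD // inl_eqE d'd.
Qed.

Lemma unzip_opp_d' : o (inl d') = inr d' /\ o (inr d') = inl d'.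
Proof.
split; rewrite !permM ?(uz_od' U) ?(uz_ofix U (uz_d' U)).
  by rewrite tpermL [tperm (inl d) (inr d) _]tpermD ?inl_eqE ?dd' // tpermL.
by rewrite [tperm (inl d) (inl d') _]tpermD // [tperm (inl d) _ _]tpermD ?inr_eqE ?dd' // tpermR.
Qed.

Lemma unzip_opp_other x : [/\ x <> inl d, x <> inl d', x <> inr d & x <> inr d'] -> o x = o0 x.
Proof.
move=> [x1 x2 x3 x4]; have od := uz_ofix U (uz_d U); have od' := uz_ofix U (uz_d' U).
have y1 : o0 x <> inl d by rewrite -(uz_od' U) => /perm_inj.
have y2 : o0 x <> inl d' by rewrite -(uz_od U) => /perm_inj.
have y3 : o0 x <> inr d by rewrite -od => /perm_inj.
have y4 : o0 x <> inr d' by rewrite -od' => /perm_inj.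
by rewrite !permM !tpermD // eq_sym; apply/eqP.
Qed.

Lemma unzip_poly_neq a : inr a \in P0 -> a != d /\ a != d'.
Proof. by move=> aP; split; apply: contraTneq aP => ->; [exact: uz_d U | exact: uz_d' U]. Qed.

Lemma unzip_corner a b : inr a \in P0 -> inr b \in P0 -> r0 (inr a) = inl b ->
  r1 (inr a) = inl b.
Proof.
move=> aP bP rab; have [ad ad'] := unzip_poly_neq aP; have [bd bd'] := unzip_poly_neq bP.
rewrite /r1 (insert_other U) ?rab //.
- by case=> /eqP; rewrite (negPf bd).
- by case=> /eqP; rewrite (negPf bd').
- by case=> /eqP; rewrite (negPf ad).
- by case=> /eqP; rewrite (negPf ad').
Qed.

Lemma unzip_corner_other a : inr a \in P0 -> inr a <> y0 -> r (inr a) = r1 (inr a).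
Proof.
move=> aP ay; have [_ ad'] := unzip_poly_neq aP.
by apply: unzip_other => // -[/eqP]; rewrite (negPf ad').
Qed.

Lemma unzip_oppE a b : inr a \notin P -> (o (inl a) = inl b) <-> (o0 (inl a) = inl b).
Proof.
rewrite unzip_polyE !negb_or => /and3P[ad ad' _].
by rewrite unzip_opp_other //; split=> // -[/eqP]; rewrite ?(negPf ad) ?(negPf ad').
Qed.

Lemma poly_y0 : y0 \in P.
Proof.
case: (uz_y0 U) => [[_ ->]|[yP _]]; first by rewrite unzip_polyE eqxx orbT.
by rewrite !inE yP !orbT.
Qed.

Lemma unzip_vertex_old a b : porbit r (inl a) = porbit r (inl b) -> porbit r0 (inl a) = porbit r0 (inl b).
Proof. by move=> /(old_vertexP U); rewrite !old_vertex_inl. Qed.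

Variables (nv nf k : nat).

Lemma unzip_polygon_map : polygon_map nv nf k r0 o0 P0 -> polygon_map nv nf k.+1 r o P.
Proof.
move=> W.
have y0case : y0 = inr d' \/ exists2 b, inr b \in P0 & y0 = inr b.
  case: (uz_y0 U) => [[_ ->]|[yP _]]; [by left | right].
  by case: y0 yP => a aP; [rewrite (negPf (pm_inl W a)) in aP | exists a].
have P0k : (P0 != set0) = (0 < k)%N by rewrite -card_gt0 (pm_card W) double_gt0.
split.
- by move=> e; rewrite !inE (negPf (pm_inl W e)).
- move=> e; rewrite unzip_polyE !negb_or => /and3P[ed ed' eP].
  have re := pm_rfix W eP.
  rewrite /r unzip_other.
  + rewrite (insert_other U) ?re //; first by case=> /eqP; rewrite (negPf ed).
    by case=> /eqP; rewrite (negPf ed').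
  + by case=> /eqP; rewrite (negPf ed').
  by move=> ey; have := poly_y0; rewrite -ey unzip_polyE (negPf ed) (negPf ed') (negPf eP).
- move=> e; rewrite unzip_polyE !negb_or => /and3P[ed ed' eP].
  rewrite unzip_opp_other ?(pm_ofix W eP) //.
  by split=> // -[/eqP]; rewrite ?(negPf ed) ?(negPf ed').
- move=> a; rewrite unzip_polyE => /or3P[/eqP ->|/eqP ->|aP].
  + exact: unzip_opp_d.
  + exact: unzip_opp_d'.
  have [ad ad'] := unzip_poly_neq aP.
  by rewrite !unzip_opp_other; [exact: pm_oP W _ aP | |];
     split=> // -[/eqP]; rewrite ?(negPf ad) ?(negPf ad').
- move=> e eP; have := eP; rewrite unzip_polyE !negb_or => /and3P[ed ed' eP0].
  have [e' [e'P ee oe oe']] := pm_o W eP0; exists e'.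
  have e'P' : inr e' \notin P.
    rewrite unzip_polyE !negb_or e'P andbT; apply/andP; split; apply/eqP => h.
      by move: oe'; rewrite h (uz_od U) => -[/eqP]; rewrite eq_sym (negPf ed').
    by move: oe'; rewrite h (uz_od' U) => -[/eqP]; rewrite eq_sym (negPf ed).
  by split=> //; apply/unzip_oppE.
- move=> a; rewrite unzip_polyE => /or3P[/eqP ->|/eqP ->|aP].
  + by exists d'; [rewrite unzip_polyE eqxx orbT | rewrite /r (unzip_d U)].
  + rewrite /r unzip_d'; case: y0case => [->|[b bP ->]].
      by exists d; [rewrite unzip_polyE eqxx | rewrite (insert_d' U)].
    have [c cP rc] := pm_corner W bP; exists c; first by rewrite unzip_polyE cP !orbT.
    exact: unzip_corner bP cP rc.
  have [ay|ay] := eqVneq (inr a) y0.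
    by exists d; [rewrite unzip_polyE eqxx | rewrite ay /r (unzip_y0 U)].
  have [c cP rc] := pm_corner W aP; exists c; first by rewrite unzip_polyE cP !orbT.
  by rewrite (unzip_corner_other aP); [exact: unzip_corner aP cP rc | exact/eqP].
(* The new grey cycle replaces the step out of [y0] by the detour through [d], then [d'], then the
   old successor of [y0]. A set closed for the new cycle therefore meets the old polygon in a set
   closed for the old one. *)
- move=> S a aS SP Sr.
  have Sd : d \in S -> d' \in S by move=> dS; apply: (Sr d d' dS); exact: unzip_d U.
  have Sd' : d' \in S -> y0 = inr d' -> d \in S.
    by move=> dS y0d; apply: (Sr d' d dS); rewrite -y0d; exact: unzip_y0 U.
  have Sb b c : inr b \in P0 -> y0 = inr b -> r0 y0 = inl c -> inr c \in P0 -> d' \in S -> c \in S.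
    move=> bP y0b rb cP dS; apply: (Sr d' c dS).
    by rewrite /r unzip_d' y0b; apply: unzip_corner bP cP _; rewrite -y0b.
  case: y0case => [y0d|[b bP y0b]].
    have P00 : P0 = set0.
      by case: (uz_y0 U) => [[]|[]] //; rewrite y0d (negPf (uz_d' U)).
    have dS : d \in S.
      have := SP _ aS; rewrite unzip_polyE P00 inE orbF => /orP[/eqP <-//|/eqP ad].
      by apply: Sd' => //; rewrite -ad.
    by move=> c; rewrite unzip_polyE P00 inE orbF => /orP[/eqP ->//|/eqP ->]; exact: Sd.
  have [c cP rc] := pm_corner W bP.
  have cSP : d' \in S -> c \in S by apply: (Sb b c) => //; rewrite y0b.
  have [a' a'S] : exists a', a' \in S :&: [set e | inr e \in P0].
    have := SP _ aS; rewrite unzip_polyE => /or3P[/eqP ad|/eqP ad|aP].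
    - by exists c; rewrite !inE cP andbT; apply: cSP; apply: Sd; rewrite -ad.
    - by exists c; rewrite !inE cP andbT; apply: cSP; rewrite -ad.
    - by exists a; rewrite !inE aS.
  have full e : inr e \in P0 -> e \in S :&: [set e | inr e \in P0].
    apply: (pm_cycle W a'S) => [f|f g]; rewrite !inE => /andP[] // fS fP rf.
    have [g' g'P] := pm_corner W fP; rewrite rf => -[gg]; rewrite gg g'P andbT.
    have [fy|fy] := eqVneq (inr f) y0.
      apply: (Sb f g') => //; [by rewrite -fy rf gg|].
      by apply: Sd; apply: (Sr f d fS); rewrite fy; exact: unzip_y0 U.
    apply: (Sr f g' fS); rewrite (unzip_corner_other fP); last exact/eqP.
    by apply: unzip_corner; rewrite // rf gg.
  have dS : d \in S.
    have := full b bP; rewrite inE => /andP[bS _].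
    by apply: (Sr b d bS); rewrite -y0b; exact: unzip_y0 U.
  move=> e; rewrite unzip_polyE => /or3P[/eqP ->//|/eqP ->|/full]; first exact: Sd.
  by rewrite inE => /andP[].
- have offd y : y \in P0 -> porbit r y <> porbit r (inr d).
    move=> yP /(old_vertexP U); rewrite (old_vertex_d r0) old_vertex_other.
    + exact: uz_off U _ yP.
    + by apply: contraTneq yP => ->; exact: uz_d U.
    by apply: contraTneq yP => ->; exact: uz_d' U.
  (* An old polygon dart at the vertex of [inr d'] would have been at the origin of [d], hence equal
     to [y0], which the split puts in the other half. *)
  have offd' y : y \in P0 -> porbit r y <> porbit r (inr d').
    move=> yP yd'; have := old_vertexP U yd'; rewrite (old_vertex_d' U) old_vertex_other.
    + case: (uz_y0 U) => [[P00 _]|[y0P <-]]; first by rewrite P00 inE in yP.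
      move=> /(pm_sep W yP y0P) yy; rewrite yy in yd'; apply: (unzip_split U) yd'.
      by move=> h; rewrite h (negPf (uz_d' U)) in y0P.
    + by apply: contraTneq yP => ->; exact: uz_d U.
    by apply: contraTneq yP => ->; exact: uz_d' U.
  have ddn : porbit r (inr d) <> porbit r (inr d').
    by move=> /(old_vertexP U); rewrite old_vertex_d (old_vertex_d' U); exact: uz_head U.
  have old y y' : y \in P0 -> y' \in P0 -> porbit r y = porbit r y' -> y = y'.
    move=> yP y'P /(old_vertexP U); rewrite !old_vertex_other.
    + exact: pm_sep W _ _ yP y'P.
    + by apply: contraTneq y'P => ->; exact: uz_d U.
    + by apply: contraTneq y'P => ->; exact: uz_d' U.
    + by apply: contraTneq yP => ->; exact: uz_d U.
    by apply: contraTneq yP => ->; exact: uz_d' U.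
  move=> y y'; rewrite /P /unzip_poly !in_setU1.
  move=> /or3P[/eqP->|/eqP->|yP] /or3P[/eqP->|/eqP->|y'P] //.
  + by move/esym/(offd _ y'P).
  + by move/esym.
  + by move/esym/(offd' _ y'P).
  + by move/(offd _ yP).
  + by move/(offd' _ yP).
  exact: old.
- move=> S a aS PS Sr So.
  have dS : d \in S by apply: PS; rewrite unzip_polyE eqxx.
  have d'S : d' \in S by apply: PS; rewrite unzip_polyE eqxx orbT.
  apply: (pm_conn W aS).
  + by move=> b bP; apply: PS; rewrite unzip_polyE bP !orbT.
  (* Vertices other than the origin of [d] are unchanged. At the origin, each of the two halves
     contains [inl d] or another [inl f] with [inr f] on the polygon, and such darts are already in
     [S]. *)
  + move=> b c bS cb; have [bd|/eqP bd] := eqVneq (porbit r0 (inl b)) (porbit r0 (inl d)).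
      have cd : porbit r0 (inl c) = porbit r0 (inl d) by rewrite cb.
      case: (split_vertex U cd) => [rc|rc].
        case: y0case => [y0d|[e eP y0e]].
          by apply: (Sr d c dS); rewrite rc -y0d -/r -(unzip_y0 U) porbit1.
        have [f fP rf] := pm_corner W eP.
        apply: (Sr f c (PS _ _)); first by rewrite unzip_polyE fP !orbT.
        have <- : r (inr d') = inl f.
          by rewrite /r unzip_d' y0e; exact: unzip_corner eP fP rf.
        by rewrite porbit1.
      by apply: (Sr d c dS); rewrite rc -/r -(unzip_y0 U) porbit1.
    by apply: (Sr b c bS); apply/eqP; rewrite (vertex_unchanged U) // cb.
  move=> b c bS bP ob; have [bd|bd] := eqVneq b d.
    by move: ob; rewrite bd (uz_od U) => -[<-].
  have [bd'|bd'] := eqVneq b d'.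
    by move: ob; rewrite bd' (uz_od' U) => -[<-].
  have bP' : inr b \notin P by rewrite unzip_polyE !negb_or bd bd'.
  by apply: (So b c bS bP'); apply/unzip_oppE.
- rewrite /P /unzip_poly !cardsU1 (pm_card W) !inE inr_eqE dd' /=.
  by rewrite (negPf (uz_d U)) (uz_d' U).
- have := card_unzip_rot U; rewrite -/r P0k; have := pm_vertices W.
  by move: #|porbits r| #|porbits r0| => i j; lia.
have := card_unzip_face U; rewrite -/r -/o P0k; have := pm_faces W.
by move: #|porbits _| #|porbits (o0 * _)%g| => i j; lia.
Qed.

End Facts.
End PolygonMaps.

(** * Zipping up an edge of the polygon *)

Section Zip.
Variable D : finType.
Local Notation T := (D + D)%type.
Implicit Types (a b c e : D) (x y z : T) (S : {set D}).

Section ZipStep.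
Variables (nv nf k : nat) (r o : {perm T}) (P : {set T}) (d : D).
Hypotheses (W : polygon_map nv nf k.+1 r o P) (dP : inr d \in P).

(** The corners that have a predecessor form a nonempty set closed under the successor, so
    [pm_cycle] makes it the whole polygon. *)
Lemma polygon_pred b : inr b \in P -> exists2 a, inr a \in P & r (inr a) = inl b.
Proof.
pose S := [set b | [exists a, [&& inr b \in P, inr a \in P & r (inr a) == inl b]]].
have [d' d'P rd] := pm_corner W dP.
have d'S : d' \in S by rewrite inE; apply/existsP; exists d; rewrite d'P dP rd eqxx.
move=> bP; have : b \in S.
  apply: (pm_cycle W d'S) => // [c|c e]; rewrite !inE => /existsP[a /and3P[cP aP ra]] //.
  move=> rc; have [e' e'P] := pm_corner W cP; rewrite rc => -[ee].
  by apply/existsP; exists c; rewrite ee e'P cP rc ee eqxx.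
by rewrite inE => /existsP[a /and3P[_ aP /eqP ra]]; exists a.
Qed.

Variables (d' : D) (y0 : T).
Hypotheses (d'P : inr d' \in P) (rd : r (inr d) = inl d') (y0P : y0 \in P) (ry0 : r y0 = inl d).

Let r0 : {perm T} := (tperm (inr d') y0 * r * tperm (inl d') (inr d) * tperm (inl d) (inr d'))%g.
Let o0 : {perm T} := (o * tperm (inl d') (inr d') * tperm (inl d) (inr d) * tperm (inl d) (inl d'))%g.
Let P0 : {set T} := [set x in P | (x != inr d) && (x != inr d')].

Lemma zip_rotK : r = unzip_rot r0 d d' y0.
Proof. by apply/permP => x; rewrite /unzip_rot /insert_rot /r0 !permM !tpermK. Qed.

Lemma zip_oppK : o = unzip_opp o0 d d'.
Proof. by apply/permP => x; rewrite /unzip_opp /o0 !permM !tpermK. Qed.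

Lemma zip_polyK : P = unzip_poly P0 d d'.
Proof.
apply/setP => x; rewrite !inE.
have [->|xd] := eqVneq x (inr d); first by rewrite dP.
by have [->|xd'] := eqVneq x (inr d'); rewrite ?d'P //= andbT.
Qed.

(** If [d] and [d'] agreed, the grey cycle would consist of one dart, against the even size in
    [pm_card]. *)
Lemma zip_neq : d != d'.
Proof.
apply/eqP => e; have := pm_card W; suff -> : P = [set inr d] by rewrite cards1 => /eqP.
apply/setP => x; rewrite inE; apply/idP/eqP => [|->//].
case: x => a aP; first by rewrite (negPf (pm_inl W a)) in aP.
congr inr; apply/set1P; apply: (pm_cycle W (set11 d)) => // [b|b c] /set1P-> //.
by rewrite rd -e => -[->]; rewrite set11.
Qed.

Lemma zip_polyE a : (inr a \in P0) = [&& inr a \in P, a != d & a != d'].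
Proof. by rewrite inE !inr_eqE. Qed.

Let dd' : d == d' = false. Proof. exact: negPf zip_neq. Qed.
Let d'd : d' == d = false. Proof. by rewrite eq_sym. Qed.

Lemma zip_y0_d : y0 <> inr d.
Proof. by move=> h; move: ry0; rewrite h rd => -[/eqP]; rewrite d'd. Qed.

Lemma zip_rot_d : r0 (inr d) = inr d.
Proof.
rewrite !permM [tperm _ y0 _]tpermD ?rd ?tpermL ?tpermD ?inr_eqE ?d'd //.
by apply/eqP/zip_y0_d.
Qed.

Lemma zip_rot_d' : r0 (inr d') = inr d'.
Proof. by rewrite !permM tpermL ry0 [tperm _ (inr d) _]tpermD ?inl_eqE ?d'd // tpermL. Qed.

Lemma zip_rot_other a b : inr a <> y0 -> a != d' -> b != d -> b != d' -> r (inr a) = inl b ->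
  r0 (inr a) = inl b.
Proof.
move=> ay ad' bd bd' rab; rewrite !permM [tperm _ y0 _]tpermD ?rab.
- by rewrite [tperm _ (inr d) _]tpermD ?tpermD // inl_eqE eq_sym.
- by rewrite inr_eqE eq_sym.
by rewrite eq_sym; apply/eqP.
Qed.

Let glue x : {set T} := if porbit r x == porbit r (inr d') then porbit r y0 else porbit r x.

Lemma zip_glue x : glue (r0 x) = glue x.
Proof.
have gr z : glue (r z) = glue z by rewrite /glue porbit1.
have g1 : glue (inr d') = glue y0 by rewrite /glue eqxx; case: eqP.
have g2 : glue (inl d') = glue (inr d) by rewrite -rd gr.
have g3 : glue (inl d) = glue (inr d') by rewrite -ry0 gr.
by rewrite 3!permM (tperm_invariant _ g3) (tperm_invariant _ g2) gr (tperm_invariant _ g1).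
Qed.

Lemma zip_glueP x y : porbit r0 x = porbit r0 y -> glue x = glue y.
Proof. exact/porbit_invariant/zip_glue. Qed.

Lemma zip_glue_d : glue (inl d) = porbit r y0.
Proof. by rewrite /glue -ry0 porbit1; case: eqP. Qed.

Lemma zip_glue_d' : glue (inl d') = porbit r (inr d).
Proof.
rewrite /glue -rd porbit1; case: eqP => // /(pm_sep W dP d'P) [/eqP].
by rewrite dd'.
Qed.

Let trace x : {set T} :=
  porbit r0 (if x == inr d then inl d' else if x == inr d' then inl d else x).

Lemma zip_trace_other x : x != inr d -> x != inr d' -> trace x = porbit r0 x.
Proof. by rewrite /trace => /negPf -> /negPf ->. Qed.

(** By [pm_sep], [inr d'] and [y0] lie at distinct vertices, so the transposition merges these
    ([porbit_tpermL]); [trace] carries this over to [r0], from which the two new darts have been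
    removed. *)
Lemma zip_y0_vertex : y0 <> inr d' -> porbit r0 y0 = porbit r0 (inl d).
Proof.
move=> y0d'; have tr0 x : trace (r0 x) = trace x.
  have [->|xd] := eqVneq x (inr d); first by rewrite zip_rot_d.
  have [->|xd'] := eqVneq x (inr d'); first by rewrite zip_rot_d'.
  have h1 : r0 x != inr d by rewrite -[X in _ != X]zip_rot_d (inj_eq perm_inj).
  have h2 : r0 x != inr d' by rewrite -[X in _ != X]zip_rot_d' (inj_eq perm_inj).
  by rewrite !zip_trace_other ?porbit1.
have t1 : trace (inr d) = trace (inl d') by rewrite /trace eqxx.
have t2 : trace (inr d') = trace (inl d) by rewrite /trace inr_eqE d'd eqxx.
pose r1 : {perm T} := (tperm (inr d') y0 * r)%g.
have tr1 x : trace (r1 x) = trace x.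
  have -> : r1 = (r0 * tperm (inl d) (inr d') * tperm (inl d') (inr d))%g.
    by apply/permP => z; rewrite /r1 /r0 !permM !tpermK.
  by rewrite 2!permM (tperm_invariant _ (esym t1)) (tperm_invariant _ (esym t2)) tr0.
have y0d : (inr d' : T) != y0 by rewrite eq_sym; exact/eqP.
have := porbit_tpermL r y0d; rewrite -/r1.
have -> : porbit r (inr d') != porbit r y0.
  by apply: contra y0d => /eqP/(pm_sep W d'P y0P)/eqP.
move=> /eqP/(porbit_invariant tr1); rewrite t2 zip_trace_other //.
by rewrite zip_trace_other //; [exact/eqP/zip_y0_d | exact/eqP].
Qed.

Lemma zip_y0_tip : y0 = inr d' -> P0 = set0.
Proof.
move=> y0d; apply/setP => -[] a; rewrite !inE; first by rewrite (negPf (pm_inl W a)).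
rewrite !inr_eqE; apply/negP => /and3P[aP ad ad'].
have : a \in [set d; d'].
  have dS : d \in [set d; d'] by rewrite !inE eqxx.
  apply: (pm_cycle W dS) aP => [b|b c]; first by rewrite !inE => /orP[] /eqP ->.
  rewrite !inE => /orP[] /eqP ->; first by rewrite rd => -[->]; rewrite eqxx orbT.
  by rewrite -y0d ry0 => -[->]; rewrite eqxx.
by rewrite !inE (negPf ad) (negPf ad').
Qed.

Lemma zip_unzippable : unzippable r0 o0 P0 d d' y0.
Proof.
have y0E : y0 = inr d' \/ (y0 \in P0 /\ y0 <> inr d').
  have [->|y0d] := eqVneq y0 (inr d'); [by left | right; split; last exact/eqP].
  by rewrite inE y0P y0d andbT; exact/eqP/zip_y0_d.
have [od od2] := pm_oP W dP; have [od' od'2] := pm_oP W d'P.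
split.
- by move=> e; rewrite inE (negPf (pm_inl W e)).
- exact: zip_neq.
- by rewrite zip_polyE eqxx andbF.
- by rewrite zip_polyE eqxx !andbF.
- move=> e; rewrite zip_polyE; have [->|ed] := eqVneq e d; first by rewrite zip_rot_d.
  have [->|ed'] := eqVneq e d'; first by rewrite zip_rot_d'.
  rewrite !andbT => eP; have re := pm_rfix W eP.
  rewrite !permM [tperm _ y0 _]tpermD ?re ?inr_eqE 1?eq_sym //.
    by rewrite [tperm _ (inr d) _]tpermD ?tpermD ?inr_eqE // eq_sym.
  by apply: contraNneq eP => ->.
- move=> e; rewrite zip_polyE; have [->|ed] := eqVneq e d.
    by rewrite !permM od2 [tperm _ (inr d') _]tpermD ?inl_eqE ?d'd // tpermL tpermD.
  have [->|ed'] := eqVneq e d'.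
    by rewrite !permM od'2 tpermL [tperm _ (inr d) _]tpermD ?inr_eqE ?dd' // tpermD.
  rewrite !andbT => eP; have re := pm_ofix W eP.
  rewrite !permM re [tperm _ (inr d') _]tpermD ?inr_eqE 1?eq_sym //.
  by rewrite [tperm _ (inr d) _]tpermD ?inr_eqE 1?eq_sym // tpermD.
- rewrite !permM od [tperm _ (inr d') _]tpermD ?inr_eqE ?d'd //.
  by rewrite tpermR tpermL.
- rewrite !permM od' tpermR [tperm _ (inr d) _]tpermD ?inl_eqE ?dd' //.
  by rewrite tpermR.
- case: y0E => [y0d|[y0P0 y0d]]; [left | right]; first by rewrite zip_y0_tip.
  by rewrite zip_y0_vertex.
- move=> /zip_glueP; rewrite zip_glue_d zip_glue_d' => /(pm_sep W dP y0P) /esym.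
  exact: zip_y0_d.
move=> y yP0 /zip_glueP; rewrite zip_glue_d' /glue.
move: yP0; rewrite inE => /and3P[yP yd yd'].
case: eqP => [_ /(pm_sep W y0P dP)|_ /(pm_sep W yP dP)]; first exact: zip_y0_d.
exact/eqP.
Qed.

Lemma zip_polygon_map : polygon_map nv nf k r0 o0 P0.
Proof.
have U := zip_unzippable.
have y0E : y0 = inr d' \/ exists2 b, inr b \in P0 & y0 = inr b.
  have [->|y0d] := eqVneq y0 (inr d'); [by left | right].
  case: y0 y0P y0d zip_y0_d => a aP ad' ad; first by rewrite (negPf (pm_inl W a)) in aP.
  by exists a => //; rewrite inE aP ad' andbT; exact/eqP.
have corner a : inr a \in P0 -> exists2 b, inr b \in P0 & r0 (inr a) = inl b /\
    (inr a = y0 -> r (inr d') = inl b) /\ (inr a <> y0 -> r (inr a) = inl b).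
  rewrite zip_polyE => /and3P[aP ad ad'].
  have [ay|/eqP ay] := eqVneq (inr a) y0.
    have [b bP rb] := pm_corner W d'P.
    have bd' : b != d'.
      by apply/eqP => h; move: rb; rewrite h -rd => /perm_inj[/eqP]; rewrite d'd.
    have bd : b != d.
      by apply/eqP => h; move: rb; rewrite h -ry0 -ay => /perm_inj[/eqP]; rewrite eq_sym (negPf ad').
    exists b; first by rewrite zip_polyE bP bd bd'.
    split; last by split.
    by rewrite !permM ay tpermR rb [tperm _ (inr d) _]tpermD ?tpermD // inl_eqE eq_sym.
  have [b bP rb] := pm_corner W aP.
  have bd' : b != d'.
    by apply/eqP => h; move: rb; rewrite h -rd => /perm_inj[/eqP]; rewrite (negPf ad).
  have bd : b != d by apply/eqP => h; move: rb; rewrite h -ry0 => /perm_inj.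
  exists b; first by rewrite zip_polyE bP bd bd'.
  by split; [exact: zip_rot_other | split].
have P0k : (P0 != set0) = (0 < k)%N.
  have := pm_card W; rewrite zip_polyK /unzip_poly !cardsU1 !inE !eqxx /= !andbF inr_eqE dd' /=.
  by rewrite -card_gt0; move: #|P0| => i; lia.
have oE := @unzip_opp_other _ _ _ _ _ _ _ U; rewrite -zip_oppK in oE.
have dn : inr d \notin P0 by exact: uz_d U.
have d'n : inr d' \notin P0 by exact: uz_d' U.
split.
- exact: uz_inl U.
- exact: uz_rfix U.
- exact: uz_ofix U.
- move=> a; rewrite zip_polyE => /and3P[aP ad ad'].
  by rewrite -!oE; [exact: pm_oP W _ aP | |]; split=> // -[/eqP]; rewrite ?(negPf ad) ?(negPf ad').
- move=> e; rewrite zip_polyE; have [->|ed] := eqVneq e d => [_|].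
    exists d'; split=> //; [by rewrite d'd | exact: uz_od U | exact: uz_od' U].
  have [->|ed'] := eqVneq e d' => [_|].
    by exists d; split; rewrite ?dd' //; [exact: uz_od' U | exact: uz_od U].
  rewrite !andbT => eP; have [e' [e'P ee oe oe']] := pm_o W eP.
  have e'd : e' != d by apply: contraNneq e'P => ->.
  have e'd' : e' != d' by apply: contraNneq e'P => ->.
  exists e'; rewrite zip_polyE (negPf e'P) -!oE //; split=> // -[/eqP];
    by rewrite ?(negPf ed) ?(negPf ed') ?(negPf e'd) ?(negPf e'd').
- by move=> a /corner[b bP [rb _]]; exists b.
- move=> S a aS SP Sr b bP.
  have [y0d|[c cP y0c]] := y0E.
    by move: bP; rewrite zip_y0_tip // inE.
  (* In the longer cycle [d] and [d'] follow the corner of [y0], so they have to be added exactly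
     when that corner belongs to [S]. *)
  pose S' := S :|: (if c \in S then [set d; d'] else set0).
  have bS' : b \in S'.
    apply: (pm_cycle W (a := a)); rewrite ?inE ?aS //.
    + move=> e; rewrite !inE => /orP[/SP|]; first by rewrite zip_polyE => /and3P[].
      by case: ifP; rewrite !inE // => _ /orP[] /eqP ->.
    + move=> e f; rewrite !inE => /orP[eS|].
        have [g gP [r0g [_ rg]]] := corner _ (SP _ eS).
        have [ey|/eqP ey] := eqVneq (inr e) y0.
          move: ey eS; rewrite y0c => -[->] cS; rewrite cS -y0c ry0 => -[<-].
          by rewrite !inE eqxx orbT.
        by rewrite rg // => -[<-]; rewrite (Sr e g).
      case: ifP; rewrite ?inE // => cS /orP[] /eqP ->.
        by rewrite rd => -[<-]; rewrite ?inE eqxx !orbT.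
      have [g gP [r0g [rg _]]] := corner _ cP.
      by rewrite rg // => -[<-]; rewrite (Sr c g).
    by move: bP; rewrite zip_polyE => /and3P[].
  move: bS'; rewrite inE => /orP[//|]; case: ifP; rewrite ?inE // => _ /orP[] /eqP h.
    by rewrite h (negPf dn) in bP.
  by rewrite h (negPf d'n) in bP.
- move=> y y' yP y'P /zip_glueP; rewrite /glue.
  move: (yP) (y'P); rewrite !inE => /and3P[yP' _ yd'] /and3P[y'P' _ y'd'].
  case: eqP => [/(pm_sep W yP' d'P)/eqP|_]; first by rewrite (negPf yd').
  case: eqP => [/(pm_sep W y'P' d'P)/eqP|_]; first by rewrite (negPf y'd').
  exact: pm_sep W _ _ yP' y'P'.
- move=> S a aS PS Sr So.
  have Sd : d \in S -> d' \in S by move=> dS; apply: (So d) => //; exact: uz_od U.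
  have Sd' : d' \in S -> d \in S by move=> dS; apply: (So d') => //; exact: uz_od' U.
  have ov b c : porbit r (inl c) = porbit r (inl b) -> porbit r0 (inl c) = porbit r0 (inl b).
    by rewrite {1 2}zip_rotK; exact: unzip_vertex_old U _ _.
  have off b : inr b \notin P -> inr b \notin P0 by rewrite zip_polyE => /negPf ->.
  have oo b c : inr b \notin P -> o (inl b) = inl c -> o0 (inl b) = inl c.
    move=> bP; have [bd bd'] : b != d /\ b != d' by split; apply: contraNneq bP => ->.
    by rewrite oE //; split=> // -[/eqP]; rewrite ?(negPf bd) ?(negPf bd').
  have [dS|dS] := boolP (d \in S).
    apply: (pm_conn W aS) => [b bP|b c bS /ov|b c bS bP].
    + have [->//|bd] := eqVneq b d; have [->|bd'] := eqVneq b d'; first exact: Sd.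
      by apply: PS; rewrite zip_polyE bP bd.
    + exact: Sr.
    by move=> /(oo _ _ bP); apply: So => //; exact: off.
  (* With a nonempty polygon, some polygon corner lies at the origin of [d], and [S] would contain
     [d]. *)
  have P00 : P0 = set0.
    apply/eqP; apply: contraNT dS => /negbTE P0n.
    have [y0d|[c cP y0c]] := y0E; first by rewrite zip_y0_tip ?eqxx in P0n.
    have [b bP [rb _]] := corner _ cP.
    apply: (Sr b) (PS _ bP) _; rewrite -rb porbit1 -y0c.
    rewrite zip_y0_vertex // y0c => h; move: cP; rewrite h.
    by rewrite (negPf d'n).
  have d'S : d' \notin S by apply: contra dS; exact: Sd'.
  (* This is the 2-gon case: the complement of [S] contains [d] and [d'], hence the whole polygon,
     and it is closed, so connectedness makes it everything, including [a]. *)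
  have : a \in ~: S.
    have dC : d \in ~: S by rewrite inE.
    apply: (pm_conn W dC) => [b|b c|b c]; rewrite ?inE.
    + rewrite zip_polyK unzip_polyE P00 inE orbF => /orP[] /eqP -> //.
    + move=> bS /ov cb; apply: contra bS => cS; apply: Sr cS _; by rewrite cb.
    move=> bS bP ob; apply: contra bS => cS.
    have [c' [c'P _ oc oc']] := pm_o W bP; move: oc; rewrite ob => -[cc].
    by apply: (So c) => //; [rewrite cc; exact: off | rewrite cc; exact: oo].
  by rewrite inE aS.
- have := pm_card W; rewrite zip_polyK /unzip_poly !cardsU1 !in_setU1 (negPf dn) (negPf d'n).
  by rewrite inr_eqE dd' /=; lia.
- have := card_unzip_rot U; rewrite -zip_rotK P0k; have := pm_vertices W.
  by move: #|porbits r| #|porbits r0| => i j; lia.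
have := card_unzip_face U; rewrite -zip_rotK -zip_oppK P0k; have := pm_faces W.
by move: #|porbits _| #|porbits (o0 * _)%g| => i j; lia.
Qed.

End ZipStep.

Lemma exists_zip nv nf k r o P d : polygon_map nv nf k.+1 r o P -> inr d \in P ->
  exists r0 o0 P0 d' y0, [/\ @unzippable D r0 o0 P0 d d' y0, polygon_map nv nf k r0 o0 P0,
    r = unzip_rot r0 d d' y0, o = unzip_opp o0 d d' & P = unzip_poly P0 d d'].
Proof.
move=> W dP; have [d' d'P rd] := pm_corner W dP.
have [b bP rb] := polygon_pred W dP dP.
have U := zip_unzippable W dP d'P rd bP rb.
have W0 := zip_polygon_map W dP d'P rd bP rb.
do 5!eexists; split; [exact: U | exact: W0 | exact: zip_rotK | exact: zip_oppK |].
exact: zip_polyK.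
Qed.

(** The unzipped rotation reveals the other data: [d'] is read off the image of [inr d] and [y0] off
    the preimage of [inl d], after which the transpositions cancel. *)
Lemma unzip_step_inj r0 o0 P0 d d' y0 r0' o0' P0' d'' y0' :
  unzippable r0 o0 P0 d d' y0 -> @unzippable D r0' o0' P0' d d'' y0' ->
  unzip_rot r0 d d' y0 = unzip_rot r0' d d'' y0' ->
  unzip_opp o0 d d' = unzip_opp o0' d d'' ->
  unzip_poly P0 d d' = unzip_poly P0' d d'' ->
  [/\ r0 = r0', o0 = o0', P0 = P0', d' = d'' & y0 = y0'].
Proof.
move=> U U' er eo eP.
have ed : d' = d'' by have := unzip_d U; rewrite er (unzip_d U') => -[].
subst d''; have ey : y0 = y0'.
  by have := unzip_y0 U; rewrite er -(unzip_y0 U') => /perm_inj.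
subst y0'; split=> //.
- by move: er; rewrite /unzip_rot /insert_rot => /mulgI/mulIg/mulIg.
- by move: eo; rewrite /unzip_opp => /mulIg/mulIg/mulIg.
apply/setP => x; have [->|xd] := eqVneq x (inr d).
  by rewrite (negPf (uz_d U)) (negPf (uz_d U')).
have [->|xd'] := eqVneq x (inr d'); first by rewrite (negPf (uz_d' U)) (negPf (uz_d' U')).
by move/setP/(_ x): eP; rewrite !inE (negPf xd) (negPf xd').
Qed.

End Zip.

(** * Walks and harmonic measure *)

Section EsumSeq.
Local Open Scope ring_scope.
Local Open Scope ereal_scope.
Local Open Scope classical_set_scope.
Variables (R : realType) (T : finType).

Lemma subset_esum (I : choiceType) (S S' : set I) (a : I -> \bar R) :
  (forall p, 0 <= a p) -> S `<=` S' -> \esum_(p in S) a p <= \esum_(p in S') a p.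
Proof.
move=> a0 SS'; rewrite (esum_mkcond S) (esum_mkcond S'); apply: le_esum => p _.
case: (boolP (p \in S)) => [/set_mem/SS'/mem_set->//|_].
by case: ifP.
Qed.

Lemma esum_seq_cons (S : set (seq T)) (a : seq T -> \bar R) : (forall p, 0 <= a p) ->
  \esum_(p in S) a p = (if `[< S [::] >] then a [::] else 0) +
    \sum_(d : T) \esum_(p in [set p | S (d :: p)]) a (d :: p).
Proof.
move=> a0; rewrite (esumID [set [::]]) //; congr (_ + _).
  case: asboolP => S0.
    rewrite (_ : _ `&` _ = [set [::]]) ?esum_set1 //.
    by apply/seteqP; split => [p []|p /= ->].
  rewrite (_ : _ `&` _ = classical_sets.set0) ?esum_set0 //.
  by apply/seteqP; split => [p [/[swap] /= ->]|p].
pose b d p : \bar R := if p \in [set q | ohead q = Some d] then a p else 0.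
transitivity (\esum_(p in S `&` ~` [set [::]]) \sum_(d : T) b d p).
  apply: eq_esum => -[|d p] [_ /= np]; first by case: np.
  rewrite (bigD1 d) //= big1 ?adde0 => [|e ed]; rewrite /b.
    by rewrite mem_set.
  by rewrite memNset //= => -[] /eqP; rewrite eq_sym (negPf ed).
rewrite esum_sum; last by move=> p d _ _; rewrite /b; case: ifP.
apply: eq_bigr => d _; rewrite -esum_mkcondr.
apply: (@reindex_esum _ _ _ _ _ (cons d)); split.
- by move=> p /= Sp; split; [split|].
- by move=> p q _ _ [].
- by move=> [|e p] [[/= Sp np] /=] // [ed]; exists p => //=; rewrite -ed.
Qed.

Lemma esumZl (I : choiceType) (S : set I) (a : I -> \bar R) (r : R) :
  (forall p, 0 <= a p) -> (0 <= r)%R ->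
  \esum_(p in S) (r%:E * a p) = r%:E * \esum_(p in S) a p.
Proof.
move=> a0 r0; rewrite /esum -ereal_supZl //; last first.
  by apply/set0P; exists (\sum_(x \in classical_sets.set0) a x); exists classical_sets.set0 => //; exact: fsets_set0.
congr ereal_sup; apply/seteqP; split => [_ [X SX <-]|_ [_ [X SX <-] <-]].
  by exists (\sum_(x \in X) a x); [exists X | rewrite ge0_mule_fsumr].
by exists X => //; rewrite ge0_mule_fsumr.
Qed.

End EsumSeq.

Section Walks.
Local Open Scope ring_scope.
Variables (R : realType) (D : finType) (M : dmap D).
Implicit Types (C : {set {set D}}) (v w : {set D}) (d : D) (p : seq D).

Definition off_cluster C : {set {set D}} := porbits (vrot M) :\: C.
Definition clusterdet C : R := lapdet R (dtail M) (dhead M) (off_cluster C).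
Definition clustergreen C := green R (dtail M) (dhead M) (off_cluster C).
Local Notation wp := (walk_prob R M).

Lemma dtail_porbits d : dtail M d \in porbits (vrot M).
Proof. exact: imset_f. Qed.

Lemma dtail_off C d : (dtail M d \in off_cluster C) = (dtail M d \notin C).
Proof. by rewrite inE dtail_porbits andbT. Qed.

Lemma dhead_off C d : (dhead M d \in off_cluster C) = (dhead M d \notin C).
Proof. exact: dtail_off. Qed.

Lemma dtail_eqE v d : v \in porbits (vrot M) -> (dtail M d == v) = (d \in v).
Proof.
move=> /imsetP[e _ ->]; apply/eqP/idP => [<-|]; first exact: porbit_id.
by rewrite -eq_porbit_mem => /eqP.
Qed.

Lemma sum_dtail (F : R) v : v \in porbits (vrot M) ->
  \sum_(d | dtail M d == v) F = #|v|%:R * F.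
Proof.
by move=> vP; under eq_bigl do rewrite dtail_eqE //; rewrite sumr_const mulr_natl.
Qed.

Lemma degree_neq0 v : v \in porbits (vrot M) -> #|v|%:R != 0 :> R.
Proof.
move=> /imsetP[e _ ->]; rewrite pnatr_eq0 -lt0n card_gt0.
by apply/set0Pn; exists e; exact: porbit_id.
Qed.

Lemma walk_prob_ge0 p : 0 <= wp p.
Proof. by apply: prodr_ge0 => d _; rewrite invr_ge0. Qed.

Lemma walk_prob_cons d p : wp (d :: p) = #|dtail M d|%:R^-1 * wp p.
Proof. by rewrite /walk_prob big_cons. Qed.

Lemma first_hit_cons v C d p : first_hit M v C (d :: p) =
  [&& dtail M d == v, v \notin C & first_hit M (dhead M d) C p].
Proof.
rewrite /first_hit /= /endpoint /=.
case: (dtail M d =P v) => //= <-.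
by case: (dtail M d \notin C) (walk _ _ _) (last _ _ \in C) => [] [] []; rewrite ?andbF.
Qed.

Local Open Scope ereal_scope.
Local Open Scope classical_set_scope.

Let wpE0 p : 0 <= (wp p)%:E. Proof. by rewrite lee_fin walk_prob_ge0. Qed.

Lemma esum_walk_cons (S : set (seq D)) : ~ S [::] ->
  \esum_(p in S) (wp p)%:E = \sum_(d : D) (#|dtail M d|%:R^-1)%:E *
     \esum_(p in [set p | S (d :: p)]) (wp p)%:E.
Proof.
move=> S0; rewrite esum_seq_cons // asboolF // add0e; apply: eq_bigr => d _.
rewrite -esumZl ?invr_ge0 //; apply: eq_esum => p _.
by rewrite walk_prob_cons EFinM.
Qed.

(** A finite family of walks has bounded length, and for lengths below [N] the bound follows by
    induction on [N] from the first step. *)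
Lemma esum_first_hit_le1 v C : v \in porbits (vrot M) ->
  \esum_(p in [set p | first_hit M v C p]) (wp p)%:E <= 1.
Proof.
move=> vP.
have le1 N : forall v, v \in porbits (vrot M) ->
    \esum_(p in [set p | first_hit M v C p /\ (size p < N)%N]) (wp p)%:E <= 1.
  elim: N => [|N IH] {vP}v vP.
    by rewrite (_ : [set _ | _] = classical_sets.set0) ?esum_set0 // -classical_sets.subset0 => p [].
  case: (boolP (v \in C)) => vC.
    rewrite (_ : [set _ | _] = [set [::]]); last first.
      apply/seteqP; split => [[|d p] [] //=|p /= ->]; first by rewrite first_hit_cons vC andbF.
      by rewrite /first_hit /= /endpoint /= vC.
    by rewrite esum_set1 // /walk_prob big_nil.
  rewrite esum_walk_cons; last first.
    by case; rewrite /first_hit /= /endpoint /= (negPf vC).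
  apply: (@le_trans _ _ (\sum_(d | dtail M d == v) (#|v|%:R^-1)%:E)).
    rewrite [X in _ <= X]big_mkcond; apply: lee_sum => d _ /=.
    case: eqP => dv; last first.
      rewrite (_ : [set _ | _] = classical_sets.set0) ?esum_set0 ?mule0 // -classical_sets.subset0 => p [].
      by rewrite first_hit_cons; case: eqP.
    rewrite -dv -[X in _ <= X]mule1 lee_pmul ?lee_fin ?invr_ge0 ?esum_ge0 //.
    apply: le_trans (IH _ (dtail_porbits (drev M d))); apply: subset_esum => //.
    by move=> p [] /=; rewrite first_hit_cons => /and3P[].
  by rewrite sumEFin lee_fin sum_dtail // divff // degree_neq0.
apply: ge_ereal_sup => _ [X [finX XS] <-].
have [N XN] : exists N, forall p, X p -> (size p < N)%N.
  have /finite_seqP[s ->] := finX; exists (\max_(p <- s) size p).+1 => p /= ps.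
  by rewrite ltnS (big_rem p ps) leq_maxl.
apply: le_trans (le1 N _ vP); apply: esum_ge; exists X => //.
by split => // p Xp; split; [exact: XS | exact: XN].
Qed.

(** Multiplied by the degree of [v], a first-step equation becomes a Laplace equation with a source
    and zero boundary values on [C]. Finiteness of [m] allows terms to be moved across. *)
Lemma first_step_solve C (m : {set D} -> \bar R) (b : D -> R) t :
    clusterdet C != 0%R -> (forall v, m v \is a fin_num) ->
    (forall v, v \in C -> m v = 0) ->
    (forall v, v \in off_cluster C ->
       m v = \sum_(d | dtail M d == v) (#|v|%:R^-1)%:E * (m (dhead M d) + (b d)%:E)) ->
    t \in off_cluster C ->
  m t = (\sum_(w in off_cluster C) clustergreen C t w * \sum_(d | dtail M d == w) b d)%:E.
Proof.
move=> detN0 mfin m0 mE tO; rewrite -[LHS](fineK (mfin t)); congr EFin.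
apply: (@green_solve _ _ _ _ _ _ detN0 (fun v => fine (m v))) => // v vO.
have vP : v \in porbits (vrot M) by move: vO; rewrite inE => /andP[].
have : fine (m v) = (\sum_(d | dtail M d == v) (#|v|%:R^-1) * (fine (m (dhead M d)) + b d))%R.
  apply: EFin_inj; rewrite fineK // mE // -sumEFin.
  by apply: eq_bigr => d _; rewrite EFinM EFinD fineK.
rewrite -mulr_sumr => /(congr1 (fun x => #|v|%:R * x)%R).
rewrite mulrA divff ?degree_neq0 // mul1r => e.
rewrite sumrB sum_dtail // e -sumrB; apply: eq_bigr => d _; rewrite dhead_off.
by case: (boolP (_ \in C)) => dC; rewrite ?(m0 _ dC) /= ?mul1r ?mul0r ?add0r ?subr0 // addrC addKr.
Qed.

Lemma hit_prob_eq0 C d : ~~ ((dtail M d \in C) && (dhead M d \notin C)) ->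
  (forall e, drev M (drev M e) = e) ->
  hit_prob R M C d = 0.
Proof.
move=> H revK; rewrite /hit_prob (_ : [set _ | _] = classical_sets.set0) ?esum_set0 // -classical_sets.subset0 => p [].
move=> /and3P[_ ep off] [q def]; apply: (negP H).
move: ep off; rewrite def /endpoint map_rcons last_rcons all_rcons /dhead revK.
by move=> -> /andP[->].
Qed.

(** The Green function of the unnormalized Laplacian is the mean number of visits divided by the
    degree, that is, the mean number of passages through one given dart out of [dhead M d]. The dart
    that enters [C] is passed at most once, so here this mean is a probability. *)
Lemma hit_probE C d : (forall e, drev M (drev M e) = e) ->
    clusterdet C != 0%R -> target M \in off_cluster C ->
    dtail M d \in C -> dhead M d \notin C ->
  hit_prob R M C d = (clustergreen C (target M) (dhead M d))%:E.
Proof.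
move=> revK detN0 tO dC hC.
pose S v := [set p | first_hit M v C p /\ exists q, p = rcons q (drev M d)].
pose m v := \esum_(p in S v) (wp p)%:E.
have m0 v : v \in C -> m v = 0.
  move=> vC; rewrite /m (_ : S v = classical_sets.set0) ?esum_set0 // -classical_sets.subset0.
  move=> [[_ [[]]] //|e p [/=]].
  by rewrite first_hit_cons vC andbF.
have SN v : v \notin porbits (vrot M) -> S v = classical_sets.set0.
  move=> vP; rewrite -classical_sets.subset0 => -[[_ [[]]] //|e p [/=]].
  by rewrite first_hit_cons; case: eqP vP => // <-; rewrite dtail_porbits.
rewrite /hit_prob -/(m _) (first_step_solve (b := fun e => (e == drev M d)%:R) detN0) //; first 1 last.
- move=> v; case: (boolP (v \in porbits (vrot M))) => vP; last first.
    by rewrite /m SN // esum_set0.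
  rewrite ge0_fin_numE ?esum_ge0 //.
  apply: (@le_lt_trans _ _ 1); last exact: ltry.
  apply: le_trans (esum_first_hit_le1 C vP); apply: subset_esum => //.
  by move=> p [].
- move=> v; rewrite inE => /andP[vC vP].
  rewrite /m esum_walk_cons; last by case=> _ [[]].
  rewrite [RHS]big_mkcond; apply: eq_bigr => e _ /=.
  case: eqP => ev; last first.
    rewrite (_ : [set _ | _] = classical_sets.set0) ?esum_set0 ?mule0 // -classical_sets.subset0 => p [/=].
    by rewrite first_hit_cons; case: eqP.
  rewrite -ev; congr (_ * _).
  (* After the first dart [e], what remains is again a walk of this kind, or is empty when [e] is
     itself the last dart; the source term accounts for the latter. *)
  transitivity (\esum_(p in S (dhead M e) `|` (if e == drev M d then [set [::]] else classical_sets.set0)) (wp p)%:E).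
    congr (esum _ _); apply/seteqP; split => [p [/=]|p [[fh [q def]]|]].
    - rewrite first_hit_cons => /and3P[_ _ fh] [[|f q] []].
        by move=> -> ->; right; rewrite eqxx.
      by move=> _ def; left; split => //; exists q.
    - split; last by exists (e :: q); rewrite def.
      by rewrite first_hit_cons ev eqxx vC.
    case: eqP => // ed /= ->; split; last by exists [::]; rewrite ed.
    rewrite first_hit_cons ev eqxx vC /= /first_hit /= /endpoint /=.
    by rewrite ed /dhead revK dC.
  rewrite [LHS](esumID [set [::]]) // addeC; congr (_ + _).
    congr (esum _ _); apply/seteqP; split => [p [[//|+] np]|p Sp].
      by case: eqP => // _ /= p0; case: np.
    split; [by left | by move=> /= p0; move: Sp; rewrite p0 => -[_ [[]]]].
  case: eqP => eq_e.
    rewrite (_ : _ `&` _ = [set [::]]) ?esum_set1 //; first by rewrite /walk_prob big_nil.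
    by apply/seteqP; split => [p []|p /= ->] //; split=> //; right.
  rewrite (_ : _ `&` _ = classical_sets.set0) ?esum_set0 // -classical_sets.subset0 => p [[|//] + /= p0].
  by rewrite p0 => -[_ [[]]].
congr EFin; rewrite (bigD1 (dhead M d)) ?dhead_off //= [X in (_ + X)%R]big1; last first.
  move=> w /andP[_ wd]; rewrite big1 ?mulr0 // => e /eqP ew.
  by case: eqP => // ed; rewrite -ew ed eqxx in wd.
rewrite (bigD1 (drev M d)) //= eqxx [X in (1 + X)%R]big1 ?addr0 ?mulr1 //.
by move=> e /andP[_ /negPf->].
Qed.

End Walks.

(** * Loop erasure *)

Section LoopErasure.
Variables (D : finType) (M : dmap D).
Implicit Types (C A : {set {set D}}) (v w : {set D}) (d : D) (p l : seq D).

Lemma endpoint_cat v l p : endpoint M v (l ++ p) = endpoint M (endpoint M v l) p.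
Proof. by rewrite /endpoint map_cat last_cat. Qed.

Lemma walk_cat v l p : walk M v (l ++ p) = walk M v l && walk M (endpoint M v l) p.
Proof. by elim: l v => //= d l IH v; rewrite IH andbA. Qed.

Lemma walk_dtail v p d : walk M v p -> d \in p -> dtail M d \in v :: map (dhead M) p.
Proof.
elim: p v => //= e p IH v /andP[/eqP <- wk]; rewrite inE => /predU1P[->|dp].
  by rewrite inE eqxx.
by rewrite inE IH ?orbT.
Qed.

Lemma walk_dhead v p w : walk M v p -> w \in v :: map (dhead M) p ->
  w \in map (dtail M) p \/ w = endpoint M v p.
Proof.
elim: p v => [|e p IH] v /=; first by rewrite inE => _ /eqP; right.
move=> /andP[/eqP <- wk]; rewrite inE => /predU1P[->|wp].
  by left; rewrite inE eqxx.
by have [h|->] := IH _ wk wp; [left; rewrite inE h orbT | right].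
Qed.

(** A walk that never returns to [v] cannot cut its path before the first dart, so [d] stays and the
    rest is erased as if it started at the head of [d]. *)
Lemma foldl_erase_cons v d g p : v \notin map (dhead M) p ->
  foldl (erase_step M v) (d :: g) p = d :: foldl (erase_step M (dhead M d)) g p.
Proof.
elim: p g => //= e p IH g; rewrite inE negb_or => /andP[ve vp].
by rewrite -IH // /erase_step /= (negPf ve).
Qed.

Lemma loop_erasure_loop v l : endpoint M v l = v -> loop_erasure M v l = [::].
Proof.
elim/last_ind: l => // l e _; rewrite /endpoint map_rcons last_rcons => ev.
by rewrite /loop_erasure foldl_rcons /erase_step /= ev eqxx take0.
Qed.

Lemma loop_erasure_last_exit v l d p : endpoint M v l = v ->
  v \notin map (dhead M) (d :: p) ->
  loop_erasure M v (l ++ d :: p) = d :: loop_erasure M (dhead M d) p.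
Proof.
move=> lv; rewrite /= inE negb_or => /andP[vd vp].
rewrite /loop_erasure foldl_cat -/(loop_erasure M v l) loop_erasure_loop //=.
by rewrite {2}/erase_step /= (negPf vd) foldl_erase_cons.
Qed.

Lemma last_exit v p : endpoint M v p = v \/
  exists l d q, [/\ p = l ++ d :: q, endpoint M v l = v & v \notin map (dhead M) (d :: q)].
Proof.
elim/last_ind: p => [|p e IH]; first by left.
case: (eqVneq (dhead M e) v) => ev.
  by left; rewrite /endpoint map_rcons last_rcons.
right; case: IH => [pv|[l [d [q [-> lv vq]]]]].
  by exists p, e, [::]; rewrite -cats1 /= inE eq_sym.
exists l, d, (rcons q e); split=> //; first by rewrite rcons_cat.
by rewrite -rcons_cons map_rcons mem_rcons inE negb_or eq_sym ev.
Qed.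

Variable t : {set D}.

(** [A] is meant to hold the target and the vertices already left, so that a path leaves each vertex
    once and stops at its first visit to [t]. *)
Fixpoint lpath A v (g : seq D) : bool :=
  if g is d :: g' then [&& v \notin A, dtail M d == v & lpath (v |: A) (dhead M d) g']
  else v == t.

Fixpoint tail_cluster A (g : seq D) : {set {set D}} :=
  if g is d :: g' then tail_cluster (dtail M d |: A) g' else A.

End LoopErasure.

(** * Law of the loop-erased walk *)

Section LerwLaw.
Local Open Scope ring_scope.
Local Open Scope ereal_scope.
Local Open Scope classical_set_scope.
Variables (R : realType) (D : finType) (M : dmap D) (t : {set D}).
Implicit Types (C A : {set {set D}}) (v w : {set D}) (d : D) (p l g : seq D).
Local Notation wp := (walk_prob R M).
Local Notation K := (clusterdet R M).

Lemma off_cluster_setU1 C w : off_cluster M (w |: C)%SET = (off_cluster M C :\ w)%SET.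
Proof. by apply/setP => v; rewrite !inE negb_or andbA. Qed.

Definition erased_to A v g : set (seq D) :=
  [set p | [/\ walk M v p, endpoint M v p = t, all (fun d => dtail M d \notin A) p
         & loop_erasure M v p = g]].

(* By last-exit decomposition, the loop erasure of a walk from [v] is [d :: g]
   when [d] is the dart taken after the last visit to [v], and the loop erasure
   of the rest is [g]. *)
Definition erased_via A v d g u : set (seq D) :=
  [set p | [/\ walk M u p, all (fun d => dtail M d \notin A) p & exists l q,
     [/\ p = l ++ d :: q, endpoint M u l = v & erased_to (v |: A)%SET (dhead M d) g q]]].

Lemma erased_to_cons A v d g : t \in A -> v \notin A ->
  erased_to A v (d :: g) = erased_via A v d g v.
Proof.
move=> tA vA; apply/seteqP; split=> p.
  move=> [wk ep off le]; split => //.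
  have [/loop_erasure_loop|[l [e [q [def lv vq]]]]] := last_exit M v p.
    by rewrite le.
  move: le; rewrite def loop_erasure_last_exit // => -[ed leq].
  subst e.
  exists l, q; split=> //; move: wk ep off.
  rewrite def walk_cat endpoint_cat all_cat /= => /and3P[_ _ wk] ep /and3P[_ _ off].
  split=> //; apply/allP => e eq; rewrite !inE negb_or (allP off) // andbT.
  by apply: contra vq => /eqP <-; exact: walk_dtail.
move=> [wk off [l [q [def lv [wkq eq offq leq]]]]].
have vq : v \notin map (dhead M) (d :: q).
  apply/negP => /(walk_dhead wkq) [/mapP[e /(allP offq)]|].
    by rewrite !inE negb_or => /andP[/negP + _] => /[swap] ->; rewrite eqxx.
  by rewrite eq => vt; rewrite vt tA in vA.
split=> //; first by rewrite def endpoint_cat.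
by rewrite def loop_erasure_last_exit // leq.
Qed.

Lemma erased_via_step A v d g u e p : dtail M d = v -> u \notin A ->
  erased_via A v d g u (e :: p) <->
  dtail M e = u /\ (erased_via A v d g (dhead M e) p \/
    [/\ e = d, u = v & erased_to (v |: A)%SET (dhead M d) g p]).
Proof.
move=> dv uA; split.
  move=> [/= /andP[/eqP eu wk] /andP[_ off] [[|f l] [q [def ep er]]]].
    by case: def => ed pq; split => //; right; rewrite pq.
  case: def => ef pq; split => //; left; split=> //.
  by exists l, q; split=> //; rewrite ef.
move=> [eu [[wk off [l [q [def ep er]]]]|[ed uv [wk ep off le]]]].
  split; [by rewrite /= eu eqxx | by rewrite /= eu uA |].
  by exists (e :: l), q; split => //; rewrite def.
split.
- by rewrite /= eu eqxx ed.
- rewrite /= eu uA /=; apply: sub_all off => f.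
  by rewrite inE negb_or => /andP[].
- by exists [::], p; split => //; rewrite ed.
Qed.

Lemma erased_via_disjoint A v d g g' u w p : dtail M d = v ->
  erased_via A v d g u p -> ~ erased_to (v |: A)%SET w g' p.
Proof.
move=> dv [_ _ [l [q [-> _ _]]]] [_ _ + _].
by rewrite all_cat /= !inE dv eqxx => /and3P[].
Qed.

Hypothesis det_neq0 : forall C, t \in C -> K C != 0%R.

Let wpE0 p : 0 <= (wp p)%:E. Proof. by rewrite lee_fin walk_prob_ge0. Qed.

(** Each vertex [v] that the path leaves contributes [G v v], which by [lapdet_setD1] is the ratio
    of the determinants after and before [v] joins [A]; the product along the path telescopes. *)
Lemma esum_erased_to g : forall A v, t \in A -> v \in porbits (vrot M) ->
  \esum_(p in erased_to A v g) (wp p)%:E =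
  (if lpath M t A v g then K (tail_cluster M A g) / K A else 0%R)%:E.
Proof.
elim: g => [|d g IH] A v tA vP /=.
  case: eqP => vt.
    rewrite (_ : erased_to _ _ _ = [set [::]]) ?esum_set1 //; last first.
      apply/seteqP; split => [[|d p] [] //= /andP[/eqP dv _] _|p /= -> //].
      by rewrite dv vt tA.
    by rewrite /walk_prob big_nil divff ?det_neq0.
  rewrite (_ : erased_to _ _ _ = classical_sets.set0) ?esum_set0 // -classical_sets.subset0 => p [wk ep off le].
  have [pv|[l [e [q [def lv vq]]]]] := last_exit M v p; first by rewrite -pv ep in vt.
  by move: le; rewrite def loop_erasure_last_exit.
case: (boolP (v \in A)) => vA /=.
  rewrite (_ : erased_to _ _ _ = classical_sets.set0) ?esum_set0 // -classical_sets.subset0.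
  move=> [|e p] [//] /= /andP[/eqP -> _] _.
  by rewrite vA.
rewrite erased_to_cons //; case: eqP => dv; last first.
  rewrite (_ : erased_via _ _ _ _ _ = classical_sets.set0) ?esum_set0 // -classical_sets.subset0.
  move=> p [wk _ [l [q [def ep _]]]]; apply: dv.
  by move: wk; rewrite def walk_cat ep /= => /and3P[_ /eqP].
pose c := (if lpath M t (v |: A)%SET (dhead M d) g
  then K (tail_cluster M (v |: A)%SET g) / K (v |: A)%SET else 0)%R.
have cE : \esum_(p in erased_to (v |: A)%SET (dhead M d) g) (wp p)%:E = c%:E.
  by rewrite IH ?dtail_porbits // inE tA orbT.
(* The start is freed from [v] to [u] in order to set up a first-step equation. Its source is at
   [d], where the walk leaves [v] for the last time, and has weight [c]. *)
pose m u := \esum_(p in erased_via A v d g u) (wp p)%:E.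
have vO : v \in off_cluster M A by rewrite inE vA.
have mE0 u : erased_via A v d g u = classical_sets.set0 -> m u = 0.
  by rewrite /m => ->; rewrite esum_set0.
have m0 u : u \in A -> m u = 0.
  move=> uA; apply: mE0; rewrite -classical_sets.subset0 => -[|e p].
    by case=> _ _ [[|f l] [q []]].
  by case=> /= /andP[/eqP ->]; rewrite uA.
have mfin u : m u \is a fin_num.
  case: (boolP (u \in porbits (vrot M))) => uP; last first.
    rewrite mE0 // -classical_sets.subset0 => -[|e p]; first by case=> _ _ [[|f l] [q []]].
    by case=> /= /andP[/eqP eu]; rewrite -eu dtail_porbits in uP.
  rewrite ge0_fin_numE ?esum_ge0 //; apply: (@le_lt_trans _ _ 1); last exact: ltry.
  apply: le_trans (esum_first_hit_le1 R A uP); apply: subset_esum => //.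
  move=> p [wk off [l [q [def ep [_ eq _ _]]]]].
  by rewrite /= /first_hit wk off def endpoint_cat /= -[endpoint M _ (d :: q)]/(endpoint M (dhead M d) q) eq tA.
rewrite -/(m v) (first_step_solve (det_neq0 tA) mfin m0 (b := fun e => if e == d then c else 0%R)) //.
  rewrite (bigD1 v) //= [X in (_ + X)%R]big1 ?addr0 => [|w /andP[_ wv]]; last first.
    rewrite big1 ?mulr0 // => e /eqP ew; case: eqP => // ed.
    by rewrite -ew ed dv eqxx in wv.
  rewrite (bigD1 d) ?dv //= eqxx [X in (_ + X)%R]big1 ?addr0 => [|e /andP[_ /negPf->] //].
  rewrite /c; case: ifP => _; last by rewrite mulr0.
  have := lapdet_setD1 (det_neq0 tA) vO; rewrite -off_cluster_setU1.
  rewrite -[lapdet _ _ _ (off_cluster M (v |: A)%SET)]/(K (v |: A)%SET) => <-.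
  have KA := det_neq0 tA; congr EFin.
  rewrite -[lapdet _ _ _ _]/(K A) -[green _ _ _ _ _ _]/(clustergreen R M A v v).
  have : (K A * clustergreen R M A v v)%R != 0%R.
    rewrite /K /clustergreen lapdet_setD1 // -off_cluster_setU1.
    by apply: det_neq0; rewrite inE tA orbT.
  rewrite mulf_eq0 => /norP[_ GN0].
  by rewrite invfM mulrCA [X in (_ * X)%R]mulrCA divff // mulr1.
move=> u; rewrite inE => /andP[uA uP].
rewrite /m esum_walk_cons; last by case=> _ _ [[|f l] [q []]].
rewrite [RHS]big_mkcond; apply: eq_bigr => e _ /=.
case: eqP => eu; last first.
  rewrite (_ : [set _ | _] = classical_sets.set0) ?esum_set0 ?mule0 // -classical_sets.subset0 => p.
  by move=> [/= /andP[/eqP]].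
rewrite eu; congr (_ * _).
transitivity (\esum_(p in erased_via A v d g (dhead M e) `|`
   (if e == d then erased_to (v |: A)%SET (dhead M d) g else classical_sets.set0)) (wp p)%:E).
  congr (esum _ _); apply/seteqP; split => p /=.
    move=> /(erased_via_step _ _ _ dv uA) [_ [h|[-> _ h]]]; first by left.
    by right; rewrite eqxx.
  move=> h; apply/(erased_via_step _ _ _ dv uA); split => //.
  case: h => [|]; first by left.
  by case: eqP => // ed h; right; split; rewrite // -eu ed.
rewrite (esumID (erased_via A v d g (dhead M e))) //; congr (_ + _).
  congr (esum _ _); apply/seteqP; split => [p [] //|p h]; by split => //; left.
rewrite -[RHS](_ : (if e == d then c%:E else 0%R) = _); last by case: ifP.
rewrite -cE; case: eqP => ed; last first.
  by rewrite (_ : _ `&` _ = classical_sets.set0) ?esum_set0 // -classical_sets.subset0 => p [[h|//] nh]; case: nh.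
congr (esum _ _); apply/seteqP; split => [p [[h|//] nh]|p h]; first by case: nh.
split; first by right.
by move=> h2; apply: (erased_via_disjoint dv h2 h).
Qed.

Lemma lerw_law_lpath g : t = target M -> seed M \in porbits (vrot M) ->
  lerw_law R M g = (if lpath M t [set t]%SET (seed M) g
    then K (tail_cluster M [set t]%SET g) / K [set t]%SET else 0%R)%:E.
Proof.
move=> tM sP; rewrite -esum_erased_to ?set11 //; congr (esum _ _).
apply/seteqP; split => [p [/and3P[wk ep off] le]|p [wk ep off le]].
  by split => //; [move: ep; rewrite -tM inE => /eqP | rewrite tM].
by split => //; rewrite /first_hit wk -tM ep set11.
Qed.

End LerwLaw.

(** * Spanning trees *)

Lemma uniq_map_inj (T1 T2 : eqType) (f : T1 -> T2) (s : seq T1) :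
  uniq (map f s) -> {in s &, injective f}.
Proof.
elim: s => //= x s IH /andP[xs us] y z; rewrite !inE.
move=> /predU1P[->|ys] /predU1P[->|zs] // fyz; last exact: IH.
  by rewrite fyz map_f in xs.
by rewrite -fyz map_f in xs.
Qed.

Section SpanningTrees.
Variables (D : finType) (M : dmap D).
Implicit Types (C : {set {set D}}) (E : {set D}) (u v w : {set D}) (d e : D) (p q c : seq D).
Implicit Type f : {ffun {set D} -> option D}.
Local Notation tl := (dtail M).
Local Notation hd := (dhead M).

Definition joined E u w : Prop :=
  exists p, [/\ walk M u p, {subset p <= E} & endpoint M u p = w].

Lemma joined_refl E u : joined E u u. Proof. by exists [::]. Qed.

Lemma joined_cons E d w : d \in E -> joined E (hd d) w -> joined E (tl d) w.
Proof.
move=> dE [p [wk sub ep]]; exists (d :: p); split=> //=; first by rewrite eqxx.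
by move=> e; rewrite inE => /predU1P[->|/sub].
Qed.

Lemma joined_trans E u v w : joined E u v -> joined E v w -> joined E u w.
Proof.
move=> [p [wk sub ep]] [q [wkq subq eq]]; exists (p ++ q); split.
- by rewrite walk_cat wk ep.
- by move=> e; rewrite mem_cat => /orP[/sub|/subq].
- by rewrite endpoint_cat ep.
Qed.

Hypothesis map_M : is_map M.

Lemma drevK d : drev M (drev M d) = d. Proof. by case: (map_M.1 d). Qed.
Lemma drev_neq d : drev M d != d. Proof. by case: (map_M.1 d). Qed.
Lemma dhead_drev d : hd (drev M d) = tl d. Proof. by rewrite /dhead drevK. Qed.

Lemma joined_sym E u w : edge_set M E -> joined E u w -> joined E w u.
Proof.
move=> EE [p]; elim: p u => [|d p IH] u [/= wk sub ep].
  by rewrite -ep; exact: joined_refl.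
have dE : d \in E by apply: sub; rewrite inE eqxx.
move: wk => /andP[/eqP <- wk]; apply: joined_trans (IH (hd d) _) _.
  by split=> // e ep'; apply: sub; rewrite inE ep' orbT.
rewrite -[X in joined _ X]/(tl (drev M d)); apply: joined_cons; first exact: EE.
by rewrite dhead_drev; exact: joined_refl.
Qed.

Lemma mem_split_walk u p w : w \in u :: map hd p ->
  exists p1 p2, p = p1 ++ p2 /\ endpoint M u p1 = w.
Proof.
elim: p u => [|d p IH] u /=; first by rewrite inE => /eqP ->; exists [::], [::].
rewrite in_cons => /predU1P[->|wp]; first by exists [::], (d :: p).
by have [p1 [p2 [-> ep]]] := IH _ wp; exists (d :: p1), p2.
Qed.

Lemma joined_simple E u w : joined E u w -> exists p,
  [/\ walk M u p, {subset p <= E}, endpoint M u p = w & uniq (u :: map hd p)].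
Proof.
move=> [p]; elim: p u => [|d p IH] u [/= wk sub ep]; first by exists [::].
move: wk => /andP[/eqP du wk].
have [|q [wkq subq eq uq]] := IH (hd d).
  by split=> // e ep'; apply: sub; rewrite inE ep' orbT.
case: (boolP (u \in hd d :: map hd q)) => uq'; last first.
  exists (d :: q); split=> //=; first by rewrite du eqxx.
    by move=> e; rewrite inE => /predU1P[->|/subq//]; apply: sub; rewrite inE eqxx.
  by rewrite uq'.
have [q1 [q2 [def epu]]] := mem_split_walk uq'.
exists q2; split.
- by move: wkq; rewrite def walk_cat epu => /andP[].
- by move=> e eq2; apply: subq; rewrite def mem_cat eq2 orbT.
- by rewrite -eq def endpoint_cat epu.
move: uq; rewrite def map_cat -cat_cons cat_uniq => /and3P[_ /hasPn H ->].
rewrite andbT; apply/negP => /H; rewrite /= -epu /endpoint.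
by rewrite mem_last.
Qed.

Lemma walk_path d p : path (fun x y => hd x == tl y) d p = walk M (hd d) p.
Proof. by elim: p d => //= e p IH d; rewrite IH eq_sym. Qed.

Lemma dhead_last d p : hd (last d p) = endpoint M (hd d) p.
Proof. by rewrite /endpoint last_map. Qed.

Lemma walk_vertices u p : walk M u p -> rcons (map tl p) (endpoint M u p) = u :: map hd p.
Proof.
elim: p u => //= d p IH u /andP[/eqP <- wk].
by rewrite -[in RHS]IH.
Qed.

Lemma mem_dedge d e : dedge M d = dedge M e -> d = e \/ d = drev M e.
Proof.
move=> de; have : d \in dedge M e by rewrite -de !inE eqxx.
by rewrite !inE => /orP[] /eqP; [left | right].
Qed.

Lemma simple_walk_edges u p : walk M u p -> uniq (u :: map hd p) -> uniq (map (dedge M) p).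
Proof.
elim: p u => //= d p IH u /andP[/eqP du wk] /and3P[up dp unp].
rewrite (IH _ wk) /= ?dp ?unp // andbT; apply/mapP => -[e ep /mem_dedge de].
move: up; rewrite -du; case: de => de; rewrite de.
  by rewrite -de -/(hd d :: _) de walk_dtail // -de.
by rewrite -[tl (drev M e)]/(hd e) inE map_f // orbT.
Qed.

Local Notation forest C f := ((f \in family (arrows tl (off_cluster M C)))
  && `[< well_founded_arrows hd (off_cluster M C) f >]).

(** The arrows follow shortest paths of [E] to [C], whose length serves as the rank. With all darts
    as [E] this gives a nonzero determinant; with a spanning tree it gives the orientation towards a
    root. *)
Lemma joined_forest C E v0 : connected_by M E -> v0 \in C -> v0 \in porbits (vrot M) ->
  exists2 f, forest C f & forall u d, f u = Some d -> d \in E.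
Proof.
move=> conn cC /imsetP[y _ yc].
pose P v n := exists p, [/\ walk M v p, {subset p <= E}, endpoint M v p \in C & size p = n].
have Pex v : exists n, v \in porbits (vrot M) -> P v n /\ forall m, P v m -> (n <= m)%N.
  case: (boolP (v \in _)) => [/imsetP[x _ xv]|_]; last by exists 0%N.
  have ex : exists n, `[< P v n >].
    have [p [wk sub ep]] := conn x y.
    exists (size p); apply/asboolP; exists p; split=> //; first by rewrite xv.
    by move: ep; rewrite -[tl x]/(porbit _ x) -xv => ->; rewrite /dtail -yc.
  case: (ex_minnP ex) => n /asboolP Pn nmin; exists n => _; split=> // m Pm.
  by apply: nmin; apply/asboolP.
have [rk rkP] := choice Pex.
have stepP v : exists o : option D, if v \in off_cluster M C
    then exists d, [/\ o = Some d, tl d = v, d \in E & (rk (hd d) < rk v)%N]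
    else o = None.
  case: (boolP (v \in off_cluster M C)) => [|_]; last by exists None.
  rewrite inE => /andP[vC vP]; have [[p [wk sub ep <-]] _] := rkP _ vP.
  case: p wk sub ep => [|d p] /=; first by rewrite /endpoint /= (negPf vC).
  move=> /andP[/eqP dv wk] sub ep; exists (Some d), d; split=> //.
    by apply: sub; rewrite inE eqxx.
  have [_ rkmin] := rkP _ (dtail_porbits M (drev M d)).
  rewrite ltnS; apply: rkmin; exists p; split=> // e ep'.
  by apply: sub; rewrite inE ep' orbT.
have [f fP] := choice stepP.
exists (finfun f).
  apply/andP; split.
    apply/familyP => v; rewrite ffunE unfold_in /arrows.
    by have := fP v; case: ifP => [_ [d [-> <-]]|_ ->].
  apply/asboolP; exists rk => u v; rewrite ffunE.
  have := fP u; case: ifP => [_ [d [-> _ _]]|_ -> //] /=.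
  by case: ifP => // _ + [<-].
move=> u d; rewrite ffunE; have := fP u.
by case: ifP => [_ [e [-> _ eE _]] [<-]|_ ->].
Qed.

Lemma clusterdet_neq0 (R : realType) C v0 : v0 \in C -> v0 \in porbits (vrot M) ->
  clusterdet R M C != 0%R.
Proof.
move=> cC cP; have [f fF _] := joined_forest (map_M.2) cC cP.
rewrite /clusterdet lapdet_forests pnatr_eq0 -lt0n card_gt0.
by apply/set0Pn; exists f; rewrite inE.
Qed.

Definition forest_edges f : {set D} :=
  [set d | (f (tl d) == Some d) || (f (hd d) == Some (drev M d))].

Section Root.
Variables (v : {set D}) (vP : v \in porbits (vrot M)).

Lemma off_root u : (u \in off_cluster M [set v]) = (u != v) && (u \in porbits (vrot M)).
Proof. by rewrite !inE. Qed.

Lemma forest_rank f : forest [set v] f -> exists rk : {set D} -> nat,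
  forall u d, f u = Some d -> [/\ tl d = u, u != v & (rk (hd d) < rk u)%N].
Proof.
move=> /andP[/familyP fam /asboolP[rk rkP]].
(* The shift by one puts the root strictly below every other vertex; the given rank only compares
   vertices off the root. *)
exists (fun u => if u \in off_cluster M [set v] then (rk u).+1 else 0%N) => u d fu.
have := fam u; rewrite unfold_in /arrows fu; case: ifP => // uO /eqP du.
split=> //; first by move: uO; rewrite off_root => /andP[].
case: ifP => // hO; rewrite ltnS; apply: rkP.
by rewrite fu /= hO.
Qed.

Lemma forest_arrow f u : forest [set v] f -> u != v -> u \in porbits (vrot M) ->
  exists d, f u = Some d.
Proof.
move=> /andP[/familyP/(_ u) + _] uv uP; rewrite unfold_in /arrows off_root uv uP /=.
by case: (f u) => // d _; exists d.
Qed.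

Lemma forest_none f u : forest [set v] f ->
  ~~ ((u != v) && (u \in porbits (vrot M))) -> f u = None.
Proof.
move=> /andP[/familyP/(_ u) + _] uO.
by rewrite unfold_in /arrows off_root (negPf uO) => /eqP.
Qed.

Lemma forest_edges_spanning f : forest [set v] f -> spanning_tree M (forest_edges f).
Proof.
move=> F; have [rk rkP] := forest_rank F.
have EE : edge_set M (forest_edges f).
  by move=> d; rewrite !inE dhead_drev drevK orbC.
split=> //.
  have tov u : u \in porbits (vrot M) -> joined (forest_edges f) u v.
    have [n] := ubnP (rk u); elim: n u => // n IH u; rewrite ltnS => un uP.
    have [->|uv] := eqVneq u v; first exact: joined_refl.
    have [d fu] := forest_arrow F uv uP; have [du _ lt] := rkP _ _ fu.
    rewrite -du; apply: joined_cons; first by rewrite inE du fu eqxx.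
    by apply: IH; [exact: leq_trans lt un | exact: dtail_porbits].
  move=> x y; apply: joined_trans (tov _ (dtail_porbits M x)) _.
  exact: joined_sym (tov _ (dtail_porbits M y)).
move=> c sub; apply/negP => /and4P[c0 cyc _ ue].
have [d0 d0c] : exists d, d \in c by case: c c0 {sub cyc ue} => // d c _; exists d; rewrite inE eqxx.
(* At a vertex of maximal rank on the cycle, both cycle edges would have to be the single arrow out
   of that vertex. *)
have [d dc dmax] : exists2 d, d \in c & forall e, e \in c -> (rk (tl e) <= rk (tl d))%N.
  by case: (arg_maxnP (fun e => rk (tl e)) d0c) => d dc dmax; exists d.
have /eqP nx := next_cycle cyc dc.
have /eqP pv := prev_cycle cyc dc.
have fd : f (tl d) = Some d.
  have := sub _ dc; rewrite inE => /orP[/eqP //|/eqP /rkP[_ _]].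
  by rewrite dhead_drev nx ltnNge dmax ?mem_next.
set e := prev c d in pv; have ec : e \in c by rewrite mem_prev.
have := sub _ ec; rewrite inE => /orP[/eqP /rkP[_ _]|].
  by rewrite pv ltnNge dmax.
rewrite pv fd => /eqP[de].
have : dedge M d = dedge M e by rewrite /dedge de drevK finset.setUC.
move=> /(uniq_map_inj ue dc ec) de'.
by have := drev_neq e; rewrite -de de' eqxx.
Qed.

(** Induction on the rank in [g]. If [f] did not have the arrow [d] of [g], the edge would be an
    arrow of [f] at the head of [d]; there [f] and [g] agree by induction, so [g] would use the edge
    in both directions. *)
Lemma forest_edges_inj : {in [set f | forest [set v] f] &, injective forest_edges}.
Proof.
move=> f g; rewrite !inE => F G eqE; apply/ffunP => u.
have [rkf rkfP] := forest_rank F; have [rk rkP] := forest_rank G.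
have [n] := ubnP (rk u); elim: n u => // n IH u; rewrite ltnS => un.
case: (boolP ((u != v) && (u \in porbits (vrot M)))) => uO; last first.
  by rewrite !(@forest_none _ u).
case/andP: uO => uv uP; have [d gu] := forest_arrow G uv uP.
have [du _ lt] := rkP _ _ gu.
have : d \in forest_edges f by rewrite eqE inE du gu eqxx.
rewrite inE du gu => /orP[/eqP //|/eqP fh].
have : g (hd d) = Some (drev M d) by rewrite -IH // (leq_trans lt un).
by move=> /rkP[_ _]; rewrite dhead_drev du ltnNge ltnW.
Qed.

(** The shortest-path forest lies inside the tree, and an edge of the tree outside it would close a
    cycle with the forest path between its ends. *)
Lemma spanning_tree_forest T : spanning_tree M T ->
  exists2 f, forest [set v] f & forest_edges f = T.
Proof.
move=> [TE conn acyc]; have [f F fT] := joined_forest conn (set11 v) vP.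
exists f => //; apply/eqP; rewrite finset.eqEsubset; apply/andP; split; apply/fintype.subsetP => d.
  by rewrite inE => /orP[/eqP/fT//|/eqP/fT/TE]; rewrite drevK.
move=> dT; apply: contrapT => /negP dN.
have [_ connF _] := forest_edges_spanning F.
have [q [wk sub ep uq]] := joined_simple (connF (drev M d) d).
have subT : {subset forest_edges f <= T}.
  by move=> e; rewrite inE => /orP[/eqP/fT//|/eqP/fT/TE]; rewrite drevK.
have ncyc : ~~ is_cycle M (d :: q).
  apply: acyc => e; rewrite inE => /predU1P[->//|/sub/subT] //.
apply: (negP ncyc).
apply/and4P; split => //.
- by rewrite /= rcons_path walk_path wk dhead_last -ep eqxx.
- by rewrite /= -rcons_uniq -ep (walk_vertices wk).
rewrite /= (simple_walk_edges wk uq) andbT; apply: contra dN => /mapP[e eq de].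
have eF := sub _ eq; have [-> //|->] := mem_dedge de.
by have [EE _ _] := forest_edges_spanning F; exact: EE.
Qed.

Lemma nb_spanning_treesE (R : realType) :
  (nb_spanning_trees M)%:R%R = clusterdet R M [set v] :> R.
Proof.
rewrite /clusterdet lapdet_forests /nb_spanning_trees; congr (_%:R)%R.
rewrite -(card_in_imset forest_edges_inj); apply: eq_card => T; rewrite inE.
apply/asboolP/imsetP => [/spanning_tree_forest[f F <-]|[f + ->]].
  by exists f; rewrite ?inE.
by rewrite inE => /forest_edges_spanning.
Qed.
End Root.

End SpanningTrees.

(** * Growing clusters *)

Section SeqSum.
Local Open Scope ring_scope.
Variables (R : realType) (T : finType).
Implicit Types (F G : seq T -> R) (s : seq T).

(** Recursive rather than over tuples, so that the first dart is split off by computation and the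
    last one by [seqsum_rcons]. *)
Fixpoint seqsum k F : R :=
  if k is k'.+1 then \sum_(d : T) seqsum k' (fun s => F (d :: s)) else F [::].

Lemma eq_seqsum k F G : (forall s, size s = k -> F s = G s) -> seqsum k F = seqsum k G.
Proof.
elim: k F G => [|k IH] F G FG /=; first exact: FG.
by apply: eq_bigr => d _; apply: IH => s sk; apply: FG; rewrite /= sk.
Qed.

Lemma seqsum_rcons k F : seqsum k.+1 F = seqsum k (fun s => \sum_d F (rcons s d)).
Proof. by elim: k F => //= k IH F; apply: eq_bigr => d _; exact: (IH (fun s => F (d :: s))). Qed.

Lemma seqsumD k F G : seqsum k (fun s => F s + G s) = seqsum k F + seqsum k G.
Proof.
elim: k F G => //= k IH F G; rewrite -big_split.
by apply: eq_bigr => d _; rewrite IH.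
Qed.

Lemma seqsumZ k (a : R) F : seqsum k (fun s => a * F s) = a * seqsum k F.
Proof.
elim: k F => //= k IH F; rewrite mulr_sumr.
by apply: eq_bigr => d _; rewrite IH.
Qed.

Lemma seqsum0 k F : (forall s, size s = k -> F s = 0) -> seqsum k F = 0.
Proof.
move=> F0; rewrite (eq_seqsum (G := fun=> 0 * 0)); first by rewrite seqsumZ mul0r.
by move=> s sk; rewrite F0 ?mul0r.
Qed.

Lemma seqsum_sum k (I : finType) (P : pred I) (F : I -> seq T -> R) :
  seqsum k (fun s => \sum_(i | P i) F i s) = \sum_(i | P i) seqsum k (F i).
Proof.
elim: k F => //= k IH F; rewrite exchange_big.
by apply: eq_bigr => d _; rewrite IH.
Qed.

Lemma esum_seqsum N F (A : seq T -> Prop) : (forall s, 0 <= F s) ->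
    (forall s, (N <= size s)%N -> F s = 0) ->
  (\esum_(s in [set s | A s]%classic) (F s)%:E =
   (\sum_(i < N) seqsum i (fun s => `[< A s >]%:R * F s))%:E)%E.
Proof.
elim: N F A => [|N IH] F A F0 FN.
  by rewrite big_ord0 esum1 // => s _; rewrite FN.
rewrite esum_seq_cons; last by move=> p; rewrite lee_fin.
rewrite big_ord_recl /= EFinD; congr (_ + _)%E.
  by case: asboolP => _; rewrite ?mul1r ?mul0r.
rewrite exchange_big -sumEFin; apply: eq_bigr => d _ /=.
by rewrite (IH (fun s => F (d :: s)) (fun s => A (d :: s))) // => s sN; apply: FN.
Qed.

End SeqSum.

Section ClusterGrowth.
Local Open Scope ring_scope.
Variables (R : realType) (D : finType) (M : dmap D).
Implicit Types (C : {set {set D}}) (v w : {set D}) (d : D) (s : seq D).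
Local Notation t := (target M).
Local Notation K := (clusterdet R M).
Local Notation G := (clustergreen R M).

(* [harm C w]: probability that the walk from the target enters [C] at [w]. *)
Definition harm C w : R := if t \in C then 1
  else \sum_(d | (dtail M d == w) && (dhead M d \notin C)) G C t (dhead M d).

Fixpoint clus C s : {set {set D}} :=
  if s is d :: s' then clus (dhead M d |: C) s' else C.

Fixpoint growth C s : bool :=
  if s is d :: s' then
    [&& t \notin C, dtail M d \in C, dhead M d \notin C & growth (dhead M d |: C) s']
  else true.

Fixpoint step_weight (tau : {set {set D}} -> {set D} -> D -> R) C w s : R :=
  if s is d :: s' then tau C w d * step_weight tau (dhead M d |: C) (dhead M d) s' else 1.

Lemma clus_rcons C s d : clus C (rcons s d) = dhead M d |: clus C s.
Proof. by elim: s C => //= e s IH C. Qed.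

Lemma growth_rcons C s d : growth C (rcons s d) =
  [&& growth C s, t \notin clus C s, dtail M d \in clus C s & dhead M d \notin clus C s].
Proof. by elim: s C => [|e s IH] C /=; rewrite ?andbT // IH !andbA. Qed.

Lemma step_weight_rcons tau C w s d : step_weight tau C w (rcons s d) =
  step_weight tau C w s * tau (clus C s) (endpoint M w s) d.
Proof. by elim: s C w => [|e s IH] C w /=; rewrite ?mulr1 ?mul1r // IH mulrA. Qed.

Lemma sub_clus C s : C \subset clus C s.
Proof.
elim: s C => //= d s IH C; apply: fintype.subset_trans (IH _).
exact: finset.subsetUr.
Qed.

Lemma endpoint_clus v C s : v \in C -> endpoint M v s \in clus C s.
Proof.
case/lastP: s => [|s d] //= vC.
by rewrite /endpoint map_rcons last_rcons clus_rcons setU11.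
Qed.

Lemma card_clus C s : growth C s -> #|clus C s| = (#|C| + size s)%N.
Proof.
elim: s C => [|d s IH] C /=; first by rewrite addn0.
by move=> /and4P[_ _ dC /IH ->]; rewrite cardsU1 dC add1n addSnnS.
Qed.

Lemma growth_size C s : growth C s -> (size s <= #|{set D}|)%N.
Proof.
move=> /card_clus e; apply: leq_trans (max_card (mem (clus C s))).
by rewrite e leq_addl.
Qed.

Hypothesis map_M : is_map M.
Hypotheses (seedP : seed M \in porbits (vrot M)) (targetP : t \in porbits (vrot M)).

(** [green_sum1] counts the exits from the complement of the cluster; reversing the darts turns them
    into entrances indexed by darts leaving [C]. *)
Lemma sum_entrances C : t \notin C -> K C != 0 ->
  \sum_(d | (dtail M d \in C) && (dhead M d \notin C)) G C t (dhead M d) = 1.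
Proof.
move=> tC KN0; have tO : t \in off_cluster M C by rewrite inE tC.
rewrite -[RHS](green_sum1 KN0 tO).
under [RHS]eq_bigr do rewrite mulr_sumr.
rewrite [RHS](exchange_big_dep (fun d => dtail M d \in off_cluster M C)) /=; last first.
  by move=> v d vO /eqP ->.
rewrite (reindex_inj (h := drev M)) /=; last exact: perm_inj.
rewrite [LHS]big_mkcond [RHS]big_mkcond; apply: eq_bigr => d _.
rewrite dhead_drev // dtail_off -/(dhead M d) andbC.
case: (boolP (dtail M d \in C)) => //= dC.
rewrite (bigD1 (dtail M d)) /= ?dtail_off ?dC ?eqxx // [X in _ + X]big1 ?addr0; last first.
  by move=> v /andP[/andP[_ /eqP ->]]; rewrite eqxx.
by rewrite negbK -[dtail M (drev M d)]/(dhead M d); case: (_ \in C); rewrite ?mulr1 ?mulr0.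
Qed.

(** Both sides are compared through [G C w w]: [lapdet_setD1] produces it from the determinants, and
    [green_setD1] from the Green function at the target. When [w] is the target only the former
    remains, matched by the value 1 that [harm] takes on clusters containing the target. *)
Lemma entrance_step C d : t \notin C -> seed M \in C -> dhead M d \notin C ->
  K C * G C t (dhead M d) = K (dhead M d |: C) * harm (dhead M d |: C) (dhead M d).
Proof.
move=> tC sC dC; set w := dhead M d.
have wO : w \in off_cluster M C by rewrite dhead_off.
have tO : t \in off_cluster M C by rewrite inE tC.
have KN0 : K C != 0 by apply: clusterdet_neq0 sC seedP.
have KwN0 : K (w |: C) != 0.
  by apply: (@clusterdet_neq0 _ _ map_M _ _ w); rewrite ?setU11 // dtail_porbits.
have det1 : K C * G C w w = K (w |: C).
  by rewrite /clusterdet off_cluster_setU1 -lapdet_setD1.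
rewrite /harm !inE (negPf tC) orbF; case: eqP => [->|/eqP tw]; first by rewrite det1 mulr1.
rewrite -det1 -mulrA; congr (_ * _).
have KwN0' : lapdet R (dtail M) (dhead M) (off_cluster M C :\ w) != 0.
  by rewrite -off_cluster_setU1.
rewrite /clustergreen (green_setD1 KN0 KwN0') //; congr (_ * _).
rewrite -off_cluster_setU1; under eq_bigr do rewrite mulr_sumr.
rewrite (exchange_big_dep (fun d => dtail M d \in off_cluster M (w |: C))) /=; last first.
  by move=> v e vO /eqP ->.
rewrite [RHS](reindex_inj (h := drev M)) /=; last exact: perm_inj.
rewrite [LHS]big_mkcond [RHS]big_mkcond; apply: eq_bigr => e _.
rewrite dhead_drev // dtail_off -/(dhead M e) andbC.
case: (boolP (dtail M e \in w |: C)) => //= eC.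
rewrite (bigD1 (dtail M e)) /= ?dtail_off ?eC ?eqxx // [X in _ + X]big1 ?addr0; last first.
  by move=> v /andP[/andP[_ /eqP ->]]; rewrite eqxx.
by case: eqP; rewrite ?mulr1 ?mulr0.
Qed.

Definition dla_step C w d : R := harm C w.
Definition path_step C w d : R := (dtail M d == w)%:R.

(* The number of spanning trees times the probability that the process with
   transition probabilities [tau C w d * G C t (dhead M d) / harm C w], for a
   cluster [C] with tip [w], starts with [s]. *)
Definition growth_weight tau s : R :=
  if growth [set seed M] s then K (clus [set seed M] s)
     * harm (clus [set seed M] s) (endpoint M (seed M) s)
     * step_weight tau [set seed M] (seed M) s
  else 0.

(** Conservation of probability, multiplied by [harm C w] because this may vanish. *)
Definition fair_step tau := forall C w, t \notin C -> seed M \in C -> w \in C ->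
  \sum_(d | (dtail M d \in C) && (dhead M d \notin C)) tau C w d * G C t (dhead M d) = harm C w.

Lemma dla_fair : fair_step dla_step.
Proof.
move=> C w tC sC wC; rewrite -mulr_sumr sum_entrances ?mulr1 //.
exact: clusterdet_neq0 sC seedP.
Qed.

Lemma path_fair : fair_step path_step.
Proof.
move=> C w tC sC wC; rewrite /harm (negPf tC) [LHS]big_mkcond [RHS]big_mkcond.
apply: eq_bigr => d _; rewrite /path_step; case: eqP => dw; last by rewrite mul0r; case: ifP.
by rewrite dw wC mul1r.
Qed.

Lemma seed_clus s : seed M \in clus [set seed M] s.
Proof. by apply: (fintype.subsetP (sub_clus _ _)); rewrite set11. Qed.

Lemma growth_weight_rcons tau s : fair_step tau -> t \notin clus [set seed M] s ->
  \sum_d growth_weight tau (rcons s d) = growth_weight tau s.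
Proof.
move=> fair tC; rewrite /growth_weight; set C := clus _ s; set w := endpoint _ _ s.
case: (boolP (growth _ s)) => gs; last first.
  by rewrite big1 // => d _; rewrite growth_rcons (negPf gs).
have wC : w \in C by rewrite endpoint_clus ?set11.
rewrite -(fair C w) ?seed_clus // mulr_sumr mulr_suml [RHS]big_mkcond.
apply: eq_bigr => d _; rewrite growth_rcons gs -/C tC /=.
case: (boolP ((dtail M d \in C) && (dhead M d \notin C))) => // /andP[_ dC].
rewrite clus_rcons -/C step_weight_rcons -/C -/w.
rewrite /endpoint map_rcons last_rcons -entrance_step ?seed_clus //.
by ring.
Qed.

Hypothesis seed_target : seed M != t.

Lemma harm_seed : harm [set seed M] (seed M) = 1.
Proof.
have tC : t \notin [set seed M] by rewrite inE eq_sym.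
rewrite /harm (negPf tC) -[RHS](sum_entrances tC).
  by apply: eq_bigl => d; rewrite !inE.
by apply: clusterdet_neq0 (set11 _) seedP.
Qed.

Definition stopped_weight tau s : R :=
  (t \in clus [set seed M] s)%:R * growth_weight tau s.

(** Keeping [K C * harm C w] on the left avoids dividing by it: [entrance_step] converts [K C] times
    the hitting probability into the same factor for the next cluster, and [harm C w] remains as the
    [dla_step] weight. *)
Lemma dla_probE C w s : seed M \in C -> exists q : R, dla_prob R M C s = q%:E /\
  K C * harm C w * q = if growth C s && (t \in clus C s)
   then K (clus C s) * harm (clus C s) (endpoint M w s) * step_weight dla_step C w s else 0.
Proof.
elim: s C w => [|d s IH] C w sC /=.
  exists (t \in C)%:R; case: (t \in C); by rewrite ?mulr1 ?mulr0.
case: (boolP (t \in C)) => tC /=; first by exists 0; rewrite mulr0.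
case: (boolP ((dtail M d \in C) && (dhead M d \notin C))) => dC; last first.
  exists 0; rewrite hit_prob_eq0 // ?mul0e ?mulr0; last exact: drevK.
  by rewrite -!andbA andbA (negPf dC).
have [|q [-> qE]] := IH (dhead M d |: C) (dhead M d); first by rewrite inE sC orbT.
case/andP: dC => tdC hdC.
exists (G C t (dhead M d) * q); split.
  rewrite hit_probE ?EFinM //; [exact: drevK | exact: clusterdet_neq0 sC seedP |].
  by rewrite inE tC.
rewrite tdC hdC /=; transitivity (harm C w * (K C * G C t (dhead M d) * q)).
  by rewrite -!mulrA mulrCA.
rewrite entrance_step // qE; case: ifP => _; last by rewrite mulr0.
by rewrite /dla_step mulrCA -!mulrA.
Qed.

Lemma dla_lawE s : dla_law R M s =
  (stopped_weight dla_step s / (nb_spanning_trees M)%:R)%:E.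
Proof.
have [q [dlaq]] := dla_probE (seed M) s (set11 (seed M)).
rewrite /dla_law dlaq harm_seed mulr1 => qE.
rewrite (nb_spanning_treesE map_M seedP); congr EFin.
have KN0 : K [set seed M] != 0 by apply: clusterdet_neq0 (set11 _) seedP.
apply: (mulfI KN0); rewrite qE mulrCA mulfV // mulr1 /stopped_weight /growth_weight.
by case: (growth _ s); case: (_ \in _); rewrite ?mul1r ?mul0r.
Qed.

(** The same vertices are collected in different orders: [lpath] adds the tails, with the target
    present from the start, while the growth adds the heads and meets the target last. At the end
    both sets consist of [B] and the vertices of the path. *)
Lemma lpath_growth (B : {set {set D}}) v s : t \notin B -> v \notin B ->
  (if lpath M t (t |: B) v s then K (tail_cluster M (t |: B) s) else 0) =
  (if growth (v |: B) s && (t \in clus (v |: B) s)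
   then K (clus (v |: B) s) * step_weight path_step (v |: B) v s else 0).
Proof.
elim: s B v => [|d s IH] B v tB vB /=.
  by rewrite !inE (negPf tB) orbF eq_sym; case: eqP => [->|//]; rewrite mulr1.
rewrite !inE (negPf tB) (negPf vB) !orbF [t == v]eq_sym /path_step.
case: (eqVneq v t) => //= vt; rewrite [dtail M d == v]eq_sym.
case: (eqVneq v (dtail M d)) => /= [dv|dv]; last by rewrite mul0r mulr0; case: ifP.
rewrite mul1r -dv; set w := dhead M d.
have -> : v |: (t |: B) = t |: (v |: B) by rewrite finset.setUCA.
have tvB : t \notin v |: B by rewrite !inE negb_or eq_sym vt.
case: (boolP (w \in v |: B)) => wB /=; last first.
  by rewrite IH // -!in_setU1 ?wB //; move: wB; rewrite !inE => ->.
have -> : lpath M t (t |: (v |: B)) w s = false.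
  case: s {IH} => [|e s] /=; first by apply/eqP => wt; rewrite -wt wB in tvB.
  by rewrite inE wB orbT.
by move: wB; rewrite !inE => ->.
Qed.

(** Loop erasure brings in the determinant at the target, cluster growth the one at the seed; by
    [nb_spanning_treesE] both are the number of spanning trees. *)
Lemma lerw_lawE s : lerw_law R M s =
  (stopped_weight path_step s / (nb_spanning_trees M)%:R)%:E.
Proof.
have det_neq0 C : t \in C -> K C != 0 by move=> tC; apply: clusterdet_neq0 tC targetP.
rewrite (lerw_law_lpath det_neq0) // (nb_spanning_treesE map_M targetP).
have := @lpath_growth finset.set0 (seed M) s; rewrite !finset.setU0 !inE => /(_ isT isT) e.
congr EFin; transitivity ((if lpath M t [set t] (seed M) s then
   K (tail_cluster M [set t] s) else 0) / K [set t]); first by case: ifP; rewrite ?mul0r.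
rewrite e /stopped_weight /growth_weight; congr (_ / _).
case: (growth _ s); rewrite ?mulr0 //=; rewrite /harm.
by case: (_ \in _); rewrite ?mulr1 ?mul1r ?mul0r.
Qed.

Lemma stopped_weight_oversize tau s : (#|{set D}| < size s)%N -> stopped_weight tau s = 0.
Proof.
move=> big; rewrite /stopped_weight /growth_weight; case: ifP => [/growth_size|]; last by rewrite mulr0.
by rewrite leqNgt big.
Qed.

(** Sequences shorter than [k] are their own prefix. For the others, [growth_weight_rcons] shows
    that the stopped weights of all continuations of a prefix add up to its growth weight; the range
    is long enough because each step adds a new vertex to the cluster. *)
Lemma stopped_marginal tau (F : seq D -> R) k : fair_step tau ->
  \sum_(i < k + #|{set D}|.+1) seqsum i (fun s => F (take k s) * stopped_weight tau s) =
  \sum_(i < k) seqsum i (fun s => F s * stopped_weight tau s) +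
  seqsum k (fun s => F s * growth_weight tau s).
Proof.
move=> fair; rewrite big_split_ord /=; congr (_ + _).
  apply: eq_bigr => i _; apply: eq_seqsum => s si.
  by rewrite take_oversize // si ltnW.
(* [W j] is the weight present at length [k + j]; it loses the part that stops there and passes the
   rest on to [W j.+1]. *)
pose W j := seqsum (k + j) (fun s => F (take k s) * growth_weight tau s).
have -> : seqsum k (fun s => F s * growth_weight tau s) = W 0%N.
  by rewrite /W addn0; apply: eq_seqsum => s sk; rewrite take_oversize ?sk.
have Wstep j : W j = seqsum (k + j) (fun s => F (take k s) * stopped_weight tau s) + W j.+1.
  rewrite /W addnS seqsum_rcons -seqsumD; apply: eq_seqsum => s sk.
  have -> : \sum_d F (take k (rcons s d)) * growth_weight tau (rcons s d)
     = F (take k s) * \sum_d growth_weight tau (rcons s d).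
    rewrite mulr_sumr; apply: eq_bigr => d _.
    by rewrite -cats1 takel_cat // sk leq_addr.
  rewrite /stopped_weight; case: (boolP (t \in _)) => tC; last first.
    by rewrite growth_weight_rcons // mul0r mulr0 add0r.
  rewrite mul1r big1 ?mulr0 ?addr0 // => d _.
  by rewrite /growth_weight growth_rcons tC andbF.
have Wsum n : \sum_(i < n) seqsum (k + i) (fun s => F (take k s) * stopped_weight tau s) + W n = W 0%N.
  by elim: n => [|n IH]; rewrite ?big_ord0 ?add0r // big_ord_recr /= -addrA -Wstep.
rewrite -(Wsum #|{set D}|.+1) [W _ in RHS]seqsum0 ?addr0 // => s sk.
rewrite /growth_weight; case: ifP => [/growth_size|]; last by rewrite mulr0.
by rewrite sk leqNgt addnS ltnS leq_addl.
Qed.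

End ClusterGrowth.

(** * Unzipping a growing cluster *)

Section InlPerm.
Variable D : finType.
Local Notation T := (D + D)%type.
Implicit Types (s : {perm D}) (r : {perm T}).

Lemma inl_permE s d : inl_perm s (inl d) = inl (s d). Proof. by rewrite permE. Qed.
Lemma inr_permE s d : inl_perm s (inr d) = inr d. Proof. by rewrite permE. Qed.

Lemma inl_permM s t : (inl_perm s * inl_perm t = inl_perm (s * t))%g.
Proof. by apply/permP => -[] d; rewrite permM ?inl_permE ?inr_permE ?permM. Qed.

Lemma inl_permV s : ((inl_perm s)^-1 = inl_perm s^-1)%g.
Proof.
apply/permP => x; apply: (@perm_inj _ (inl_perm s)); rewrite permKV.
by case: x => d; rewrite ?inl_permE ?inr_permE ?permKV.
Qed.

Lemma inl_perm_inj : injective (@inl_perm D).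
Proof.
move=> s t st; apply/permP => d; have := inl_permE s d; rewrite st inl_permE.
by case.
Qed.

Lemma inl_permX s i d : (inl_perm s ^+ i)%g (inl d) = inl ((s ^+ i)%g d).
Proof. by elim: i => [|i IH]; rewrite ?expg0 ?perm1 // !expgSr !permM IH inl_permE. Qed.

Lemma porbit_inl s d : porbit (inl_perm s) (inl d) = inl @: porbit s d.
Proof.
apply/setP => x; apply/porbitP/imsetP => [[i ->]|[e /porbitP[i ->] ->]].
  by exists ((s ^+ i)%g d); [apply/porbitP; exists i | rewrite inl_permX].
by exists i; rewrite inl_permX.
Qed.

Lemma porbit_inr s d : porbit (inl_perm s) (inr d) = [set inr d].
Proof.
apply/setP => x; rewrite inE -eq_porbit_mem; apply/eqP/eqP => [|->//].
exact/porbit_fixed/inr_permE.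
Qed.

Lemma porbit_inl_eq s d e :
  (porbit (inl_perm s) (inl d) == porbit (inl_perm s) (inl e)) = (porbit s d == porbit s e).
Proof. by rewrite !eq_porbit_mem porbit_inl mem_imset //; apply: inl_inj. Qed.

Lemma card_porbits_inl s : #|porbits (inl_perm s)| = (#|porbits s| + #|D|)%N.
Proof.
pose f (x : {set D} + D) : {set T} := match x with inl A => inl @: A | inr d => [set inr d] end.
have -> : porbits (inl_perm s) =
    f @: ((inl @: porbits s) :|: (inr @: [set: D])).
  apply/setP => A; apply/imsetP/imsetP => [[[d|d] _ ->]|[[B|d]]].
  - exists (inl (porbit s d)); last exact: porbit_inl.
    by rewrite inE; apply/orP; left; apply: imset_f; exact: imset_f.
  - exists (inr d); last exact: porbit_inr.
    by rewrite inE; apply/orP; right; exact: imset_f.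
  - rewrite inE => /orP[] /imsetP[] // C /imsetP[d _ ->] [->] ->.
    by exists (inl d); rewrite // porbit_inl.
  by move=> _ ->; exists (inr d); rewrite // porbit_inr.
rewrite card_in_imset.
  rewrite cardsU (_ : _ :&: _ = set0).
    by rewrite cards0 subn0 (card_imset _ (@inl_inj _ _)) (card_imset _ (@inr_inj _ _)) cardsT.
  by apply/setP => -[x|x]; rewrite !inE; apply/negP => /andP[/imsetP[] // _ _ _ /imsetP[]].
move=> [A|d] [B|e]; rewrite !inE => AP BP /= fAB.
- by congr inl; exact: (imset_inj inl_inj fAB).
- by have := set11 (inr e : T); rewrite -fAB => /imsetP[].
- by have := set11 (inr d : T); rewrite fAB => /imsetP[].
by have := set11 (inr d : T); rewrite fAB inE => /eqP[->].
Qed.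

Lemma inl_perm_exists r : (forall d, r (inr d) = inr d) -> exists s, r = inl_perm s.
Proof.
move=> rfix; pose f d := if r (inl d) is inl e then e else d.
have rf d : r (inl d) = inl (f d).
  rewrite /f; case rd: (r (inl d)) => [//|e].
  by have := rfix e; rewrite -rd => /perm_inj.
have f_inj : injective f.
  by move=> d e fde; have := rf d; rewrite fde -rf => /perm_inj[].
by exists (perm f_inj); apply/permP => -[] d; rewrite ?inl_permE ?inr_permE // permE.
Qed.

End InlPerm.

(** * Closed maps as maps with an empty polygon *)

Section ClosedMaps.
Variables (D : finType) (nv nf : nat).
Implicit Types (M : dmap D) (d e : D).

Definition marked_map M : Prop :=
  [/\ is_map M, #|porbits (vrot M)| = nv, #|porbits (face_perm M)| = nf,
      seed M \in porbits (vrot M) /\ target M \in porbits (vrot M) & seed M != target M].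

Lemma closed_polygon_map M : is_map M ->
  #|porbits (vrot M)| = nv -> #|porbits (face_perm M)| = nf ->
  polygon_map nv nf 0 (inl_perm (vrot M)) (inl_perm (drev M)) set0.
Proof.
move=> mapM cv cf; split; try by move=> *; rewrite ?inE ?inr_permE.
- by move=> a; rewrite inE.
- by move=> e _; exists (drev M e); split; rewrite ?inl_permE ?drevK ?drev_neq ?inE.
- by move=> a; rewrite inE.
- by move=> S a aS /(_ a aS); rewrite inE.
- by move=> y y'; rewrite inE.
- move=> S a aS _ Sr So b.
  have [p [wk _ ep]] := mapM.2 a b.
  have Sv e : porbit (vrot M) e = dtail M a -> e \in S.
    by move=> ea; apply: (Sr a e aS); apply/eqP; rewrite porbit_inl_eq; apply/eqP.
  move: (dtail M a) wk ep Sv => v; elim: p v => [|d p IH] v /=.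
    by rewrite /endpoint /= => _ -> Sv; exact: Sv.
  move=> /andP[/eqP dv wk] ep Sv; apply: (IH _ wk ep) => e ed.
  have dS : d \in S by exact: Sv.
  have d'S : drev M d \in S by apply: (So d) => //; rewrite ?inE ?inl_permE.
  by apply: (Sr _ _ d'S); apply/eqP; rewrite porbit_inl_eq; apply/eqP.
- by rewrite cards0.
- by rewrite card_porbits_inl cv !addn0.
by rewrite inl_permV inl_permM card_porbits_inl cf !addn0.
Qed.

Lemma polygon_map_closed r o P : polygon_map nv nf 0 r o P ->
  exists M : {perm D} * {perm D}, [/\ P = set0, r = inl_perm M.1, o = inl_perm M.2 &
    forall root sd tg, let M := DMap M.1 M.2 root sd tg in
      [/\ is_map M, #|porbits (vrot M)| = nv & #|porbits (face_perm M)| = nf]].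
Proof.
move=> W; have P0 : P = set0 by apply/eqP; rewrite -cards_eq0 (pm_card W).
have nP e : inr e \notin P by rewrite P0 inE.
have [rho rE] := inl_perm_exists (fun e => pm_rfix W (nP e)).
have [om oE] := inl_perm_exists (fun e => pm_ofix W (nP e)).
exists (rho, om); split=> // root sd tg M.
have omK d : om d != d /\ om (om d) = d.
  have [e [_ ed oe oe']] := pm_o W (nP d); move: oe oe'.
  by rewrite oE !inl_permE => -[->] [].
split.
- split=> // x y.
  suff : y \in [set b | `[< joined M [set: D] (dtail M x) (dtail M b) >]].
    by rewrite inE => /asboolP.
  have xS : x \in [set b | `[< joined M [set: D] (dtail M x) (dtail M b) >]].
    by rewrite inE; apply/asboolP; exact: joined_refl.
  apply: (pm_conn W xS) => [b|b c|b c]; rewrite ?(negPf (nP b)) // !inE.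
    move=> /asboolP bS cb; apply/asboolP.
    rewrite /dtail /=; move/eqP: cb; rewrite rE porbit_inl_eq => /eqP ->.
    exact: bS.
  move=> /asboolP bS _; rewrite oE inl_permE => -[<-]; apply/asboolP.
  apply: joined_trans bS _; apply: (@joined_cons _ M _ b); first by rewrite inE.
  exact: joined_refl.
- by have := pm_vertices W; rewrite rE card_porbits_inl !addn0 => /addIn.
by have := pm_faces W; rewrite rE oE inl_permV inl_permM card_porbits_inl !addn0 => /addIn.
Qed.

End ClosedMaps.

Section UnzipWalk.
Variables (D : finType) (nv nf : nat).
Local Notation T := (D + D)%type.
Implicit Types (M : dmap D) (Y : gmap D) (d e : D) (s : seq D).

Local Notation cluster M s := (clus M [set seed M] s).
Local Notation tip M s := (endpoint M (seed M) s).

(* How the map obtained by unzipping a cluster remembers the original map: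
   off the cluster, its vertices are the original ones. *)
Record unzipped M s Y : Prop := Unzipped {
  un_map : polygon_map nv nf (size s) (grot Y) (gopp Y) (gpoly Y);
  un_cluster : forall e, (dtail M e \in cluster M s) <->
    (exists2 y, y \in gpoly Y & porbit (grot Y) y = porbit (grot Y) (inl e)) \/
    (s = [::] /\ dtail M e = seed M);
  un_off : forall e e', (dtail M e \notin cluster M s) || (s == [::]) ->
    (porbit (grot Y) (inl e') == porbit (grot Y) (inl e)) = (dtail M e' == dtail M e);
  un_opp : forall e, inr e \notin gpoly Y -> gopp Y (inl e) = inl (drev M e);
  un_poly : forall e, inr e \in gpoly Y -> inr (drev M e) \in gpoly Y;
  un_tip : forall e, (inl e \in gtip Y) = (dtail M e == tip M s);
  un_gtip : s <> [::] -> exists2 a, inr a \in gpoly Y & gtip Y = porbit (grot Y) (inr a);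
  un_target : exists2 e, target M = dtail M e & gtarget Y = porbit (grot Y) (inl e) }.

(** The [pick] in [unzip] has at most one candidate by [pm_sep], and it finds [y0] when the polygon
    is nonempty. *)
Lemma unzipE M Y d y0 : polygon_map nv nf (#|gpoly Y|./2) (grot Y) (gopp Y) (gpoly Y) ->
    unzippable (grot Y) (gopp Y) (gpoly Y) d (drev M d) y0 ->
    let r := unzip_rot (grot Y) d (drev M d) y0 in
  unzip M Y d = GMap r (unzip_opp (gopp Y) d (drev M d)) (unzip_poly (gpoly Y) d (drev M d))
     (porbit r (inr d)) (\bigcup_(x in gtarget Y) porbit r x).
Proof.
move=> W U r; rewrite /unzip /=.
set sp := (if _ is Some y then _ else _).
have -> : sp = tperm (inr (drev M d)) y0.
  rewrite /sp; case: pickP => [y /andP[yP]|no].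
    rewrite -eq_porbit_mem => /eqP yd; congr tperm.
    case: (uz_y0 U) => [[P0 _]|[y0P y0d]]; first by rewrite P0 inE in yP.
    by apply: (pm_sep W) => //; rewrite yd.
  case: (uz_y0 U) => [[_ ->]|[y0P y0d]]; first by rewrite tperm1.
  by have := no y0; rewrite /= y0P -eq_porbit_mem y0d eqxx.
by rewrite /r /unzip_rot /insert_rot /unzip_opp /unzip_poly !mulgA.
Qed.

Lemma bigcup_porbit_unzip r0 o0 P0 d d' y0 (e : D) :
  unzippable r0 o0 P0 d d' y0 ->
  porbit r0 (inl e) <> porbit r0 (inl d) ->
  let r := unzip_rot r0 d d' y0 in
  \bigcup_(x in porbit r0 (inl e)) porbit r x = porbit r (inl e).
Proof.
move=> U ed r; apply/setP => z; apply/bigcupP/idP => [[x xe]|ze]; last first.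
  by exists (inl e); first exact: porbit_id.
rewrite -eq_porbit_mem => /eqP zx.
have xe' : porbit r0 x = porbit r0 (inl e) by apply/eqP; rewrite eq_porbit_mem.
rewrite -eq_porbit_mem zx (vertex_unchanged U) ?xe' //.
  apply/eqP => xd; rewrite xd in xe'.
  by have := porbit_fixed (uz_rfix U (uz_d U)) (esym xe').
apply/eqP => xd; rewrite xd in xe'.
by have := porbit_fixed (uz_rfix U (uz_d' U)) (esym xe').
Qed.

Section OneStep.
Variables (M : dmap D) (s : seq D) (Y : gmap D) (d : D).
Hypotheses (MM : marked_map nv nf M) (UN : unzipped M s Y).
Let map_M : is_map M. Proof. by case: MM. Qed.
Local Notation C := (cluster M s).

Lemma half_card_poly : #|gpoly Y|./2 = size s.
Proof. by rewrite (pm_card (un_map UN)) doubleK. Qed.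

Lemma un_poly_cluster e : inr e \in gpoly Y -> dtail M e \in C.
Proof.
move=> eP; apply/(un_cluster UN); left.
have [m sm] : exists m, size s = m.+1.
  by case: (size s) (pm_card (un_map UN)) => [/eqP|m _]; [rewrite cards_eq0 => /eqP P0; rewrite P0 inE in eP | exists m].
have := un_map UN; rewrite sm => W; have [a aP ra] := polygon_pred W eP eP.
by exists (inr a); rewrite // -ra porbit1.
Qed.

Lemma un_unzippable : growth M [set seed M] (rcons s d) ->
  exists y0, unzippable (grot Y) (gopp Y) (gpoly Y) d (drev M d) y0.
Proof.
rewrite growth_rcons => /and4P[gs tC dC hC]; have W := un_map UN.
have dP : inr d \notin gpoly Y.
  by apply: contra hC => /(un_poly UN); exact: un_poly_cluster.
have d'P : inr (drev M d) \notin gpoly Y by apply: contra hC; exact: un_poly_cluster.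
have off y : y \in gpoly Y -> porbit (grot Y) y <> porbit (grot Y) (inl (drev M d)).
  by move=> yP h; apply: (negP hC); apply/(un_cluster UN); left; exists y.
have hd : porbit (grot Y) (inl (drev M d)) <> porbit (grot Y) (inl d).
  move/eqP; rewrite eq_sym (un_off UN (e := drev M d)) ?(hC : dtail M (drev M d) \notin C) // => /eqP h.
  by move: hC; rewrite -[dhead M d]/(dtail M (drev M d)) -h dC.
have U y0 : (gpoly Y = set0 /\ y0 = inr (drev M d)) \/
    (y0 \in gpoly Y /\ porbit (grot Y) y0 = porbit (grot Y) (inl d)) ->
    unzippable (grot Y) (gopp Y) (gpoly Y) d (drev M d) y0.
  move=> y0P; split=> //.
  - exact: pm_inl W.
  - by rewrite eq_sym drev_neq.
  - exact: pm_rfix W.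
  - exact: pm_ofix W.
  - exact: un_opp UN _ dP.
  by rewrite (un_opp UN d'P) drevK.
have /(un_cluster UN)[[y yP yd]|[s0 _]] := dC; first by exists y; apply: U; right.
exists (inr (drev M d)); apply: U; left; split => //.
by apply/eqP; rewrite -cards_eq0 (pm_card W) s0.
Qed.

Lemma un_unzip : growth M [set seed M] (rcons s d) -> unzipped M (rcons s d) (unzip M Y d).
Proof.
move=> gsd; have [y0 U] := un_unzippable gsd.
move: gsd; rewrite growth_rcons => /and4P[gs tC dC hC]; have W := un_map UN.
have W2 : polygon_map nv nf (#|gpoly Y|./2) (grot Y) (gopp Y) (gpoly Y).
  by rewrite half_card_poly.
rewrite (unzipE W2 U); set r0 := grot Y in U W *; set o0 := gopp Y in U W *.
set P0 := gpoly Y in U W *; set d' := drev M d in U *.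
set r := unzip_rot r0 d d' y0; set P := unzip_poly P0 d d'.
have inPd : inr d \in P by rewrite unzip_polyE eqxx.
have inPd' : inr d' \in P by rewrite unzip_polyE eqxx orbT.
have tipE e : porbit r (inl e) = porbit r (inr d) <-> dtail M e = dhead M d.
  have rd : porbit r (inl d') = porbit r (inr d) by rewrite -(unzip_d U) porbit1.
  have := un_off UN (e := d') e; rewrite (hC : dtail M d' \notin C) => /(_ isT); rewrite -/r0 -[dtail M d']/(dhead M d).
  have := @vertex_unchanged _ _ _ _ _ _ _ U (inl d') (inl e) isT isT isT isT (uz_head U).
  rewrite -/r rd => <- h; split=> /eqP; first by rewrite h => /eqP.
  by rewrite -h => /eqP.
(* The first alternative absorbs the initial case, in which the seed is the origin of [d] and
   carries no polygon dart. *)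
have clE e : dtail M e \in C <-> porbit r0 (inl e) = porbit r0 (inl d) \/
    exists2 y, y \in P0 & porbit r0 y = porbit r0 (inl e).
  split.
    move=> /(un_cluster UN)[h|[s0 es]]; [by right | left].
    move: dC; rewrite s0 inE => /eqP ds.
    by apply/eqP; rewrite (un_off UN) ?s0 ?eqxx ?orbT // es ds.
  case=> [ed|h]; last by apply/(un_cluster UN); left.
  apply: contraT => eC; have := un_off UN (e := e) d; rewrite eC => /(_ isT).
  by rewrite -/r0 ed eqxx => /esym/eqP h; rewrite -h dC in eC.
have split_on e : porbit r0 (inl e) = porbit r0 (inl d) ->
    exists2 y, y \in P & porbit r y = porbit r (inl e).
  move=> /(split_vertex U) [->|->]; first by exists (inr d').
  by exists y0; first exact: poly_y0 U.
have old_on y e : y \in P0 -> porbit r0 (inl e) <> porbit r0 (inl d) ->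
    (porbit r y == porbit r (inl e)) = (porbit r0 y == porbit r0 (inl e)).
  move=> yP ne; apply: (vertex_unchanged U) => //.
    by apply: contraTneq yP => ->; exact: uz_d U.
  by apply: contraTneq yP => ->; exact: uz_d' U.
have P0P y : y \in P0 -> y \in P by move=> yP; rewrite !inE yP !orbT.
have newclE e : dtail M e \in dhead M d |: C <->
    exists2 y, y \in P & porbit r y = porbit r (inl e).
  split.
    rewrite in_setU1 => /predU1P[/tipE h|/clE [/split_on //|[y yP yE]]].
      by exists (inr d).
    have [/split_on //|/eqP ne] := eqVneq (porbit r0 (inl e)) (porbit r0 (inl d)).
    by exists y; [exact: P0P | apply/eqP; rewrite old_on // yE].
  case=> y; rewrite /P /unzip_poly !in_setU1 => /or3P[/eqP ->|/eqP ->|yP] yE.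
  - by apply/orP; left; apply/eqP/tipE.
  - apply/orP; right; apply/clE; left.
    by have := old_vertexP U yE; rewrite (old_vertex_d' U) old_vertex_inl.
  apply/orP; right; apply/clE.
  have [->|/eqP ne] := eqVneq (porbit r0 (inl e)) (porbit r0 (inl d)); [by left | right].
  by exists y => //; apply/eqP; rewrite -old_on // yE.
have newoff e : dtail M e \notin dhead M d |: C -> porbit r0 (inl e) <> porbit r0 (inl d).
  move=> eC /split_on h; apply: (negP eC); exact/newclE.
have [et tE gtE] := un_target UN.
have tO : porbit r0 (inl et) <> porbit r0 (inl d).
  move=> h; apply: (negP tC); rewrite tE; apply/clE; by left.
have sz : size (rcons s d) = (size s).+1 by rewrite size_rcons.
split; rewrite /= ?clus_rcons.
- by rewrite sz; exact: unzip_polygon_map U _ _ _ W.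
- move=> e; split=> [/newclE h|]; first by left.
  by case=> [/newclE //|[]]; case: (s).
- move=> e e'; rewrite orbC; have -> /= : (rcons s d == [::]) = false by case: (s).
  move=> eC; rewrite (vertex_unchanged U) //; last exact: newoff.
  apply: (un_off UN); apply/orP; left; apply: contra eC => eC.
  by rewrite in_setU1 eC orbT.
- by move=> e eP; apply/(unzip_oppE U _ eP)/(un_opp UN); move: eP; rewrite unzip_polyE !negb_or => /and3P[].
- move=> e; rewrite !unzip_polyE => /or3P[/eqP ->|/eqP ->|/(un_poly UN) ->].
  + by rewrite eqxx orbT.
  + by rewrite /d' drevK // eqxx.
  by rewrite !orbT.
- move=> e; rewrite -eq_porbit_mem /endpoint map_rcons last_rcons.
  by apply/eqP/eqP => /tipE.
- by exists d.
exists et => //; rewrite gtE; exact: bigcup_porbit_unzip U tO.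
Qed.
End OneStep.

Lemma unzipped_init M : marked_map nv nf M -> unzipped M [::] (gmap_init M).
Proof.
case=> mapM cv cf [/imsetP[es _ sE] /imsetP[et _ tE]] st; split=> //=.
- exact: closed_polygon_map.
- move=> e; rewrite inE; split=> [/eqP ->|]; first by right.
  by case=> [[y]|[_ ->]]; rewrite ?inE.
- by move=> e e' _; rewrite porbit_inl_eq.
- by move=> e _; rewrite inl_permE.
- by move=> e; rewrite inE.
- move=> e; rewrite mem_imset; last exact: inl_inj.
  by rewrite dtail_eqE // sE; exact: imset_f.
exists et => //; by rewrite tE porbit_inl.
Qed.

Lemma unzipped_all M s : marked_map nv nf M -> growth M [set seed M] s ->
  unzipped M s (unzip_all M s).
Proof.
move=> MM; elim/last_ind: s => [_|s d IH gs]; first exact: unzipped_init.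
have gs' : growth M [set seed M] s by move: gs; rewrite growth_rcons => /and4P[].
rewrite /unzip_all foldl_rcons -/(unzip_all M s).
exact: un_unzip MM (IH gs') gs.
Qed.

End UnzipWalk.

(** * Reshuffling *)

Section GmapFinite.
Variable D : finType.
Definition gmap_enc (Y : gmap D) := (grot Y, gopp Y, gpoly Y, gtip Y, gtarget Y).
Definition gmap_dec (u : {perm D + D} * {perm D + D} * {set D + D} * {set D + D} * {set D + D}) :=
  let: (r, o, p, v, t) := u in GMap r o p v t.
Lemma gmap_encK : cancel gmap_enc gmap_dec. Proof. by case. Qed.
HB.instance Definition _ := Finite.copy (gmap D) (can_type gmap_encK).
End GmapFinite.

Section Reshuffling.
Local Open Scope ring_scope.
Variables (R : realType) (D : finType) (nv nf : nat).
Local Notation T := (D + D)%type.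
Implicit Types (M : dmap D) (Y : gmap D) (d e : D) (s : seq D).

Local Notation cluster M s := (clus M [set seed M] s).
Local Notation tip M s := (endpoint M (seed M) s).
Local Notation marked := (@marked_map D nv nf).
Local Notation unzipped := (@unzipped D nv nf).
Local Notation grows M s := (growth M [set seed M] s).

Definition target_reached Y := [exists y in gpoly Y, y \in gtarget Y].

Lemma target_cluster M s Y : marked M -> unzipped M s Y ->
  (target M \in cluster M s) = target_reached Y.
Proof.
move=> [_ _ _ _ st] UN; have [e tE gE] := un_target UN.
rewrite /target_reached gE; apply/idP/existsP => [|[y /andP[yP]]].
  rewrite tE => /(un_cluster UN)[[y yP yE]|[_ es]].
    by exists y; rewrite yP -eq_porbit_mem yE eqxx.
  by rewrite tE es eqxx in st.
rewrite -eq_porbit_mem => /eqP yE; rewrite tE; apply/(un_cluster UN); left.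
by exists y.
Qed.

Section SameUnzipping.
Variables (M M' : dmap D) (s s' : seq D) (Y Y' : gmap D).
Hypotheses (MM : marked M) (MM' : marked M').
Hypotheses (UN : unzipped M s Y) (UN' : unzipped M' s' Y').
Hypotheses (s0 : s <> [::]) (s0' : s' <> [::]).
Hypotheses (rE : grot Y = grot Y') (oE : gopp Y = gopp Y') (pE : gpoly Y = gpoly Y').
Hypothesis tE : gtarget Y = gtarget Y'.
Local Notation C := (cluster M s).
Local Notation C' := (cluster M' s').

Lemma same_cluster e : (dtail M e \in C) = (dtail M' e \in C').
Proof.
apply/idP/idP => [/(un_cluster UN)|/(un_cluster UN')] [[y yP yE]|[]//].
  by apply/(un_cluster UN'); left; exists y; rewrite -?pE -?rE.
by apply/(un_cluster UN); left; exists y; rewrite ?pE ?rE.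
Qed.

Lemma same_dtail e : dtail M e \notin C -> dtail M e = dtail M' e.
Proof.
move=> eC; have eC' : dtail M' e \notin C' by rewrite -same_cluster.
apply/setP => e'; rewrite -!eq_porbit_mem.
have := un_off UN (e := e) e'; have := un_off UN' (e := e) e'.
by rewrite eC eC' rE => /(_ isT) h /(_ isT) h'; rewrite -[LHS]h' -[RHS]h.
Qed.

Lemma same_dhead_cluster e : (dhead M e \in C) = (dhead M' e \in C').
Proof.
have [eP|eP] := boolP (inr e \in gpoly Y).
  have eP' : inr e \in gpoly Y' by rewrite -pE.
  by rewrite /dhead (un_poly_cluster UN (un_poly UN eP)) (un_poly_cluster UN' (un_poly UN' eP')).
have eP' : inr e \notin gpoly Y' by rewrite -pE.
have := un_opp UN eP; rewrite oE (un_opp UN' eP') => -[h].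
by rewrite /dhead h same_cluster.
Qed.

Lemma same_dhead e : dhead M e \notin C -> dhead M e = dhead M' e.
Proof.
move=> eC; have eP : inr e \notin gpoly Y.
  by apply: contra eC => eP; exact: (un_poly_cluster UN (un_poly UN eP)).
have eP' : inr e \notin gpoly Y' by rewrite -pE.
have := un_opp UN eP; rewrite oE (un_opp UN' eP') => -[h].
by move: eC; rewrite /dhead h => /same_dtail.
Qed.

Lemma same_off_cluster : off_cluster M C = off_cluster M' C'.
Proof.
apply/setP => v; rewrite !inE; apply/andP/andP => -[+ /imsetP[e _ ve]]; rewrite ve.
  move=> eC; rewrite -[porbit _ e]/(dtail M e) in eC *.
  by rewrite (same_dtail eC) -same_cluster eC dtail_porbits.
move=> eC; rewrite -[porbit _ e]/(dtail M' e) in eC *.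
by rewrite -same_cluster in eC; rewrite -(same_dtail eC) eC dtail_porbits.
Qed.

(** Off the cluster the two maps have the same vertices, as sets of darts; on the cluster the
    vertices may differ, but the Dirichlet condition only sees membership. The tips of [Y] and [Y']
    are not compared, which lets the tip vary in [dla_balanced]. *)
Lemma same_lapmx : lapmx R (dtail M) (dhead M) (off_cluster M C) =
  lapmx R (dtail M') (dhead M') (off_cluster M' C').
Proof.
rewrite -same_off_cluster; apply: eq_lapmx => [d|d|d _|d _].
- by rewrite dtail_off same_off_cluster dtail_off same_cluster.
- by rewrite dtail_off => /same_dtail.
- by rewrite dhead_off same_off_cluster dhead_off same_dhead_cluster.
by rewrite dhead_off => /same_dhead.
Qed.

Lemma same_clusterdet : clusterdet R M C = clusterdet R M' C'.
Proof. by rewrite /clusterdet /lapdet same_lapmx. Qed.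

Lemma same_clustergreen u v : clustergreen R M C u v = clustergreen R M' C' u v.
Proof. by rewrite /clustergreen /green same_lapmx. Qed.

Lemma same_target_cluster : (target M \in C) = (target M' \in C').
Proof. by rewrite (target_cluster MM UN) (target_cluster MM' UN') /target_reached pE tE. Qed.

Lemma same_target : target M \notin C -> target M = target M'.
Proof.
move=> tC; have [e teE geE] := un_target UN; have [e' te'E ge'E] := un_target UN'.
have eC : dtail M e \notin C by rewrite -teE.
have := un_off UN (e := e) e'; rewrite eC => /(_ isT).
rewrite rE -ge'E -tE geE rE eqxx => /esym/eqP ee'.
by rewrite teE te'E -ee'; apply: same_dtail; rewrite ee'.
Qed.

Lemma harm_tip : target M \notin C -> harm R M C (tip M s) =
  \sum_(d | (inl d \in gtip Y) && (dhead M d \notin C)) clustergreen R M C (target M) (dhead M d).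
Proof. by move=> tC; rewrite /harm (negPf tC); apply: eq_bigl => d; rewrite (un_tip UN). Qed.

Lemma same_harm_sum (A : {set T}) : target M \notin C ->
  \sum_(d | (inl d \in A) && (dhead M d \notin C)) clustergreen R M C (target M) (dhead M d) =
  \sum_(d | (inl d \in A) && (dhead M' d \notin C')) clustergreen R M' C' (target M') (dhead M' d).
Proof.
move=> tC; apply: eq_big => [d|d /andP[_ dC]]; first by rewrite same_dhead_cluster.
by rewrite same_clustergreen same_target // same_dhead.
Qed.

End SameUnzipping.

Lemma same_harm M M' s s' Y : marked M -> marked M' -> unzipped M s Y -> unzipped M' s' Y ->
  s <> [::] -> s' <> [::] ->
  harm R M (cluster M s) (tip M s) = harm R M' (cluster M' s') (tip M' s').
Proof.
move=> MM MM' UN UN' s0 s0'.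
have tt := same_target_cluster MM MM' UN UN' erefl erefl.
have [tC|tC] := boolP (target M \in cluster M s); first by rewrite /harm -tt tC.
have tC' : target M' \notin cluster M' s' by rewrite -tt.
rewrite (harm_tip UN tC) (harm_tip UN' tC').
exact: (same_harm_sum UN UN' s0 s0' erefl erefl erefl erefl).
Qed.

(** By [pm_sep] each entrance dart leaves from exactly one polygon corner, so the sum over corners
    regroups [sum_entrances]. *)
Lemma sum_tips M s Y : marked M -> unzipped M s Y -> s <> [::] ->
    target M \notin cluster M s ->
  \sum_(y in gpoly Y)
     \sum_(d | (inl d \in porbit (grot Y) y) && (dhead M d \notin cluster M s))
        clustergreen R M (cluster M s) (target M) (dhead M d) = 1.
Proof.
move=> MM UN s0 tC; have [map_M _ _ [sP tP] _] := MM.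
rewrite -[RHS](sum_entrances map_M tP tC); last by apply: clusterdet_neq0 (seed_clus M s) sP.
rewrite (exchange_big_dep (fun d => (dtail M d \in cluster M s) && (dhead M d \notin cluster M s))) /=.
  apply: eq_bigr => d /andP[dC hC].
  have /(un_cluster UN)[[y yP yE]|[] //] := dC.
  rewrite (bigD1 y) /=; last by rewrite yP hC andbT -eq_porbit_mem yE eqxx.
  rewrite big1 ?addr0 // => y' /andP[/and3P[y'P]] + _.
  rewrite -eq_porbit_mem -yE => /eqP yy' /eqP[].
  exact/esym/(pm_sep (un_map UN)).
move=> y d yP /andP[dy ->]; rewrite andbT; apply/(un_cluster UN); left.
by exists y => //; apply/esym/eqP; rewrite eq_porbit_mem.
Qed.

(* Characterizes the maps obtained by unzipping k edges: the target is either
   off the polygon or its tip. *)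
Definition tipped_map k Y : Prop :=
  [/\ polygon_map nv nf k (grot Y) (gopp Y) (gpoly Y),
      exists2 a, inr a \in gpoly Y & gtip Y = porbit (grot Y) (inr a)
    & exists2 e, gtarget Y = porbit (grot Y) (inl e) &
        gtarget Y = gtip Y \/ forall y, y \in gpoly Y -> porbit (grot Y) y <> gtarget Y].

Lemma unzip_all_rcons M s d : unzip_all M (rcons s d) = unzip M (unzip_all M s) d.
Proof. by rewrite /unzip_all foldl_rcons. Qed.

Lemma tipped_unzip M s d : marked M -> grows M (rcons s d) ->
  tipped_map (size s).+1 (unzip_all M (rcons s d)).
Proof.
move=> MM gs; have UN := unzipped_all MM gs.
have n0 : rcons s d <> [::] by case: (s).
split; first by rewrite -(size_rcons s d); exact: un_map UN.
  exact: un_gtip UN n0.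
have [e tE gE] := un_target UN; exists e => //.
have [tC|tC] := boolP (target M \in cluster M (rcons s d)); last first.
  right=> y yP yE; apply: (negP tC); rewrite tE; apply/(un_cluster UN); left.
  by exists y => //; rewrite yE.
left; move: tC gs; rewrite clus_rcons growth_rcons in_setU1.
move=> /orP[/eqP tw|->]; last by rewrite andbF.
move=> _; have [a aP tipE] := un_gtip UN n0.
have : inl e \in gtip (unzip_all M (rcons s d)).
  by rewrite (un_tip UN) -tE tw /endpoint map_rcons last_rcons.
by rewrite gE tipE -eq_porbit_mem => /eqP.
Qed.

Section ZipTip.
Variables (k : nat) (Y : gmap D).
Hypothesis YT : tipped_map k.+1 Y.

(** The halves glued at the origin of [d] carry the polygon darts [inr d'] and [y0], neither of
    which is at the tip. Hence the target, being the tip or off the polygon, ends up off the smaller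
    polygon and away from the origin of [d]. *)
Lemma zip_tip : exists d d' r0 o0 P0 y0 e0,
  [/\ unzippable r0 o0 P0 d d' y0, polygon_map nv nf k r0 o0 P0,
      Y = GMap (unzip_rot r0 d d' y0) (unzip_opp o0 d d') (unzip_poly P0 d d')
            (porbit (unzip_rot r0 d d' y0) (inr d)) (porbit (unzip_rot r0 d d' y0) (inl e0)),
      porbit r0 (inl e0) <> porbit r0 (inl d)
    & forall y, y \in P0 -> porbit r0 y <> porbit r0 (inl e0)].
Proof.
case: YT => W [d dP tipE] [e gE gT].
have [r0 [o0 [P0 [d' [y0 [U W0 rE oE pE]]]]]] := exists_zip W dP.
exists d, d', r0, o0, P0, y0, e.
have dP' : inr d \in unzip_poly P0 d d' by rewrite -pE.
have y0P := poly_y0 U; have d'P : inr d' \in unzip_poly P0 d d'.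
  by rewrite unzip_polyE eqxx orbT.
rewrite rE in tipE gE gT W; rewrite pE in W gT.
have sep := pm_sep W; set r := unzip_rot r0 d d' y0 in tipE gE gT sep.
have ed : porbit r0 (inl e) <> porbit r0 (inl d).
  move=> ed; case: gT => [|gT].
    rewrite gE tipE; case: (split_vertex U ed) => -> => /sep => [/(_ d'P dP')|/(_ y0P dP')].
      by case=> /eqP; rewrite eq_sym (negPf (uz_neq U)).
    exact: uz_y0_d U.
  by case: (split_vertex U ed) => h; [apply: (gT _ d'P) | apply: (gT _ y0P)]; rewrite gE h.
split=> //.
  by move: rE oE pE tipE gE; case: (Y) => r' o' P' tip' tg' /= -> -> -> -> ->.
move=> y yP ye; have yP' : y \in unzip_poly P0 d d' by rewrite !inE yP !orbT.
have yd : y != inr d by apply: contraTneq yP => ->; exact: uz_d U.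
have yd' : y != inr d' by apply: contraTneq yP => ->; exact: uz_d' U.
have : porbit r y == porbit r (inl e) by rewrite (vertex_unchanged U) ?ye.
move=> /eqP yre; case: gT => [|gT]; last by apply: (gT _ yP'); rewrite gE.
by rewrite gE tipE -yre => /(sep _ _ yP' dP')/eqP; rewrite (negPf yd).
Qed.
End ZipTip.

Section Preimages.
Variables (k : nat) (d d' : D) (r0 o0 : {perm T}) (P0 : {set T}) (y0 : T) (e0 : D).
Hypotheses (U : unzippable r0 o0 P0 d d' y0) (W0 : polygon_map nv nf k r0 o0 P0).
Hypothesis e0d : porbit r0 (inl e0) <> porbit r0 (inl d).
Hypothesis e0P : forall y, y \in P0 -> porbit r0 y <> porbit r0 (inl e0).
Let r := unzip_rot r0 d d' y0.
Let Y := GMap r (unzip_opp o0 d d') (unzip_poly P0 d d') (porbit r (inr d)) (porbit r (inl e0)).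
Let Y0 y := GMap r0 o0 P0 (porbit r0 y) (porbit r0 (inl e0)).

Let W2 : polygon_map nv nf (#|P0|./2) r0 o0 P0.
Proof. by rewrite (pm_card W0) doubleK. Qed.

Lemma zip_tipped y : y \in P0 -> tipped_map k (Y0 y).
Proof.
case: y => a yP; first by rewrite (negPf (pm_inl W0 a)) in yP.
split=> //=; first by exists a.
by exists e0 => //; right.
Qed.

Lemma unzip_zip_tip M s y : marked M -> (0 < k)%N -> size s = k -> grows M s ->
    y \in P0 -> unzip_all M s = Y0 y ->
  [/\ grows M (rcons s d), unzip_all M (rcons s d) = Y & target M \notin cluster M s].
Proof.
move=> MM k0 sk gs yP sY; have UN := unzipped_all MM gs; rewrite sY in UN.
have s0 : s <> [::] by move=> s0; move: k0; rewrite -sk s0.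
have d'E : drev M d = d'.
  by have := un_opp UN (uz_d U); rewrite /= (uz_od U) => -[].
have tC : target M \notin cluster M s.
  rewrite (target_cluster MM UN); apply/existsP => -[z /andP[zP]] /=.
  by rewrite -eq_porbit_mem => /eqP; exact: e0P.
have hC : dhead M d \notin cluster M s.
  apply/negP => /(un_cluster UN)[[z zP]|[] //] /=.
  by rewrite d'E; exact: uz_off U _ zP.
have dC : dtail M d \in cluster M s.
  apply/(un_cluster UN); left; case: (uz_y0 U) => [[P00 _]|[y0P y0E]]; last by exists y0.
  by rewrite P00 inE in yP.
split=> //; first by rewrite growth_rcons gs tC dC.
rewrite unzip_all_rcons sY.
have := @unzipE D nv nf M (Y0 y) d y0 W2; rewrite d'E => /(_ U) -> /=.
by rewrite (bigcup_porbit_unzip U e0d).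
Qed.

(** By [pm_sep] the tip of [Y] carries a single polygon dart, which forces [d2]; [unzip_step_inj]
    then recovers everything except the former tip. *)
Lemma unzip_preimage M s d2 : marked M -> size s = k -> grows M (rcons s d2) ->
    unzip_all M (rcons s d2) = Y ->
  [/\ d2 = d, grot (unzip_all M s) = r0, gopp (unzip_all M s) = o0,
      gpoly (unzip_all M s) = P0 & gtarget (unzip_all M s) = porbit r0 (inl e0)].
Proof.
move=> MM sk gsd sY; have gs : grows M s by move: gsd; rewrite growth_rcons => /and4P[].
have UN := unzipped_all MM gs; have [y0' U'] := un_unzippable MM UN gsd.
have UN' := un_unzip MM UN gsd; rewrite -unzip_all_rcons sY in UN'.
have W' := un_map UN'; move: sY; rewrite unzip_all_rcons.
have Wh : polygon_map nv nf (#|gpoly (unzip_all M s)|./2) (grot (unzip_all M s))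
    (gopp (unzip_all M s)) (gpoly (unzip_all M s)).
  by rewrite (half_card_poly UN); exact: un_map UN.
have [et tE gE] := un_target UN.
have etd : porbit (grot (unzip_all M s)) (inl et) <> porbit (grot (unzip_all M s)) (inl d2).
  move: gsd; rewrite growth_rcons => /and4P[_ tC dC _] h.
  have := un_off UN (e := et) d2; rewrite -tE tC => /(_ isT); rewrite h eqxx => /esym/eqP h2.
  by rewrite -h2 dC in tC.
rewrite (unzipE Wh U') gE (bigcup_porbit_unzip U' etd) => -[er eo ep etip etg].
have d2d : d2 = d.
  have dP : inr d \in unzip_poly P0 d d' by rewrite unzip_polyE eqxx.
  have d2P : inr d2 \in unzip_poly P0 d d' by rewrite -ep unzip_polyE eqxx.
  have h : porbit r (inr d2) = porbit r (inr d) by rewrite -etip er.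
  by case: (pm_sep W' d2P dP h).
subst d2; have [h1 h2 h3 h4 h5] := unzip_step_inj U' U er eo ep.
split=> //; rewrite h1; have := old_vertexP U; rewrite -/r => /(_ (inl et) (inl e0)).
rewrite !old_vertex_inl => -> //.
by rewrite -etg er.
Qed.

End Preimages.

End Reshuffling.

Section ReshufflingSums.
Local Open Scope ring_scope.
Variables (R : realType) (D : finType) (nv nf : nat).
Local Notation T := (D + D)%type.
Implicit Types (M : dmap D) (Y : gmap D) (d e : D) (s : seq D).

Local Notation cluster M s := (clus M [set seed M] s).
Local Notation tip M s := (endpoint M (seed M) s).
Local Notation marked := (@marked_map D nv nf).
Local Notation grows M s := (growth M [set seed M] s).
Local Notation stepping := (dmap D -> {set {set D}} -> {set D} -> D -> R).
Local Notation weight tau M s := (step_weight M (tau M) [set seed M] (seed M) s).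

(* When the last unzipped edge is zipped up, the weights of the possible
   positions [y] of the previous tip add up to 1. *)
Definition balanced (tau : stepping) : Prop :=
  (forall M d, marked M -> dtail M d = seed M -> tau M [set seed M] (seed M) d = 1) /\
  (forall k (r0 o0 : {perm T}) (P0 : {set T}) e0 d, polygon_map nv nf k r0 o0 P0 ->
     (forall y, y \in P0 -> porbit r0 y <> porbit r0 (inl e0)) ->
     (exists2 y, y \in P0 & porbit r0 y = porbit r0 (inl d)) ->
   exists2 c : T -> R, \sum_(y in P0) c y = 1 &
     forall M s y, marked M -> s <> [::] -> grows M s -> y \in P0 ->
       unzip_all M s = GMap r0 o0 P0 (porbit r0 y) (porbit r0 (inl e0)) ->
       target M \notin cluster M s ->
     tau M (cluster M s) (tip M s) d = c y).

Lemma sum_eq_corner k (r0 o0 : {perm T}) (P0 : {set T}) d : polygon_map nv nf k r0 o0 P0 ->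
  (exists2 y, y \in P0 & porbit r0 y = porbit r0 (inl d)) ->
  \sum_(y in P0) (inl d \in porbit r0 y)%:R = 1 :> R.
Proof.
move=> W [y yP yd]; rewrite (bigD1 y) //= -eq_porbit_mem yd eqxx big1 ?addr0 //.
move=> y' /andP[y'P]; case: (boolP (_ \in _)) => //.
rewrite -eq_porbit_mem -yd => /eqP yy' /eqP[].
exact/esym/(pm_sep W).
Qed.

Lemma path_balanced : balanced (@path_step R D).
Proof.
split=> [M d _ ds|k r0 o0 P0 e0 d W _ dP]; first by rewrite /path_step ds eqxx.
exists (fun y => (inl d \in porbit r0 y)%:R); first exact: sum_eq_corner W dP.
move=> M s y MM s0 gs yP sY _; have UN := unzipped_all MM gs.
by rewrite /path_step -(un_tip UN) sY.
Qed.

Lemma dla_balanced : balanced (@dla_step R D).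
Proof.
split=> [M d [map_M _ _ [sP tP] st] _|k r0 o0 P0 e0 d W e0P dP]; first exact: harm_seed.
(* If no growing sequence leads to the zipped map, for any tip, the condition on [c] is void and any
   weights of sum 1 will do. Otherwise one such preimage serves to compute the harmonic measure at
   every corner, which the other preimages share even though their tips differ. *)
have [[M1 [s1 [y1 [MM1 s10 gs1 y1P [sY1 tC1]]]]]|no] := pselect (exists M1 s1 y1,
    [/\ marked M1, s1 <> [::], grows M1 s1, y1 \in P0 &
      unzip_all M1 s1 = GMap r0 o0 P0 (porbit r0 y1) (porbit r0 (inl e0)) /\
      target M1 \notin cluster M1 s1]); last first.
  exists (fun y => (inl d \in porbit r0 y)%:R); first exact: sum_eq_corner W dP.
  by move=> M s y MM s0 gs yP sY tC; case: no; exists M, s, y.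
have UN1 := unzipped_all MM1 gs1; rewrite sY1 in UN1.
exists (fun y => \sum_(d | (inl d \in porbit r0 y) && (dhead M1 d \notin cluster M1 s1))
   clustergreen R M1 (cluster M1 s1) (target M1) (dhead M1 d)).
  by have := sum_tips R MM1 UN1 s10 tC1.
move=> M s y MM s0 gs yP sY tC; have UN := unzipped_all MM gs; rewrite sY in UN.
rewrite /dla_step (harm_tip R UN tC).
exact: (same_harm_sum R UN UN1 s0 s10 erefl erefl erefl erefl).
Qed.

Definition unzip_sum (tau : stepping) k Y : R := \sum_(M | `[< marked M >])
  seqsum k (fun s => (grows M s && (unzip_all M s == Y))%:R * weight tau M s).

(** Unzipping forgets the root. After one step, both permutations, the seed, the target and [d] are
    determined by [Y], so the preimages are the maps [Mx x], one for each root dart [x] and each of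
    weight 1. *)
Lemma unzip_sum1 tau Y : balanced tau -> tipped_map nv nf 1 Y -> unzip_sum tau 1 Y = #|D|%:R.
Proof.
move=> [tau1 _] YT; have [d [d' [r0 [o0 [P0 [y0 [e0 [U W0 YE e0d e0P]]]]]]]] := zip_tip YT.
have [[rho om] /= [P00 r0E o0E MP]] := polygon_map_closed W0; subst P0 r0 o0.
pose Mx x := DMap rho om x (porbit rho d) (porbit rho e0).
have W2 : polygon_map nv nf (#|(set0 : {set T})|./2) (inl_perm rho) (inl_perm om) set0.
  by rewrite (pm_card W0).
have omd : om d = d' by have := uz_od U; rewrite inl_permE => -[].
have A x : [/\ marked (Mx x), grows (Mx x) [:: d] & unzip_all (Mx x) [:: d] = Y].
  have [map_M cv cf] := MP x (porbit rho d) (porbit rho e0).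
  have ed : porbit rho d != porbit rho e0.
    by apply/eqP => h; apply: e0d; apply/eqP; rewrite porbit_inl_eq h.
  split.
  - by split=> //; split; apply: imset_f.
  - rewrite /= !inE eq_sym ed eqxx /= andbT; apply/eqP.
    rewrite /dhead /dtail /= omd => h; apply: (uz_head U); apply/eqP.
    by rewrite porbit_inl_eq h.
  have := @unzipE D nv nf (Mx x) (gmap_init (Mx x)) d y0.
  rewrite /unzip_all /= omd => /(_ W2 U) ->.
  by rewrite -porbit_inl (bigcup_porbit_unzip U e0d) YE.
have B M d2 : marked M -> grows M [:: d2] -> unzip_all M [:: d2] = Y ->
    M = Mx (rootd M) /\ d2 = d.
  move=> MM gs sY; have [] := @unzip_preimage _ _ _ 0 _ _ _ _ _ _ e0 U M [::] d2 MM erefl gs.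
    by rewrite sY.
  move=> d2d /=; rewrite porbit_inl => /inl_perm_inj rE /inl_perm_inj oE _.
  move=> /(imset_inj inl_inj) tE; split=> //; rewrite {}d2d in gs.
  move: gs; rewrite /= !inE => /and4P[_ /eqP ds _ _].
  by move: rE oE tE ds; rewrite /Mx /dtail; case: M {MM sY} => r o x sd tg /= -> -> -> <-.
rewrite /unzip_sum.
transitivity (\sum_(M in Mx @: [set: D]) 1 : R); last first.
  rewrite sumr_const card_imset ?cardsT // => x x'.
  by move=> /(congr1 (@rootd D)).
rewrite big_mkcond [RHS]big_mkcond; apply: eq_bigr => M _.
case: asboolP => MM; last first.
  by case: imsetP => // -[x _ Mx_]; case: MM; rewrite Mx_; case: (A x).
case: imsetP => [[x _ ->]|no] /=.
  have [_ gs sY] := A x; rewrite (bigD1 d) //= [X in _ + X]big1 ?addr0.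
    rewrite sY eqxx andbT mulr1 tau1; [|by case: (A x)|by []].
    by move: gs => /= ->; rewrite mulr1.
  move=> d2 /negPf d2d; case: andP => [[g /eqP e]|_]; last by rewrite mul0r.
  by have [_ h] := B (Mx x) d2 (let: And3 m _ _ := A x in m) g e; rewrite h eqxx in d2d.
rewrite big1 // => d2 _; case: andP => [[g /eqP e]|_]; last by rewrite mul0r.
by have [h _] := B M d2 MM g e; case: no; exists (rootd M).
Qed.

(** The last dart is forced, so the sum runs over prefixes, grouped by the position [y] of the
    former tip. The last factor is [c y] by [balanced], the prefixes for a given [y] have total
    weight [#|D|] by hypothesis, and the [c y] add up to 1. *)
Lemma unzip_sum_step tau k Y : balanced tau -> tipped_map nv nf k.+2 Y ->
  (forall Y', tipped_map nv nf k.+1 Y' -> unzip_sum tau k.+1 Y' = #|D|%:R) ->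
  unzip_sum tau k.+2 Y = #|D|%:R.
Proof.
move=> [_ tau2] YT IH.
have [d [d' [r0 [o0 [P0 [y0 [e0 [U W0 YE e0d e0P]]]]]]]] := zip_tip YT.
have y0P : y0 \in P0 /\ porbit r0 y0 = porbit r0 (inl d).
  case: (uz_y0 U) => [[P00 _]|[]] //.
  by have := pm_card W0; rewrite P00 cards0.
have [|c c1 cE] := tau2 _ _ _ _ _ d W0 e0P; first by exists y0; case: y0P.
pose Y0 y := GMap r0 o0 P0 (porbit r0 y) (porbit r0 (inl e0)).
have Y0T y : y \in P0 -> tipped_map nv nf k.+1 (Y0 y) by exact: zip_tipped W0 e0P _.
transitivity (\sum_(y in P0) c y * unzip_sum tau k.+1 (Y0 y)); last first.
  under eq_bigr => y yP do rewrite (IH _ (Y0T y yP)).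
  by rewrite -mulr_suml c1 mul1r.
rewrite /unzip_sum; under [RHS]eq_bigr do rewrite mulr_sumr.
rewrite [RHS]exchange_big; apply: eq_bigr => M /asboolP MM.
under [RHS]eq_bigr do rewrite -seqsumZ.
rewrite -[RHS]seqsum_sum -[LHS]/(seqsum k.+2 _) seqsum_rcons; apply: eq_seqsum => s sk.
have B d2 : grows M (rcons s d2) -> unzip_all M (rcons s d2) = Y ->
    d2 = d /\ exists2 y, y \in P0 & unzip_all M s = Y0 y.
  move=> gsd sY; have := @unzip_preimage _ _ _ _ _ _ _ _ _ _ e0 U M s d2 MM sk gsd.
  rewrite sY => /(_ YE)[-> rE oE pE tE]; split=> //.
  have gs : grows M s by move: gsd; rewrite growth_rcons => /and4P[].
  have [|a aP tipE] := un_gtip (unzipped_all MM gs); first by move=> s0; move: sk; rewrite s0.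
  rewrite pE in aP; exists (inr a) => //.
  by case: (unzip_all M s) rE oE pE tipE tE => ? ? ? ? ? /= -> -> -> -> ->.
have A y : grows M s -> y \in P0 -> unzip_all M s = Y0 y ->
    [/\ grows M (rcons s d), unzip_all M (rcons s d) = Y & target M \notin cluster M s].
  by move=> gs yP sY; rewrite YE; apply: (unzip_zip_tip U W0 e0d e0P MM _ sk gs yP sY).
have [gs|ngs] := boolP (grows M s); last first.
  rewrite big1 => [|d2 _]; last by rewrite growth_rcons (negPf ngs) mul0r.
  by rewrite big1 // => y _; rewrite mul0r mulr0.
have [[y yP sY]|no] := pselect (exists2 y, y \in P0 & unzip_all M s = Y0 y); last first.
  rewrite big1 => [|d2 _]; last first.
    by case: andP => [[g /eqP /(B _ g)[_]]//|_]; rewrite mul0r.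
  rewrite big1 // => y yP; case: eqP => [h|_]; last by rewrite mul0r mulr0.
  by case: no; exists y.
have [gsd sdY tC] := A y gs yP sY.
rewrite (bigD1 d) //= gsd sdY eqxx mul1r [X in _ + X]big1 ?addr0; last first.
  move=> d2 /negPf d2d; case: andP => [[g /eqP /(B _ g)[h]]|_]; last by rewrite mul0r.
  by rewrite h eqxx in d2d.
rewrite (bigD1 y) //= sY eqxx mul1r [X in _ + X]big1 ?addr0; last first.
  move=> y' /andP[y'P y'y]; case: eqP => [[h]|_]; last by rewrite mul0r mulr0.
  by rewrite (pm_sep W0 yP y'P h) eqxx in y'y.
have s0 : s <> [::] by move=> s0; move: sk; rewrite s0.
by rewrite step_weight_rcons (cE M s y) // mulrC.
Qed.

Lemma unzip_sumE tau k Y : balanced tau ->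
  unzip_sum tau k.+1 Y = if `[< tipped_map nv nf k.+1 Y >] then #|D|%:R else 0.
Proof.
move=> btau; case: asboolP => [|nT].
  by elim: k Y => [|k IH] Y YT; [exact: unzip_sum1 | exact: unzip_sum_step].
rewrite /unzip_sum big1 // => M /asboolP MM.
apply: seqsum0 => s; case/lastP: s => // s d; rewrite size_rcons => -[sk].
case: andP => [[g /eqP e]|_]; last by rewrite mul0r.
by case: nT; rewrite -e -sk; exact: tipped_unzip.
Qed.

Lemma reshuffle tau tau' k (F : gmap D -> R) : balanced tau -> balanced tau' ->
  \sum_(M | `[< marked M >]) seqsum k (fun s => F (unzip_all M s) * growth_weight M (tau M) s) =
  \sum_(M | `[< marked M >]) seqsum k (fun s => F (unzip_all M s) * growth_weight M (tau' M) s).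
Proof.
(* For [k = 0] no step has been chosen and the two weights coincide. *)
move=> btau btau'; case: k => [|k]; first by apply: eq_bigr.
pose kappa M s := clusterdet R M (cluster M s) * harm R M (cluster M s) (tip M s).
have E (t : stepping) : \sum_(M | `[< marked M >])
     seqsum k.+1 (fun s => F (unzip_all M s) * growth_weight M (t M) s) =
   \sum_Y F Y * \sum_(M | `[< marked M >]) seqsum k.+1
     (fun s => (grows M s && (unzip_all M s == Y))%:R * (kappa M s * weight t M s)).
  under [RHS]eq_bigr do rewrite mulr_sumr.
  rewrite [RHS]exchange_big; apply: eq_bigr => M _.
  under [RHS]eq_bigr do rewrite -seqsumZ.
  rewrite -[RHS]seqsum_sum -[LHS]/(seqsum k.+1 _); apply: eq_seqsum => s _.
  rewrite (bigD1 (unzip_all M s)) //= eqxx andbT [X in _ + X]big1 ?addr0; last first.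
    by move=> Y YE; rewrite eq_sym (negPf YE) andbF mul0r mulr0.
  rewrite /growth_weight; case: (growth _ _ _); last by rewrite mul0r.
  by rewrite mul1r.
rewrite !E; apply: eq_bigr => Y _; congr (_ * _).
have [[M1 [s1 [MM1 g1 sk1 e1]]]|no] := pselect (exists M s,
    [/\ marked M, grows M s, size s = k.+1 & unzip_all M s = Y]); last first.
  rewrite !big1 // => M /asboolP MM; apply: seqsum0 => s sk.
    by case: andP => [[g /eqP e]|_]; [case: no; exists M, s | rewrite mul0r].
  by case: andP => [[g /eqP e]|_]; [case: no; exists M, s | rewrite mul0r].
have UN1 := unzipped_all MM1 g1; rewrite e1 in UN1.
(* [kappa] takes the same value at all preimages of [Y], so it is taken out at the representative
   [M1], [s1]. *)
have K (t : stepping) : \sum_(M | `[< marked M >]) seqsum k.+1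
     (fun s => (grows M s && (unzip_all M s == Y))%:R * (kappa M s * weight t M s)) =
   kappa M1 s1 * unzip_sum t k.+1 Y.
  rewrite mulr_sumr; apply: eq_bigr => M /asboolP MM.
  rewrite -seqsumZ -[LHS]/(seqsum k.+1 _); apply: eq_seqsum => s sk.
  case: andP => [[g /eqP e]|_]; last by rewrite !mul0r mulr0.
  rewrite !mul1r; congr (_ * _).
  have UN := unzipped_all MM g; rewrite e in UN.
  have s0 : s <> [::] by move=> h; move: sk; rewrite h.
  have s10 : s1 <> [::] by move=> h; move: sk1; rewrite h.
  rewrite /kappa (same_harm R MM MM1 UN UN1 s0 s10); congr (_ * _).
  exact: (same_clusterdet R UN UN1 s0 s10 erefl erefl erefl).
by rewrite !K !unzip_sumE.
Qed.

End ReshufflingSums.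

(** * The laws of the unzipped maps *)

Section IsoClass.
Variable D : finType.
Implicit Type M : dmap D.

(* Rooted maps have no symmetries, hence all isomorphism classes of maps have
   the same size and the weight of a map is its number of spanning trees. *)
Lemma relabel_inj M : is_map M -> injective (fun f : {perm D} => relabel f M).
Proof.
move=> map_M f g [vE oE rE _ _].
have W := closed_polygon_map map_M erefl erefl.
pose S := [set d | f d == g d].
have rS : rootd M \in S by rewrite inE rE.
have step (u : {perm D}) : (u ^ f)%g = (u ^ g)%g -> forall d, d \in S -> u d \in S.
  move=> ufg d; rewrite !inE => /eqP fgd.
  have := congr1 (fun h : {perm D} => h (f d)) ufg.
  by rewrite /= permJ fgd permJ => ->.
have full := pm_conn W rS; apply/permP => d; apply/eqP.
suff : d \in S by rewrite inE.
apply: full => [b|b c bS /eqP|b c bS _]; first by rewrite inE.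
  rewrite porbit_inl_eq eq_porbit_mem => /porbitP[i ->].
  by elim: i => [|i IH]; rewrite ?expg0 ?perm1 // expgSr permM; exact: step.
by rewrite inl_permE => -[<-]; exact: step.
Qed.

Lemma card_iso_class M : is_map M -> #|iso_class M| = #|{perm D}|.
Proof. by move=> map_M; rewrite card_imset //; exact: relabel_inj. Qed.

End IsoClass.

Section Laws.
Local Open Scope ring_scope.
Variables (R : realType) (n m : nat).
Hypothesis le_mn : (m <= n)%N.
Local Notation D := 'I_(2 * n).
Local Notation bound := #|{set D}|.+1.
Local Notation marked := (@marked_map D m.+1 (n - m).+1).

(** [le_mn] makes the subtraction exact, and the two prescribed counts then imply Euler's
    relation. *)
Lemma decorated_marked (M : dmap D) : decorated m M <-> marked M.
Proof.
split=> [[[map_M _] cv cf [sP tP] st]|[map_M cv cf [sP tP] st]]; first by split.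
split=> //; split=> //.
by rewrite /planar cv cf card_ord; lia.
Qed.

Lemma map_law_marked : exists c : R, forall M : dmap D, marked M ->
  map_law R m M = c * (nb_spanning_trees M)%:R.
Proof.
exists ((#|{perm D}|%:R)^-1 / \sum_(M' : dmap D | `[< decorated m M' >]) map_weight R M') => M MM.
rewrite /map_law asboolT; last exact/decorated_marked.
have [map_M _ _ _ _] := MM.
by rewrite /map_weight card_iso_class // -mulrA mulrC.
Qed.

Lemma map_law_unmarked (M : dmap D) : ~ marked M -> map_law R m M = 0.
Proof. by move=> nM; rewrite /map_law asboolF // => /decorated_marked. Qed.

Lemma nb_spanning_trees_neq0 (M : dmap D) : marked M -> (nb_spanning_trees M)%:R != 0 :> R.
Proof.
move=> [map_M _ _ [sP _] _]; rewrite (nb_spanning_treesE map_M sP).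
exact: (clusterdet_neq0 map_M _ (set11 _) sP).
Qed.

(** [N] is left free because the law of the first [k] steps needs a range that depends on [k]. *)
Lemma joint_probE (c : R) (P : dmap D -> seq D -> \bar R)
    (tau : dmap D -> {set {set D}} -> {set D} -> D -> R) (A : dmap D -> seq D -> Prop) N :
    (forall M, marked M -> map_law R m M = c * (nb_spanning_trees M)%:R) ->
    (forall M s, marked M -> P M s =
       (stopped_weight M (tau M) s / (nb_spanning_trees M)%:R)%:E) ->
    (forall M s, (0 <= P M s)%E) -> (bound <= N)%N ->
  joint_prob m P A = (c * \sum_(M | `[< marked M >]) \sum_(i < N)
     seqsum i (fun s => `[< A M s >]%:R * stopped_weight M (tau M) s))%:E.
Proof.
move=> cE PE P0 bN; rewrite /joint_prob mulr_sumr -sumEFin [RHS]big_mkcond.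
apply: eq_bigr => M _; case: asboolP => MM; last by rewrite map_law_unmarked // mul0e.
have KN0 := nb_spanning_trees_neq0 MM; rewrite (cE _ MM).
under eq_esum do rewrite PE //.
rewrite (esum_seqsum (N := N)); first last.
- move=> s sN; rewrite stopped_weight_oversize ?mul0r //.
  exact: leq_trans bN sN.
- by move=> s; rewrite -lee_fin -PE.
rewrite -EFinM; congr EFin; rewrite -mulrA; congr (_ * _).
rewrite mulr_sumr; apply: eq_bigr => i _; rewrite -seqsumZ.
by apply: eq_seqsum => s _; rewrite mulrCA; congr (_ * _); rewrite mulrCA divff // mulr1.
Qed.

Lemma lerw_law_ge0 (M : dmap D) s : (0 <= lerw_law R M s)%E.
Proof. by apply: esum_ge0 => p _; rewrite lee_fin walk_prob_ge0. Qed.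

Lemma dla_prob_ge0 (M : dmap D) C s : (0 <= dla_prob R M C s)%E.
Proof.
elim: s C => [|d s IH] C /=; case: ifP => // _.
by apply: mule_ge0 => //; apply: esum_ge0 => p _; rewrite lee_fin walk_prob_ge0.
Qed.

Lemma growth_reshuffle i (F : gmap D -> R) :
  \sum_(M : dmap D | `[< marked M >])
     seqsum i (fun s => F (unzip_all M s) * growth_weight M (dla_step R M) s) =
  \sum_(M : dmap D | `[< marked M >])
     seqsum i (fun s => F (unzip_all M s) * growth_weight M (path_step R M) s).
Proof. by apply: (@reshuffle R D _ _ (@dla_step R D) (@path_step R D)); [exact: dla_balanced | exact: path_balanced]. Qed.

(** That the target has been reached is visible on the unzipped map, so the stopping indicator can
    be absorbed into [F]. *)
Lemma stopped_reshuffle i (F : gmap D -> R) :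
  \sum_(M : dmap D | `[< marked M >])
     seqsum i (fun s => F (unzip_all M s) * stopped_weight M (dla_step R M) s) =
  \sum_(M : dmap D | `[< marked M >])
     seqsum i (fun s => F (unzip_all M s) * stopped_weight M (path_step R M) s).
Proof.
have E (tau : dmap D -> {set {set D}} -> {set D} -> D -> R) :
    \sum_(M : dmap D | `[< marked M >])
       seqsum i (fun s => F (unzip_all M s) * stopped_weight M (tau M) s) =
    \sum_(M : dmap D | `[< marked M >])
       seqsum i (fun s => (F (unzip_all M s) * (target_reached (unzip_all M s))%:R)
          * growth_weight M (tau M) s).
  apply: eq_bigr => M /asboolP MM; apply: eq_seqsum => s _.
  rewrite /stopped_weight -mulrA; congr (_ * _).
  rewrite /growth_weight; case: ifP => gs; last by rewrite !mulr0.
  by rewrite (target_cluster MM (unzipped_all MM gs)).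
by rewrite !E (growth_reshuffle i (fun Y => F Y * (target_reached Y)%:R)).
Qed.

Lemma joint_prob_lerw_dla : exists c : R,
  (forall A N, (bound <= N)%N -> pr_lerw R n m A = (c * \sum_(M | `[< marked M >]) \sum_(i < N)
     seqsum i (fun s => `[< A M s >]%:R * stopped_weight M (path_step R M) s))%:E) /\
  (forall A N, (bound <= N)%N -> pr_dla R n m A = (c * \sum_(M | `[< marked M >]) \sum_(i < N)
     seqsum i (fun s => `[< A M s >]%:R * stopped_weight M (dla_step R M) s))%:E).
Proof.
have [c cE] := map_law_marked; exists c; split=> A N bN.
  apply: joint_probE => // [M s [map_M _ _ [sP tP] st]|M s]; last exact: lerw_law_ge0.
  exact: lerw_lawE.
apply: joint_probE => // [M s [map_M _ _ [sP tP] st]|M s]; last exact: dla_prob_ge0.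
exact: dla_lawE.
Qed.

Lemma marked_fair (M : dmap D) : marked M ->
  fair_step M (dla_step R M) /\ fair_step M (path_step R M).
Proof.
move=> [map_M _ _ [sP tP] _]; split; [exact: dla_fair | exact: path_fair].
Qed.

End Laws.

Theorem proposition2p3 (R : realType) (n m : nat)
    (m_gt0 : (0 < m)%N) (le_mn : (m <= n)%N) :
  [/\ (* (i) *)
      forall j : nat,
        pr_dla R n m (fun _ s => size s = j)
        = pr_lerw R n m (fun _ s => size s = j),
      (* (ii) *)
      forall (k : nat) (Y : gmap 'I_(2 * n)),
        pr_lerw R n m (fun M s => gmap_iso (unzip_all M (take k s)) Y)
        = pr_dla R n m (fun M s => gmap_iso (unzip_all M (take k s)) Y)
    & (* (iii) *)
      forall Y : gmap 'I_(2 * n),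
        pr_lerw R n m (fun M s => gmap_iso (unzip_all M s) Y)
        = pr_dla R n m (fun M s => gmap_iso (unzip_all M s) Y)].
Proof.
have [c [lE dE]] := joint_prob_lerw_dla R le_mn; split.
- move=> j; rewrite (lE _ _ (leqnn _)) (dE _ _ (leqnn _)); congr (c * _)%:E%R.
  rewrite exchange_big [RHS]exchange_big; apply: eq_bigr => i _.
  (* At fixed length [i] the event is constant, hence trivially a function of the unzipped map. *)
  have E (tau : dmap 'I_(2 * n) -> {set {set 'I_(2 * n)}} -> {set 'I_(2 * n)} -> 'I_(2 * n) -> R) :
    (\sum_(M : dmap 'I_(2 * n) | `[< marked_map m.+1 (n - m).+1 M >])
      seqsum i (fun s => `[< size s = j >]%:R * stopped_weight M (tau M) s) =
     \sum_(M : dmap 'I_(2 * n) | `[< marked_map m.+1 (n - m).+1 M >])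
      seqsum i (fun s => (fun=> (i == j :> nat)%:R) (unzip_all M s) * stopped_weight M (tau M) s))%R.
    apply: eq_bigr => M _; apply: eq_seqsum => s si; rewrite si.
    by have -> : `[< i = j :> nat >] = (i == j :> nat) by apply/asboolP/eqP.
  rewrite (E (@dla_step R _)) (E (@path_step R _)).
  exact: (stopped_reshuffle _ i (fun=> (i == j :> nat)%:R)%R).
- move=> k Y; have kN : (#|{set 'I_(2 * n)}|.+1 <= k + #|{set 'I_(2 * n)}|.+1)%N by exact: leq_addl.
  rewrite (lE _ _ kN) (dE _ _ kN); congr (c * _)%:E%R.
  (* Sequences that stop before length [k] and those that reach length [k] are compared
     separately. *)
  have E (tau : dmap 'I_(2 * n) -> {set {set 'I_(2 * n)}} -> {set 'I_(2 * n)} -> 'I_(2 * n) -> R) :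
     (forall M, marked_map m.+1 (n - m).+1 M -> fair_step M (tau M)) ->
    (\sum_(M : dmap 'I_(2 * n) | `[< marked_map m.+1 (n - m).+1 M >])
       \sum_(i < k + #|{set 'I_(2 * n)}|.+1)
         seqsum i (fun s => `[< gmap_iso (unzip_all M (take k s)) Y >]%:R * stopped_weight M (tau M) s) =
     \sum_(i < k) \sum_(M : dmap 'I_(2 * n) | `[< marked_map m.+1 (n - m).+1 M >])
         seqsum i (fun s => `[< gmap_iso (unzip_all M s) Y >]%:R * stopped_weight M (tau M) s) +
     \sum_(M : dmap 'I_(2 * n) | `[< marked_map m.+1 (n - m).+1 M >])
         seqsum k (fun s => `[< gmap_iso (unzip_all M s) Y >]%:R * growth_weight M (tau M) s))%R.
    move=> fair; rewrite [X in _ = (X + _)%R]exchange_big -big_split; apply: eq_bigr => M /asboolP MM.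
    have [map_M _ _ [sP tP] st] := MM.
    exact: (stopped_marginal map_M sP _ (fun s => `[< gmap_iso (unzip_all M s) Y >]%:R)%R k (fair _ MM)).
  rewrite !E; [|by move=> M /(marked_fair R)[]..].
  rewrite (growth_reshuffle _ k (fun Y' => `[< gmap_iso Y' Y >]%:R)%R); congr (_ + _)%R.
  apply: eq_bigr => i _.
  by rewrite (stopped_reshuffle _ i (fun Y' => `[< gmap_iso Y' Y >]%:R)%R).
move=> Y; rewrite (lE _ _ (leqnn _)) (dE _ _ (leqnn _)); congr (c * _)%:E%R.
rewrite exchange_big [RHS]exchange_big; apply: eq_bigr => i _.
by rewrite (stopped_reshuffle _ i (fun Y' => `[< gmap_iso Y' Y >]%:R)%R).
Qed.
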